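(* Let $\mathcal{Z}$ be a $\tau$-periodic orbit of the conservative system $\dot x=JDH(x)$ satisfying the following three assumptions (terms defined in the context), where $m,l$ are relatively prime positive integers, $z\in\mathcal{Z}$ and $\Pi=X_0(m\tau;z)$: (A.1) $\mathcal{Z}$ is $m$-normal and its Melnikov function has a simple zero at $0$, i.e. $M_{m:l}(0)=0$ and $M_{m:l}'(0)\neq 0$; (A.2) all eigenvalues of $\Pi$ lie on the unit circle in $\mathbb{C}$; (A.3) the algebraic and geometric multiplicities of the eigenvalue $+1$ of $\Pi$ are $2$ and $1$, respectively. Let $\mathcal{Z}_\varepsilon$ be the $l\delta(\varepsilon)$-periodic orbit of $\dot x=JDH(x)+\varepsilon g(x,t;\delta,\varepsilon)$ that perturbs from $\mathcal{Z}$, let $T(h)$ be the minimal-period function of the family $\mathcal{F}$ with $h=H(z)$, and let $\mathcal{T}$ be the tangent space of $\mathcal{F}$ at $z$. Assume that, other than two eigenvalues equal to $+1$, the remaining eigenvalues of $\Pi$ are $n-1$ distinct complex conjugate pairs. For $k=1,\dots,n-1$, denote by $\mathcal{N}_k\subset\mathcal{N}$ the strongly invariant subspace for $\Pi$ related to the $k$th pair of eigenvalues. Then $\mathcal{Z}_\varepsilon$ is asymptotically stable for $\varepsilon>0$ small enough if each of the following conditions holds: (i) $T'(h)M_{m:l}'(0)>0$ and $C_{\mathcal{T}}>0$; (ii) $C_{\mathcal{N}_k}>0$ for all $k=1,\dots,n-1$.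
   Context: System. Let $n\ge 1$, $x=(q,p)\in\mathbb{R}^{2n}$, $J=\begin{bmatrix}0&I\\-I&0\end{bmatrix}$. Consider $$\dot x=JDH(x)+\varepsilon g(x,t;\delta,\varepsilon),\qquad \varepsilon\ge 0,$$ on a subset $\mathcal{U}\subseteq\mathbb{R}^{2n}$, where $H(q,p)=\frac12\langle p-G_1(q),M^{-1}(q)(p-G_1(q))\rangle-G_0(q)+V(q)$ with $M(q)$ symmetric positive definite, and $g(x,t;\delta,\varepsilon)=(0,\,Q(q,F(q,p),t;\delta,\varepsilon))$ with $F(q,p)=M^{-1}(q)(p-G_1(q))$. The perturbation $Q$ is periodic in $t$ with period $\delta$. $H$ is $C^{r_0+1}$ with $r_0\ge 3$, and $g$ is $C^{r_0-1}$ in $t$ and $C^{r_0}$ in its other arguments. Let $x(t;\xi,\delta,\varepsilon)$ be the solution with initial condition $\xi$ at $t=0$, and $x_0(t;\xi)=x(t;\xi,\delta,0)$. Let $X(t;\xi,\delta,\varepsilon)$ solve the variational equation $\dot X=(JD^2H(x(t;\xi,\delta,\varepsilon))+\varepsilon\partial_xg(x(t;\xi,\delta,\varepsilon),t;\delta,\varepsilon))X$, $X(0)=I$, and $X_0(t;\xi)=X(t;\xi,\delta,0)$. Conservative orbit. $\mathcal{Z}\subset\mathcal{U}$ is a periodic orbit of the system for $\varepsilon=0$ with minimal period $\tau>0$; $z\in\mathcal{Z}$; $m,l$ are relatively prime positive integers; $\Pi=X_0(m\tau;z)$. $\mathcal{Z}$ is called $m$-normal if either (a) the geometric multiplicity of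 the eigenvalue $+1$ of $\Pi$ is $1$, or (b) this geometric multiplicity is $2$ and $JDH(z)\notin\mathrm{range}(\Pi-I)$. An $m$-normal orbit lies in a one-parameter family $\mathcal{F}$ of periodic orbits, parametrized by the values of a scalar function $r$ of a point of an orbit and its period (e.g. $r(z,m\tau)=m\tau$ or $r(z,m\tau)=H(z)$). The Melnikov function is $$M_{m:l}(s)=\int_0^{m\tau}\langle DH(x_0(t+s;z)),\,g(x_0(t+s;z),t;\tau m/l,0)\rangle\,dt.$$ Perturbed orbit. It is known that, under (A.1), for small $\varepsilon>0$ there is an $l\delta(\varepsilon)$-periodic orbit $\mathcal{Z}_\varepsilon$ of the perturbed system, depending smoothly on $\varepsilon$, with initial condition $\xi(\varepsilon)=z+O(\varepsilon)$ and $l\delta(\varepsilon)=m\tau+O(\varepsilon)$, subject to the resonance condition $r(\xi(\varepsilon),l\delta(\varepsilon))=r(z,m\tau)$. Its Floquet multipliers are the eigenvalues of $X(l\delta(\varepsilon);\xi(\varepsilon),\delta(\varepsilon),\varepsilon)$; the orbit is asymptotically stable if all of them lie inside the open unit disk and unstable if at least one lies outside the closed unit disk. Under (A.3), $\mathcal{F}$ is locally parametrized by the value of $H$; $T$ denotes the function giving the minimal period of the orbits of $\mathcal{F}$ near $\mathcal{Z}$ as a function of the value of $H$, so $\tau=T(h)$, $h=H(z)$, and $T'(h)\ne0$. Invariant subspaces and contraction. Let $\mathcal{V}\subseteq\mathbb{R}^{2n}$ be a $2v$-dimensional invariant subspace of $\Pi$, $R_{\mathcal{V}}\in\mathbb{R}^{2n\times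 2v}$ a matrix whose columns form a basis of $\mathcal{V}$, and $B_{\mathcal{V}}$ the unique matrix with $\Pi R_{\mathcal{V}}=R_{\mathcal{V}}B_{\mathcal{V}}$. $\mathcal{V}$ is strongly invariant for $\Pi$ if $\det B_{\mathcal{V}}=1$ and the eigenvalues of $B_{\mathcal{V}}$ are not repeated in the rest of the spectrum of $\Pi$ (each eigenvalue of $B_{\mathcal{V}}$ has the same algebraic multiplicity for $B_{\mathcal{V}}$ and for $\Pi$). The symplectic left inverse of $R_{\mathcal{V}}$ is $S_{\mathcal{V}}=(R_{\mathcal{V}}^\top JR_{\mathcal{V}})^{-1}R_{\mathcal{V}}^\top J$. The volume contraction is $$C_{\mathcal{V}}=-\frac{1}{m\tau v}\int_0^{m\tau}\mathrm{trace}\big(S_{\mathcal{V}}X_0^{-1}(t;z)\,\partial_xg(x_0(t;z),t;m\tau/l,0)\,X_0(t;z)R_{\mathcal{V}}\big)\,dt,$$ which does not depend on the choice of basis. The tangent space $\mathcal{T}$ of $\mathcal{F}$ at $z$ is the two-dimensional strongly invariant subspace for $\Pi$ associated with its eigenvalues equal to $+1$; the normal space $\mathcal{N}$ is the $2(n-1)$-dimensional strongly invariant subspace for $\Pi$ associated with its eigenvalues different from $+1$. *)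

(* Defs.v *)
From HB Require Import structures.
From mathcomp Require Import all_boot all_order all_algebra complex.
From mathcomp Require Import all_classical all_reals all_analysis.

Set Implicit Arguments.
Unset Strict Implicit.
Unset Printing Implicit Defensive.

Import Order.TTheory GRing.Theory Num.Theory.
Import numFieldNormedType.Exports.
Local Open Scope classical_set_scope.
Local Open Scope ring_scope.

Section Calculus.
Variable R : realType.

(* In finite dimension, f is C^(k+1) on an open set iff it is differentiable
   there and all its directional derivatives are C^k. *)
Fixpoint Ck (V W : normedModType R) (k : nat) (O : set V) (f : V -> W) : Prop :=
  match k with
  | 0 => forall x, O x -> {for x, continuous f}
  | k'.+1 => (forall x, O x -> differentiable f x) /\
             (forall v, Ck k' O (fun x => 'D_v f x))
  end.

(* Smoothness on a set that need not be open (here, with a boundary at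
   epsilon = 0) is smoothness of some extension to an open neighbourhood. *)
Definition Ck_on (V W : normedModType R) (k : nat) (D : set V) (f : V -> W) :=
  exists (O : set V) (f' : V -> W),
    [/\ open O, D `<=` O, Ck k O f' & forall x, D x -> f' x = f x].

Definition inner n (u v : 'cV[R]_n) : R := (u^T *m v) 0 0.

Definition grad n (f : 'cV[R]_n -> R) (x : 'cV[R]_n) : 'cV[R]_n :=
  \col_i 'D_(delta_mx i 0 : 'cV[R]_n) f x.

Definition jac n k (f : 'cV[R]_n -> 'cV[R]_k) (x : 'cV[R]_n) : 'M[R]_(k, n) :=
  \matrix_(i, j) ('D_(delta_mx j 0 : 'cV[R]_n) f x) i 0.

Definition spd n (A : 'M[R]_n) :=
  A^T = A /\ forall w : 'cV[R]_n, w != 0 -> 0 < inner w (A *m w).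

Definition minimal_period (E : zmodType) (y : R -> E) (T : R) :=
  [/\ 0 < T, periodic y T & forall s, 0 < s < T -> ~ periodic y s].

(* Solutions of y' = F(y, t) in U on an open set I of times. *)
Definition solution n (U : set 'cV[R]_n) (F : 'cV[R]_n -> R -> 'cV[R]_n)
    (I : set R) (y : R -> 'cV[R]_n) :=
  forall t, I t -> U (y t) /\ is_derive t (1 : R) y (F (y t) t).

Definition forward_solution n (U : set 'cV[R]_n)
    (F : 'cV[R]_n -> R -> 'cV[R]_n) (y : R -> 'cV[R]_n) :=
  exists2 a : R, 0 < a & solution U F `](- a), +oo[ y.

(* Lyapunov stability and attractivity of the solution x of y' = F(y, t). *)
Definition asymptotically_stable n (U : set 'cV[R]_n)
    (F : 'cV[R]_n -> R -> 'cV[R]_n) (x : R -> 'cV[R]_n) :=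
  forall eta : R, 0 < eta -> exists2 rho : R, 0 < rho &
    forall y0 : 'cV[R]_n, `|y0 - x 0| < rho ->
      (exists2 y, forward_solution U F y & y 0 = y0) /\
      (forall y, forward_solution U F y -> y 0 = y0 ->
         (forall t, 0 <= t -> `|y t - x t| < eta) /\
         `|y t - x t| @[t --> +oo] --> (0 : R)).

End Calculus.

Section Spectrum.
Variable R : realType.

Definition to_C n (A : 'M[R]_n) : 'M[R[i]]_n := map_mx (real_complex R) A.

(* `eigenspace` consists of left (row) eigenvectors, whence the transpose. *)
Definition geo_mult n (A : 'M[R]_n) (a : R[i]) : nat :=
  \rank (eigenspace (to_C A)^T a).

Definition alg_mult n (A : 'M[R]_n) (a : R[i]) : nat :=
  mup a (char_poly (to_C A)).

(* The columns of RV are a basis of a subspace V that is strongly invariant for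
   Pi, and B is the matrix of the restriction of Pi to V in this basis. *)
Definition strongly_invariant n k (Pi : 'M[R]_n) (RV : 'M[R]_(n, k))
    (B : 'M[R]_k) :=
  [/\ row_free RV^T, Pi *m RV = RV *m B, \det B = 1 &
      forall a : R[i], eigenvalue (to_C B) a -> alg_mult B a = alg_mult Pi a].

End Spectrum.

Section MechanicalSystem.
Variables (R : realType) (n : nat).

Definition sympJ : 'M[R]_(n + n) := block_mx 0 1%:M (- 1%:M) 0.

(* A state is x = col_mx q p; the arguments of `force` are q, the velocity
   M^-1(q)(p - G_1(q)), t, delta and epsilon. *)
Record mech_system := MechSystem {
  dom : set 'cV[R]_(n + n);
  mass : 'cV[R]_n -> 'M[R]_n;
  gyro : 'cV[R]_n -> 'cV[R]_n;
  gyro0 : 'cV[R]_n -> R;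
  potential : 'cV[R]_n -> R;
  force : 'cV[R]_n -> 'cV[R]_n -> R -> R -> R -> 'cV[R]_n }.

Variable sys : mech_system.

Definition velocity (x : 'cV[R]_(n + n)) : 'cV[R]_n :=
  invmx (mass sys (usubmx x)) *m (dsubmx x - gyro sys (usubmx x)).

Definition ham (x : 'cV[R]_(n + n)) : R :=
  2^-1 * inner (dsubmx x - gyro sys (usubmx x)) (velocity x)
  - gyro0 sys (usubmx x) + potential sys (usubmx x).

Definition pert (x : 'cV[R]_(n + n)) (t delta eps : R) : 'cV[R]_(n + n) :=
  col_mx 0 (force sys (usubmx x) (velocity x) t delta eps).

Definition pert_joint (w : 'cV[R]_(n + n) * R * R * R) : 'cV[R]_(n + n) :=
  pert w.1.1.1 w.1.1.2 w.1.2 w.2.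

Definition pert_dom : set ('cV[R]_(n + n) * R * R * R) :=
  [set w | [/\ dom sys w.1.1.1, 0 < w.1.2 & 0 <= w.2]].

(* pert is C^(r-1) in t and C^r in (x, delta, epsilon): pert and its derivatives
   in the directions orthogonal to the time axis are jointly C^(r-1), that is,
   all partial derivatives of total order at most r with at most r-1
   differentiations in t exist and are continuous. *)
Definition pert_regular (r : nat) :=
  exists (O : set ('cV[R]_(n + n) * R * R * R))
         (f : 'cV[R]_(n + n) * R * R * R -> 'cV[R]_(n + n)),
    [/\ open O, pert_dom `<=` O, forall w, pert_dom w -> f w = pert_joint w,
        Ck r.-1 O f &
        forall v, v.1.1.2 = 0 -> Ck r.-1 O (fun w => 'D_v f w)].

Definition standing_assumptions (r0 : nat) :=
  [/\ open (dom sys),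
      forall x, dom sys x -> spd (mass sys (usubmx x)),
      Ck r0.+1 (dom sys) ham,
      pert_regular r0 &
      forall x t delta eps, dom sys x -> 0 < delta -> 0 <= eps ->
        force sys (usubmx x) (velocity x) (t + delta) delta eps =
        force sys (usubmx x) (velocity x) t delta eps].

Definition ham_field (x : 'cV[R]_(n + n)) : 'cV[R]_(n + n) :=
  sympJ *m grad ham x.

Definition field (delta eps : R) (x : 'cV[R]_(n + n)) (t : R) :=
  ham_field x + eps *: pert x t delta eps.

Definition conservative_orbit (x : R -> 'cV[R]_(n + n)) :=
  solution (dom sys) (fun y _ => ham_field y) setT x.

Definition perturbed_orbit (delta eps : R) (x : R -> 'cV[R]_(n + n)) :=
  solution (dom sys) (field delta eps) setT x.

Definition dpert (x : 'cV[R]_(n + n)) (t delta eps : R) : 'M[R]_(n + n) :=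
  jac (fun y => pert y t delta eps) x.

Definition variational (delta eps : R) (x : R -> 'cV[R]_(n + n))
    (X : R -> 'M[R]_(n + n)) :=
  X 0 = 1%:M /\
  forall t, is_derive t (1 : R) X
    ((sympJ *m jac (grad ham) (x t) + eps *: dpert (x t) t delta eps) *m X t).

Definition m_normal (Pi : 'M[R]_(n + n)) (z : 'cV[R]_(n + n)) :=
  geo_mult Pi 1 = 1%N \/
  (geo_mult Pi 1 = 2%N /\
   ~ exists w : 'cV[R]_(n + n), (Pi - 1%:M) *m w = ham_field z).

Definition melnikov (m l : nat) (tau : R) (x0 : R -> 'cV[R]_(n + n)) (s : R) : R :=
  \int[lebesgue_measure]_(t in `[0, m%:R * tau])
    inner (grad ham (x0 (t + s)))
          (pert (x0 (t + s)) t (tau * m%:R / l%:R) 0).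

Definition sympl_left_inv k (RV : 'M[R]_(n + n, k)) : 'M[R]_(k, n + n) :=
  invmx (RV^T *m sympJ *m RV) *m RV^T *m sympJ.

Definition volume_contraction (m l : nat) (tau : R) (x0 : R -> 'cV[R]_(n + n))
    (X0 : R -> 'M[R]_(n + n)) (v : nat) (RV : 'M[R]_(n + n, v.*2)) : R :=
  - (m%:R * tau * v%:R)^-1 *
  \int[lebesgue_measure]_(t in `[0, m%:R * tau])
    \tr (sympl_left_inv RV *m invmx (X0 t)
         *m dpert (x0 t) t (m%:R * tau / l%:R) 0 *m X0 t *m RV).

(* The family F near the orbit of z, parametrized by the value c of H on an open
   set I of energies: zeta c is a point of the orbit of energy c (chosen smoothly
   in c) and T c is the minimal period of this orbit. *)
Definition energy_family (z : 'cV[R]_(n + n)) (tau : R) (I : set R)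
    (zeta : R -> 'cV[R]_(n + n)) (T : R -> R) :=
  [/\ open I /\ I (ham z), zeta (ham z) = z /\ T (ham z) = tau,
      Ck 1 I zeta, Ck 1 I T &
      forall c, I c -> ham (zeta c) = c /\
        exists y, [/\ conservative_orbit y, y 0 = zeta c & minimal_period y (T c)]].

End MechanicalSystem.

(* Main.v *)
Require Import Defs.
From HB Require Import structures.
From mathcomp Require Import all_boot all_order all_algebra complex.
From mathcomp Require Import all_classical all_reals all_analysis.
From mathcomp Require Import ring lra.
Set Implicit Arguments.
Unset Strict Implicit.
Unset Printing Implicit Defensive.
Import Order.TTheory GRing.Theory Num.Theory.
Import numFieldNormedType.Exports.
Local Open Scope classical_set_scope.
Local Open Scope ring_scope.

(** Write A_e for the monodromy matrix X_e(l delta(e)) of the perturbed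
    orbit, S = m tau, u1 = J DH(z), and x_e(0) = xi(e). At e = 0 the
    variational flow conserves the symplectic form and the differential of
    the energy; for e > 0 both drift at rate e, and averaging the drift
    along the conservative orbit gives, as e -> 0+,

      A_e^T J A_e = J + e L + o(e),
      DH(xi(e))^T (A_e - 1) = e k + o(e),

    where L and k are the integrals over [0, S] of X0^T (dg^T J + J dg) X0
    and of (g^T D^2H + DH^T dg) X0 ([sympl_identity], [energy_identity],
    [averaging]).

    Conditions (i) and (ii) are statements about L and k. On a
    two-dimensional symplectic subspace V all skew forms are proportional,
    and the ratio of L to J on V is -S C_V ([volume_contraction_drift]):
    positive contraction makes L a negative multiple of J on T and on each
    N_k. Moreover k u1 is the derivative of the Melnikov function at 0
    ([melnikov_derive]). Finally, differentiating the period relation of the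
    family F with respect to the energy gives a row vector p = zeta'(h)^T J
    with

      p Pi = p + m T'(h) DH(z)^T,  p u1 = -1

    ([family_covector], [energy_normalization]).

    Suppose that A_e had a multiplier mu with |mu| >= 1 for arbitrarily
    small e. Along an ultrafilter of such e all bounded quantities converge.
    If mu is not real, the real invariant plane of mu has an orthonormal
    basis a, b, and skewness of J gives (|mu|^2 - 1) J(a,b) = e L(a,b) +
    o(e) ([plane_basis]). The limit of the plane is one of T, N_k, because a
    strongly invariant subspace absorbs every vector annihilated by the
    corresponding quadratic polynomial in Pi ([strongly_invariant_span]);
    there L is a negative multiple of J, whereas the limit of the relation
    makes L(a,b) J(a,b) >= 0. If mu is real, then mu -> 1 and the unit
    eigenvector v tends to a multiple s u1 of u1. With nu = mu - 1,

      nu DH(xi(e))^T v = e k v + o(e),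
      nu p v = m T'(h) DH(xi(e))^T v + O(e),

    so that nu^2 (p v) = e (m T'(h) k v + o(1)). Multiplying by p v -> -s
    makes the left-hand side nonnegative and the right-hand side e (- s^2 m
    T'(h) M'(0) + o(1)), which is negative. Both cases being impossible, all
    multipliers lie in the open disk for small e ([multipliers_in_disk]).

    Multipliers in the open disk imply asymptotic stability: the powers of
    A_e tend to 0 ([small_power], from Cayley-Hamilton), hence some iterate
    of the period map contracts a neighbourhood of the orbit
    ([floquet_stability]). The existence of the neighbouring solutions comes
    from Picard iteration for the field clamped to a tube around the orbit. *)

(** * Norm, convergence and derivatives of matrices *)

Section MatrixNorm.
Variable R : realType.

Lemma ler_mx_norm m n (A : 'M[R]_(m, n)) i j : `|A i j| <= `|A|.
Proof.
rewrite [leRHS]/Num.Def.normr /= mx_normrE.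
exact: (le_bigmax _ (fun ij : 'I_m * 'I_n => `|A ij.1 ij.2|) (i, j)).
Qed.

Lemma mx_norm_ler m n (A : 'M[R]_(m, n)) c :
  0 <= c -> (forall i j, `|A i j| <= c) -> `|A| <= c.
Proof.
by move=> c0 Ac; rewrite [leLHS]/Num.Def.normr /= mx_normrE bigmax_le// => -[].
Qed.

(** The norm is the largest absolute value of an entry, so it is
    submultiplicative only up to the inner dimension. *)
Lemma ler_norm_mulmx m n p (A : 'M[R]_(m, n)) (B : 'M[R]_(n, p)) :
  `|A *m B| <= n%:R * `|A| * `|B|.
Proof.
apply: mx_norm_ler => [|i j]; first by rewrite !mulr_ge0.
rewrite mxE (le_trans (ler_norm_sum _ _ _))//.
have -> : n%:R * `|A| * `|B| = \sum_(k < n) `|A| * `|B|.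
  by rewrite sumr_const card_ord -mulrA mulr_natl.
apply: ler_sum => k _.
by rewrite normrM ler_pM// ler_mx_norm.
Qed.

Lemma mx_norm_trmx m n (A : 'M[R]_(m, n)) : `|A^T| = `|A|.
Proof.
apply/eqP; rewrite eq_le; apply/andP; split; apply: mx_norm_ler => // i j.
  by rewrite mxE ler_mx_norm.
by rewrite -[A i j](mxE trmx_key (fun i j => A j i)) -/(A^T) ler_mx_norm.
Qed.

Lemma cvg_mxP T (F : set_system T) {FF : Filter F} m n
    (f : T -> 'M[R]_(m, n)) (l : 'M[R]_(m, n)) :
  f @ F --> l <-> forall i j, f x i j @[x --> F] --> l i j.
Proof.
split=> [fl i j|fl].
  exact: (cvg_comp f (fun M : 'M[R]_(m, n) => M i j) fl (@coord_continuous _ _ _ i j l)).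
apply/cvgrPdist_le => e e0.
have : \forall x \near F, forall ij : 'I_m * 'I_n,
    `|l ij.1 ij.2 - f x ij.1 ij.2| <= e.
  apply: filter_forall => -[i j].
  by move/cvgrPdist_le: (fl i j); apply.
apply: filterS => x H; apply: mx_norm_ler; first exact: ltW.
by move=> i j; rewrite !mxE; exact: (H (i, j)).
Qed.

Lemma cvg_mulmx T (F : set_system T) {FF : Filter F} m n p
    (f : T -> 'M[R]_(m, n)) (g : T -> 'M[R]_(n, p)) (a : 'M[R]_(m, n)) (b : 'M[R]_(n, p)) :
  f @ F --> a -> g @ F --> b -> (f x *m g x) @[x --> F] --> a *m b.
Proof.
move=> /cvg_mxP fa /cvg_mxP gb; apply/cvg_mxP => i j.
rewrite mxE; under eq_fun do rewrite mxE.
by apply: cvg_big => [|k _]; [exact: add_continuous|exact: cvgM].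
Qed.

Lemma cvg_trmx T (F : set_system T) {FF : Filter F} m n
    (f : T -> 'M[R]_(m, n)) (a : 'M[R]_(m, n)) :
  f @ F --> a -> (f x)^T @[x --> F] --> a^T.
Proof.
move=> /cvg_mxP fa; apply/cvg_mxP => i j.
by rewrite mxE; under eq_fun do rewrite mxE; exact: fa.
Qed.

End MatrixNorm.

Section MatrixDerivative.
Variables (R : realType) (V : normedModType R).

Lemma is_derive_mxP m n (M : V -> 'M[R]_(m, n)) t v dM :
  is_derive t v M dM <->
  forall i j, is_derive t v (fun x => M x i j) (dM i j).
Proof.
split=> [[Mt <-] i j|H].
  have Mij : derivable (fun x => M x i j) t v by exact: (derivable_mxP M t v).1.
  by apply: DeriveDef => //; rewrite derive_mx// mxE.
have Mt : derivable M t v by apply: (derivable_mxP M t v).2 => i j; have [] := H i j.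
apply: DeriveDef => //; rewrite derive_mx//; apply/matrixP => i j.
by rewrite mxE; have [] := H i j.
Qed.

Lemma is_derive_fsum (W : normedModType R) n (h : 'I_n -> V -> W) dh t v :
  (forall k, is_derive t v (h k) (dh k)) ->
  is_derive t v (fun s => \sum_(k < n) h k s) (\sum_(k < n) dh k).
Proof. by move=> H; have := is_derive_sum H; rewrite fct_sumE. Qed.

Lemma is_derive_mulmx m n p (A : V -> 'M[R]_(m, n)) (B : V -> 'M[R]_(n, p))
    t v dA dB :
  is_derive t v A dA -> is_derive t v B dB ->
  is_derive t v (fun s => A s *m B s) (dA *m B t + A t *m dB).
Proof.
move=> /is_derive_mxP HA /is_derive_mxP HB; apply/is_derive_mxP => i j.
have -> : (fun s => (A s *m B s) i j) = (fun s => \sum_(k < n) A s i k * B s k j).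
  by apply/funext => s; rewrite mxE.
apply: is_derive_eq; first by apply: is_derive_fsum => k; exact: is_deriveM.
rewrite !mxE -big_split /=; apply: eq_bigr => k _.
by rewrite [dA i k * _]mulrC addrC.
Qed.

Lemma is_derive_trmx m n (A : V -> 'M[R]_(m, n)) t v dA :
  is_derive t v A dA -> is_derive t v (fun s => (A s)^T) dA^T.
Proof.
move=> /is_derive_mxP HA; apply/is_derive_mxP => i j.
rewrite mxE (_ : (fun _ => _) = (fun s => A s j i))//.
by apply/funext => s; rewrite mxE.
Qed.

Lemma is_derive_mulmxl m n p (A : 'M[R]_(m, n)) (B : V -> 'M[R]_(n, p)) t v dB :
  is_derive t v B dB -> is_derive t v (fun s => A *m B s) (A *m dB).
Proof.
move=> HB; apply: is_derive_eq.
  by apply: is_derive_mulmx HB; exact: is_derive_cst.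
by rewrite mul0mx add0r.
Qed.

Lemma is_derive_mulmxr m n p (A : V -> 'M[R]_(m, n)) (B : 'M[R]_(n, p)) t v dA :
  is_derive t v A dA -> is_derive t v (fun s => A s *m B) (dA *m B).
Proof.
move=> HA; apply: is_derive_eq.
  by apply: is_derive_mulmx HA _; exact: is_derive_cst.
by rewrite mulmx0 addr0.
Qed.

Lemma is_derive_inner n (a b : V -> 'cV[R]_n) t v da db :
  is_derive t v a da -> is_derive t v b db ->
  is_derive t v (fun s => inner (a s) (b s)) (inner da (b t) + inner (a t) db).
Proof.
move=> Ha Hb; rewrite /inner.
have /is_derive_mxP/(_ 0 0) := is_derive_mulmx (is_derive_trmx Ha) Hb.
by rewrite mxE.
Qed.

End MatrixDerivative.

Section Increments.
Variable R : realType.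

Lemma is_derive_continuous (W : normedModType R) (f : R -> W) (t : R) df :
  is_derive t (1 : R) f df -> {for t, continuous f}.
Proof. by move=> [ft _]; apply/differentiable_continuous/derivable1_diffP. Qed.

(** Monotonicity of g - f, by the mean value theorem. *)
Lemma le_increment (f g df dg : R -> R) (a b : R) : a <= b ->
  (forall t, a <= t <= b -> is_derive t (1 : R) f (df t)) ->
  (forall t, a <= t <= b -> is_derive t (1 : R) g (dg t)) ->
  (forall t, a <= t <= b -> df t <= dg t) ->
  f b - f a <= g b - g a.
Proof.
move=> ab Df Dg fg.
have D t : a <= t <= b -> is_derive t (1 : R) (fun s => g s - f s) (dg t - df t).
  by move=> tab; apply: is_deriveB; [exact: Dg|exact: Df].
have [|t|c cab] := @MVT_segment R (fun s => g s - f s) (fun s => dg s - df s) a b ab.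
- by move=> t; rewrite in_itv /= => /andP[/ltW at1 /ltW tb]; apply: D; rewrite at1.
- apply: derivable_within_continuous => s; rewrite in_itv /= => sab.
  by have [] := D s sab.
rewrite (_ : _ - _ = (g b - g a) - (f b - f a)) => [E|]; last by rewrite /=; ring.
rewrite -subr_ge0 E mulr_ge0 ?subr_ge0//.
by apply: fg; move: cab; rewrite in_itv.
Qed.

(** Since the norm is a maximum over the entries, it is enough to compare
    each entry of w with g. *)
Lemma norm_increment_le m n (w dw : R -> 'M[R]_(m, n)) (g dg : R -> R) (a b : R) :
  a <= b ->
  (forall t, a <= t <= b -> is_derive t (1 : R) w (dw t)) ->
  (forall t, a <= t <= b -> is_derive t (1 : R) g (dg t)) ->
  (forall t, a <= t <= b -> `|dw t| <= dg t) ->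
  `|w b - w a| <= g b - g a.
Proof.
move=> ab Dw Dg wg.
have ij_le i j : `|w b i j - w a i j| <= g b - g a.
  have Dij t : a <= t <= b -> is_derive t (1 : R) (fun s => w s i j) (dw t i j).
    by move=> /Dw /is_derive_mxP.
  rewrite ler_norml; apply/andP; split.
    rewrite -subr_ge0 (_ : _ - _ = (g b - g a) - (- w b i j - - w a i j)); last by ring.
    rewrite subr_ge0; apply: (le_increment (f := fun s => - w s i j)
      (df := fun s => - dw s i j) ab _ Dg) => t tab.
      by apply: is_deriveN; exact: Dij.
    by rewrite (le_trans _ (wg t tab))// (le_trans (ler_norm _))// normrN ler_mx_norm.
  apply: (le_increment ab Dij Dg) => t tab.
  by rewrite (le_trans _ (wg t tab))// (le_trans (ler_norm _))// ler_mx_norm.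
apply: mx_norm_ler => [|i j]; last by rewrite !mxE; exact: ij_le.
rewrite -(subrr (0 : R)).
apply: (le_increment (f := cst 0) (df := cst 0) ab _ Dg) => t tab.
by rewrite (le_trans _ (wg t tab)).
Qed.

Lemma norm_increment_le_cst m n (w dw : R -> 'M[R]_(m, n)) (c a b : R) :
  a <= b ->
  (forall t, a <= t <= b -> is_derive t (1 : R) w (dw t)) ->
  (forall t, a <= t <= b -> `|dw t| <= c) ->
  `|w b - w a| <= c * (b - a).
Proof.
move=> ab Dw wc; rewrite mulrBr.
apply: (norm_increment_le (g := fun s => c * s) (dg := cst c) ab Dw _ wc) => t _.
by have := @is_deriveZ R R R id c t 1 1 (is_derive_id _ _); rewrite [_%:A]mulr1.
Qed.

End Increments.

(** * Continuity induction and Gronwall's inequality *)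

Section Gronwall.
Variable R : realType.

(** The set where the bound fails is closed in [0, T]; at its infimum the
    bound holds by the step hypothesis, and then on a neighbourhood by
    continuity. *)
Lemma continuity_induction (w : R -> R) (T c : R) :
  (forall t : R, 0 <= t <= T -> {for t, continuous w}) ->
  (forall s : R, 0 <= s <= T -> (forall t : R, 0 <= t < s -> w t < c) -> w s < c) ->
  forall s : R, 0 <= s <= T -> w s < c.
Proof.
move=> cw step s0 s0T; rewrite ltNge; apply/negP => ws0.
(* the points where the bound fails *)
pose S := [set s | 0 <= s <= T /\ c <= w s].
have Ss0 : S s0 by [].
have lbS : lbound S 0 by move=> s [/andP[]].
have infS : has_inf S by split; [exists s0|exists 0].
have i0 : 0 <= inf S by apply: lb_le_inf => //; exists s0.
have is0 : inf S <= s0 by exact: (ge_inf (ex_intro _ 0 lbS)).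
have iT : 0 <= inf S <= T.
  by rewrite i0/= (le_trans is0)//; case/andP: s0T.
have wi : w (inf S) < c.
  apply: step => // t /andP[t0 ti]; rewrite ltNge; apply/negP => wt.
  have : inf S <= t.
    apply: (ge_inf (ex_intro _ 0 lbS)); split=> //.
    by rewrite t0/= ltW// (lt_le_trans ti)//; case/andP: iT.
  by rewrite leNgt ti.
have /nbhs_ballP[e /= e0 He] : \forall t \near inf S, w t < c.
  exact: (cvgr_lt (w (inf S)) (cw _ iT)) wi.
have [s [sT ws] si] := inf_adherent e0 infS.
have is_ : inf S <= s by exact: (ge_inf (ex_intro _ 0 lbS)).
have : w s < c.
  by apply: He; rewrite /ball /= ltr_distlC; apply/andP; split; lra.
by rewrite ltNge ws.
Qed.

Lemma innerC n (u v : 'cV[R]_n) : inner u v = inner v u.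
Proof. by rewrite /inner !mxE; apply: eq_bigr => k _; rewrite !mxE mulrC. Qed.

Lemma inner_ge0 n (u : 'cV[R]_n) : 0 <= inner u u.
Proof. by rewrite /inner mxE sumr_ge0// => k _; rewrite mxE -expr2 sqr_ge0. Qed.

Lemma norm_inner_le n (u v : 'cV[R]_n) : `|inner u v| <= n%:R * `|u| * `|v|.
Proof.
by rewrite (le_trans (ler_mx_norm _ _ _))// (le_trans (ler_norm_mulmx _ _))// mx_norm_trmx.
Qed.

Lemma sqr_norm_le_inner n (u : 'cV[R]_n) : `|u| ^+ 2 <= inner u u.
Proof.
rewrite -[leRHS]sqr_sqrtr ?inner_ge0// lerXn2r ?nnegrE ?sqrtr_ge0//.
apply: mx_norm_ler => [|i j]; first exact: sqrtr_ge0.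
rewrite -sqrtr_sqr ler_sqrt ?inner_ge0// /inner mxE (bigD1 i)//= !mxE ord1 -expr2.
by rewrite lerDl sumr_ge0// => k _; rewrite mxE -expr2 sqr_ge0.
Qed.

Definition gronwall_cst n (L T : R) : R :=
  n.+1%:R * expR (n.+1%:R * (2 * L + 1) * T).

Lemma gronwall_cst_ge1 n (L T : R) : 0 <= L -> 0 <= T -> 1 <= gronwall_cst n L T.
Proof.
move=> L0 T0; rewrite /gronwall_cst -[leLHS]mulr1 ler_pM ?ler1n//.
by rewrite -[leLHS]expR0 ler_expR !mulr_ge0// addr_ge0// mulr_ge0.
Qed.

(** The differential inequality is only assumed where u stays within rho:
    the estimate itself, which is below rho, keeps u there, so that no a
    priori bound on u is required. The proof works with the smooth quantity
    |u|^2 + eta^2 in the Euclidean norm, and pays a factor depending on n to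
    return to the maximum norm. *)
Lemma gronwall n (u du : R -> 'cV[R]_n) (T L eta rho : R) :
  0 <= L -> 0 <= eta ->
  (forall t, 0 <= t <= T -> is_derive t (1 : R) u (du t)) ->
  (forall t, 0 <= t <= T -> `|u t| <= rho -> `|du t| <= L * `|u t| + eta) ->
  gronwall_cst n L T * (`|u 0| + eta) < rho ->
  forall t, 0 <= t <= T -> `|u t| <= gronwall_cst n L T * (`|u 0| + eta).
Proof.
move=> L0 eta0 Du du_le small.
set B := gronwall_cst n L T * _ in small *.
pose N : R := n.+1%:R; pose k := N * (2 * L + 1).
have N1 : 1 <= N by rewrite /N ler1n.
have k0 : 0 <= k by rewrite /k mulr_ge0//; lra.
pose q t := inner (u t) (u t) + eta ^+ 2.
(* q grows at most at the rate k, so E is nonincreasing. *)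
pose E t := q t * expR (- k * t).
have Dq t : 0 <= t <= T -> is_derive t (1 : R) q (2 * inner (u t) (du t)).
  move=> tT; rewrite (_ : 2 * _ = inner (du t) (u t) + inner (u t) (du t) + 0).
    exact: (is_deriveD (is_derive_inner (Du t tT) (Du t tT)) (is_derive_cst (eta ^+ 2) t 1)).
  by rewrite [inner (du t) _]innerC addr0 mulr_natl.
have De (t : R) : is_derive t (1 : R) (fun s => expR (- k * s)) (- k * expR (- k * t)).
  have Dl : is_derive t (1 : R) (fun s => - k * s) (- k).
    by have := @is_deriveZ R R R id (- k) t 1 1 (is_derive_id _ _); rewrite [_%:A]mulr1.
  by rewrite [X in is_derive _ _ _ X]mulrC; exact: is_derive1_comp (is_derive_expR _) Dl.
have DE t : 0 <= t <= T ->
    is_derive t (1 : R) E ((2 * inner (u t) (du t) - k * q t) * expR (- k * t)).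
  move=> tT; apply: is_derive_eq; first exact: is_deriveM (Dq t tT) (De t).
  by rewrite /GRing.scale /=; ring.
have grow s : 0 <= s <= T -> (forall t, 0 <= t <= s -> `|u t| <= rho) -> `|u s| <= B.
  move=> /andP[s0 sT] us.
  have Es : E s <= E 0.
    rewrite -subr_le0 -[leRHS](subrr (0 : R)).
    apply: (le_increment (g := cst 0) (dg := cst 0) s0) => [t /andP[t0 ts]|t /andP[t0 ts]].
      by apply: DE; rewrite t0 (le_trans ts).
    rewrite pmulr_lle0 ?expR_gt0// subr_le0.
    have tT : 0 <= t <= T by rewrite t0 (le_trans ts).
    have := du_le t tT (us t _); rewrite t0 ts => /(_ isT).
    have := norm_inner_le (u t) (du t); have := sqr_norm_le_inner (u t).
    rewrite /q /k; have : n%:R <= N by rewrite /N ler_nat.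
    have : 0 <= n%:R :> R by [].
    move: (inner _ _) (inner _ _) (normr_ge0 (u t)) (normr_ge0 (du t)) => b a.
    move: `|u t| `|du t| (n%:R : R) => x y m x0 y0 m0 mN xa bxy yx.
    have h1 : b <= m * x * y by exact: le_trans (ler_norm _) bxy.
    have h2 : m * x * y <= m * x * (L * x + eta) by rewrite ler_wpM2l// mulr_ge0.
    have h3 : m * x * (L * x + eta) <= N * (x * (L * x + eta)).
      by rewrite -mulrA ler_wpM2r// mulr_ge0// addr_ge0// mulr_ge0.
    have h4 : 2 * (x * (L * x + eta)) <= (2 * L + 1) * (x ^+ 2 + eta ^+ 2).
      have : 0 <= (x - eta) ^+ 2 by exact: sqr_ge0.
      have : 0 <= L * eta ^+ 2 by rewrite mulr_ge0 ?sqr_ge0.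
      by move=> *; nra.
    have h5 : (2 * L + 1) * (x ^+ 2 + eta ^+ 2) <= (2 * L + 1) * (a + eta ^+ 2).
      by rewrite ler_wpM2l//; lra.
    have h6 : N * (2 * (x * (L * x + eta))) <= N * ((2 * L + 1) * (a + eta ^+ 2)).
      by rewrite ler_wpM2l//; lra.
    by rewrite -mulrA; lra.
  have q_le : q s <= q 0 * expR (k * s).
    rewrite -ler_pdivrMr ?expR_gt0// -expRN -mulNr.
    by move: Es; rewrite /E mulr0 expR0 mulr1.
  have e_le : expR (k * s) <= expR (k * T) by rewrite ler_expR ler_wpM2l.
  have e1 : 1 <= expR (k * T).
    by rewrite -[leLHS]expR0 ler_expR mulr_ge0// (le_trans s0).
  rewrite -(ler_pXn2r (_ : (0 < 2)%N)) ?nnegrE//; last first.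
    by rewrite mulr_ge0 ?addr_ge0// (le_trans ler01)// gronwall_cst_ge1// (le_trans s0).
  have h1 : `|u s| ^+ 2 <= q 0 * expR (k * T).
    rewrite (le_trans (sqr_norm_le_inner _))// (le_trans _ (_ : q s <= _))//.
      by rewrite lerDl sqr_ge0.
    by rewrite (le_trans q_le)// ler_wpM2l// addr_ge0 ?inner_ge0 ?sqr_ge0.
  have h2 : q 0 <= N * (`|u 0| + eta) ^+ 2.
    have := norm_inner_le (u 0) (u 0); rewrite ger0_norm ?inner_ge0// /q.
    have : n%:R <= N - 1 by rewrite /N -natr1 addrK.
    move: (inner _ _) (normr_ge0 (u 0)); move: `|u 0| (n%:R : R) => x m a x0 mN ax.
    have : m * x * x <= (N - 1) * (x * x) by rewrite -mulrA ler_wpM2r// mulr_ge0.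
    have : 0 <= N * (x * eta) by rewrite !mulr_ge0//; lra.
    have : 0 <= (N - 1) * (eta ^+ 2) by rewrite mulr_ge0 ?sqr_ge0 ?subr_ge0.
    have : 0 <= x * x by rewrite mulr_ge0.
    rewrite !expr2; lra.
  rewrite (le_trans h1)// /B /gronwall_cst -/N -/k exprMn.
  rewrite (le_trans (_ : _ <= N * (`|u 0| + eta) ^+ 2 * expR (k * T)))//.
    by rewrite ler_wpM2r// expR_ge0.
  rewrite mulrAC ler_wpM2r ?sqr_ge0// exprMn !expr2.
  rewrite -[leLHS]mul1r -mulrA ler_pM// ?mulr_ge0 ?expR_ge0//; try lra.
  by rewrite mulrA -[leLHS]mulr1 ler_wpM2l// mulr_ge0 ?expR_ge0//; lra.
move=> t tT; apply: (grow _) => // s /andP[s0 st].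
apply: ltW; apply: (continuity_induction (w := fun r => `|u r|) (T := T)); last first.
- by rewrite s0 (le_trans st)//; case/andP: tT.
- move=> r rT Hr; have [->|r0] := eqVneq r 0.
    rewrite (le_lt_trans _ small)// /B -[leLHS]mul1r ler_pM//.
      by apply: gronwall_cst_ge1 => //; case/andP: tT => /le_trans; apply.
    by rewrite lerDl.
  have ur_rho : `|u r| <= rho.
    rewrite leNgt; apply/negP => ur.
    have cu : {for r, continuous (fun s => `|u s|)}.
      by apply: cvg_norm; exact: is_derive_continuous (Du r rT).
    have /nbhs_ballP[e /= e0 He] : \forall t \near r, rho < `|u t|.
      exact: (cvgr_gt `|u r| cu) ur.
    have r_gt0 : 0 < r by rewrite lt_def r0; case/andP: rT.
    pose p := r - Num.min (e / 2) r.
    have mgt0 : 0 < Num.min (e / 2) r by rewrite lt_min r_gt0 divr_gt0.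
    have [mle mlr] : Num.min (e / 2) r <= e / 2 /\ Num.min (e / 2) r <= r.
      by rewrite !ge_min !lexx orbT.
    have : rho < `|u p|.
      by apply: He; rewrite /ball /= ltr_distlC /p; apply/andP; split; lra.
    by rewrite ltNge ltW// Hr// /p; apply/andP; split; lra.
  rewrite (le_lt_trans _ small)//; apply: (grow _) => // p /andP[p0].
  by rewrite le_eqVlt => /predU1P[->//|pr]; rewrite ltW// Hr// p0.
- by move=> r rT; apply: cvg_norm; exact: is_derive_continuous (Du r rT).
Qed.

End Gronwall.

(** * Primitives *)

Section Integration.
Variable R : realType.
Notation mu := (@lebesgue_measure R).

Lemma Rintegral_primitive (c F : R -> R) (a b : R) : a < b ->
  (forall t : R, a <= t <= b -> {for t, continuous c}) ->
  (forall t : R, a <= t <= b -> is_derive t (1 : R) F (c t)) ->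
  \int[mu]_(t in `[a, b]) c t = F b - F a.
Proof.
move=> ab cc dF; rewrite /Rintegral (@continuous_FTC2 _ c F a b)//.
- apply: continuous_in_subspaceT => t; rewrite inE /= in_itv /= => tab.
  exact: cc.
- have cF (t : R) : a <= t <= b -> F @ t --> F t.
    by move=> tab; exact: is_derive_continuous (dF t tab).
  split; first by move=> t; rewrite in_itv /= => /andP[at1 tb]; have [] := dF t; rewrite ?ltW.
  + by apply: cvg_at_right_filter; apply: cF; rewrite lexx ltW.
  + by apply: cvg_at_left_filter; apply: cF; rewrite lexx ltW.
- move=> t; rewrite in_itv /= => /andP[at1 tb].
  by rewrite derive1E; have [] := dF t; rewrite ?ltW.
Qed.

(** The fundamental theorem of calculus, with the integral started at the
    left of the interval of interest so that 0 is an interior point. *)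
Lemma local_antiderivative (c : R -> R) (B : R) : continuous c ->
  exists2 F : R -> R, F 0 = 0 &
    forall t : R, - B < t -> is_derive t (1 : R) F (c t).
Proof.
move=> cc; pose G x := \int[mu]_(t in `[- B, x]) c t.
exists (fun x => G x - G 0) => [|t t1]; first by rewrite subrr.
have [] := @continuous_FTC1_closed R c (- B) t (t + 1) _ _ t1 (cc t).
- by rewrite ltrDl.
- apply: continuous_compact_integrable; first exact: segment_compact.
  exact: continuous_subspaceT.
rewrite derive1E => dG EG; have dG' : is_derive t (1 : R) G (c t) by exact: DeriveDef.
rewrite -[c t]subr0; exact: (is_deriveB dG' (is_derive_cst (G 0) t 1)).
Qed.

End Integration.

(** * Uniformity near a compact set *)

Section CompactUniformity.
Variables (R : realType) (E : normedModType R).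

(** Uniform continuity at the points of a compact set: w ranges over a full
    neighbourhood, not only over K. This is what compares the perturbed
    orbit with the conservative one. *)
Lemma compact_unif (W : normedModType R) (K : set E) (f : E -> W) :
  compact K -> (forall k, K k -> {for k, continuous f}) ->
  forall eta : R, 0 < eta -> exists2 rho : R, 0 < rho &
    forall k w, K k -> `|w - k| < rho -> `|f w - f k| < eta.
Proof.
move=> /compact_near_coveringP cK cf eta eta0.
have [|rho /= rho0 H] := (cK R (0 : R)^'+
  (fun rho k => forall w, `|w - k| < rho -> `|f w - f k| < eta) _ _).
  move=> k Kk.
  have /nbhs_ballP[e /= e0 He] : \forall x \near k, `|f k - f x| < eta / 2.
    by move/cvgrPdist_lt: (cf k Kk); apply; rewrite divr_gt0.
  near=> x' rho => /= w wx'.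
  have fx' : `|f k - f x'| < eta / 2.
    apply: He; rewrite -ball_normE /=; near: x'.
    by move/cvgrPdist_lt: (@cvg_id _ (nbhs k)); apply.
  have fw : `|f k - f w| < eta / 2.
    apply: He; rewrite -ball_normE /= -(subrKA x') (le_lt_trans (ler_normD _ _))//.
    rewrite [ltRHS](splitr e) ltrD//.
      near: x'.
      by move/cvgrPdist_lt: (@cvg_id _ (nbhs k)); apply; rewrite divr_gt0.
    rewrite distrC (lt_trans wx')//; near: rho; apply: nbhs_right_lt.
    by rewrite divr_gt0.
  rewrite -(subrKA (f k)) (le_lt_trans (ler_normD _ _))// [ltRHS](splitr eta) ltrD//.
  by rewrite distrC.
exists (rho / 2); first by rewrite divr_gt0.
move=> k w Kk; apply: H => //=; last by rewrite divr_gt0.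
by rewrite sub0r normrN gtr0_norm ?divr_gt0// gtr_pMr// invf_lt1// ltr1n.
Unshelve. all: by end_near. Qed.

Lemma compact_open_unif (K O : set E) : compact K -> open O -> K `<=` O ->
  exists2 rho : R, 0 < rho & forall k w, K k -> `|w - k| < rho -> O w.
Proof.
move=> /compact_near_coveringP cK oO KO.
have [|rho /= rho0 H] := (cK R (0 : R)^'+
  (fun rho k => forall w, `|w - k| < rho -> O w) _ _).
  move=> k Kk; have /nbhs_ballP[e /= e0 He] := open_nbhs_nbhs (conj oO (KO k Kk)).
  near=> x' rho => /= w wx'; apply: He.
  rewrite -ball_normE /= -(subrKA x') (le_lt_trans (ler_normD _ _))//.
  rewrite [ltRHS](splitr e) ltrD//.
    by near: x'; move/cvgrPdist_lt: (@cvg_id _ (nbhs k)); apply; rewrite divr_gt0.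
  rewrite distrC (lt_trans wx')//; near: rho; apply: nbhs_right_lt.
  by rewrite divr_gt0.
exists (rho / 2); first by rewrite divr_gt0.
move=> k w Kk; apply: H => //=; last by rewrite divr_gt0.
by rewrite sub0r normrN gtr0_norm ?divr_gt0// gtr_pMr// invf_lt1// ltr1n.
Unshelve. all: by end_near. Qed.

Lemma compact_bounded_unif (W : normedModType R) (K : set E) (f : E -> W) :
  compact K -> (forall k, K k -> {for k, continuous f}) ->
  exists2 C : R, 0 < C & forall k, K k -> `|f k| <= C.
Proof.
move=> /compact_near_coveringP cK cf.
have [|M [Mr H]] := (cK R +oo (fun C k => `|f k| <= C) _ _).
  move=> k Kk; near=> x' C => /=.
  rewrite (@le_trans _ _ (`|f k| + 1))//.
    rewrite -lerBlDl (le_trans (lerB_dist _ _))// ltW// distrC; near: x'.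
    by move/cvgrPdist_lt: (cf k Kk); apply.
exists (`|M| + 1) => [|k Kk]; first by rewrite ltr_wpDl.
by apply: (H (`|M| + 1)) => //; rewrite (le_lt_trans (ler_norm _))// ltrDl.
Unshelve. all: by end_near. Qed.

End CompactUniformity.

Section Differentials.
Variable R : realType.

Lemma is_derive_line (V W : normedModType R) (f : V -> W) (x v : V) (s : R) df :
  is_derive (x + s *: v) v f df ->
  is_derive s (1 : R) (fun r => f (x + r *: v)) df.
Proof.
move=> [fd <-]; have E : (fun h : R => h^-1 *: (f (x + (h *: 1 + s) *: v) - f (x + s *: v))) =
   (fun h => h^-1 *: (f (h *: v + (x + s *: v)) - f (x + s *: v))).
  apply/funext => h; congr (_ *: (f _ - _)).
  by rewrite [h *: 1]mulr1 scalerDl addrCA.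
apply: DeriveDef; first by rewrite /derivable E.
by rewrite /derive E.
Qed.

Lemma is_derive_curve (V W : normedModType R) (f : V -> W) (c : R -> V) (t : R) dc :
  differentiable f (c t) -> is_derive t (1 : R) c dc ->
  is_derive t (1 : R) (fun s => f (c s)) ('D_dc f (c t)).
Proof.
move=> df [cd <-]; have cdiff : differentiable c t by apply/derivable1_diffP.
have fc : differentiable (f \o c) t by exact: differentiable_comp.
apply: DeriveDef; first by apply/derivable1_diffP.
rewrite -/(f \o c) deriveE// diff_comp//= deriveE//.
by rewrite [in RHS]deriveE.
Qed.

End Differentials.

Lemma is_derive_scalel (R : realType) (W : normedModType R) (w : W) (s : R) :
  is_derive s (1 : R) (fun r : R => r *: w) w.
Proof.
have D : differentiable (fun r : R => r *: w) s by exact: differentiableZl.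
apply: DeriveDef; first exact: diff_derivable.
by rewrite deriveE// diffZl// diff_val scale1r.
Qed.

Section UniformTaylor.
Variables (R : realType) (n k : nat) (E : normedModType R).
Variables (F : 'cV[R]_n -> E -> 'cV[R]_k) (DF : 'cV[R]_n * E -> 'M[R]_(k, n)).
Variables (O K : set ('cV[R]_n * E)%type).
Hypothesis oO : open O.
Hypothesis DFE : forall p, O p ->
  forall v, is_derive p.1 v (F ^~ p.2) (DF p *m v).
Hypothesis cK : compact K.
Hypothesis KO : K `<=` O.
Hypothesis cDF : forall p, K p -> {for p, continuous DF}.

(** First-order Taylor expansion with a remainder uniform in the base point
    p of K and in a parameter e near the one of p. Both differences are read
    off on the segment from p.1 to w, on which DF stays close to its value
    at p. *)
Lemma taylor_unif (eta : R) : 0 < eta ->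
  exists2 rho : R, 0 < rho & forall p w e, K p -> `|w - p.1| < rho ->
    `|e - p.2| < rho ->
    `|F w e - F p.1 e - DF p *m (w - p.1)| <= eta * `|w - p.1|.
Proof.
move=> eta0; pose a := eta / n.+1%:R.
have a0 : 0 < a by rewrite divr_gt0.
have [r1 r10 H1] := compact_unif cK cDF a0.
have [r2 r20 H2] := compact_open_unif cK oO KO.
exists (Num.min r1 r2) => [|p w e Kp wp ep]; first by rewrite lt_min r10.
pose d := w - p.1.
have near_p (s : R) : 0 <= s <= 1 -> `|(p.1 + s *: d, e) - p| < Num.min r1 r2.
  move=> /andP[s0 s1]; rewrite prod_normE /= gt_max ep addrC addKr andbT.
  rewrite normrZ ger0_norm// (le_lt_trans _ wp)// -[leRHS]mul1r.
  by rewrite ler_wpM2r.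
pose g (s : R) := F (p.1 + s *: d) e - s *: (DF p *m d).
have Dg (s : R) : 0 <= s <= 1 ->
    is_derive s (1 : R) g (DF (p.1 + s *: d, e) *m d - DF p *m d).
  move=> s01; have Os : O (p.1 + s *: d, e).
    by apply: (H2 p) => //; move: (near_p s s01); rewrite lt_min => /andP[].
  have D1 : is_derive s (1 : R) (fun r => F (p.1 + r *: d) e) (DF (p.1 + s *: d, e) *m d).
    by apply: (is_derive_line (f := F ^~ e)); exact: (DFE Os).
  have D2 : is_derive s (1 : R) (fun r : R => r *: (DF p *m d)) (DF p *m d).
    exact: is_derive_scalel.
  exact: is_deriveB.
have key : `|g 1 - g 0| <= eta * `|d| * (1 - 0).
  apply: (norm_increment_le_cst ler01 Dg) => s s01.
  rewrite -mulmxBl (le_trans (ler_norm_mulmx _ _))// ler_wpM2r//.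
  have : `|DF (p.1 + s *: d, e) - DF p| < a.
    by apply: H1 => //; move: (near_p s s01); rewrite lt_min => /andP[].
  move=> /ltW h; rewrite (le_trans (ler_wpM2l (ler0n _ n) h))//.
  by rewrite /a mulrA ler_pdivrMr// mulrC ler_wpM2l ?ler_nat// ltW.
move: key; rewrite subr0 mulr1 /g !scale1r !scale0r addr0 subr0.
by rewrite [p.1 + d](_ : _ = w) ?[_ - _ - F _ _]addrAC// /d addrC subrK.
Qed.

(** The bound on DF near the compact set K, integrated along segments, which
    stay in the convex balls around the points of K. *)
Lemma lipschitz_tube :
  exists rho L : R, [/\ 0 < rho, 0 < L & forall p w w' e, K p ->
    `|w - p.1| < rho -> `|w' - p.1| < rho -> `|e - p.2| < rho ->
    O (w, e) /\ `|F w e - F w' e| <= L * `|w - w'|].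
Proof.
have [r1 r10 H1] := compact_unif cK cDF ltr01.
have [r2 r20 H2] := compact_open_unif cK oO KO.
have [C C0 HC] := compact_bounded_unif cK cDF.
exists (Num.min r1 r2), (n.+1%:R * (C + 1)); split; rewrite ?lt_min ?r10//.
  by rewrite mulr_gt0// addr_gt0.
move=> p w w' e Kp wp wp' ep.
pose d := w - w'.
have near_p (s : R) : 0 <= s <= 1 -> `|(w' + s *: d, e) - p| < Num.min r1 r2.
  move=> /andP[s0 s1]; rewrite prod_normE /= gt_max ep andbT.
  have -> : w' + s *: d - p.1 = (1 - s) *: (w' - p.1) + s *: (w - p.1).
    by rewrite /d scalerBl scale1r !scalerBr opprB; apply/matrixP => i j; rewrite !mxE; ring.
  rewrite (le_lt_trans (ler_normD _ _))// !normrZ !ger0_norm ?subr_ge0//.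
  have [s00|s0'] := eqVneq s 0; first by rewrite s00 mul0r addr0 subr0 mul1r.
  rewrite [ltRHS](_ : _ = (1 - s) * Num.min r1 r2 + s * Num.min r1 r2); last by ring.
  rewrite ler_ltD//.
    by rewrite ler_wpM2l ?subr_ge0// ltW.
  by rewrite ltr_pM2l// lt_def s0'.
have Os (s : R) : 0 <= s <= 1 -> O (w' + s *: d, e).
  by move=> s01; apply: (H2 p) => //; move: (near_p s s01); rewrite lt_min => /andP[].
have one01 : 0 <= (1 : R) <= 1 by rewrite ler01 lexx.
split; first by move: (Os 1 one01); rewrite scale1r /d addrC subrK.
have Dg (s : R) : 0 <= s <= 1 -> is_derive s (1 : R) (fun r => F (w' + r *: d) e)
    (DF (w' + s *: d, e) *m d).
  move=> s01; apply: (is_derive_line (f := F ^~ e)); exact: (DFE (Os s s01)).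
have key : `|F (w' + 1 *: d) e - F (w' + 0 *: d) e| <= n.+1%:R * (C + 1) * `|d| * (1 - 0).
  apply: (norm_increment_le_cst ler01 Dg) => s s01.
  rewrite (le_trans (ler_norm_mulmx _ _))// ler_wpM2r//.
  have : `|DF (w' + s *: d, e) - DF p| < 1.
    by apply: H1 => //; move: (near_p s s01); rewrite lt_min => /andP[].
  move=> h; rewrite ler_pM ?ler_nat// -(subrK (DF p) (DF _)).
  by rewrite (le_trans (ler_normD _ _))// addrC lerD ?HC// ltW.
move: key; rewrite subr0 mulr1 scale1r scale0r addr0.
by rewrite [w' + d](_ : _ = w)// /d addrC subrK.
Qed.

End UniformTaylor.

(** * Symmetry of second derivatives *)

Section Schwarz.
Variables (R : realType) (V : normedModType R).

(** The mean value theorem in the direction u for the increment of f by h v,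
    then in the direction v. *)
Lemma second_difference (f : V -> R) (u v x : V) (h : R) : 0 < h ->
  (forall s t, 0 <= s <= h -> 0 <= t <= h ->
    derivable f (x + s *: u + t *: v) u /\
    derivable ('D_u f) (x + s *: u + t *: v) v) ->
  exists s t, [/\ 0 <= s <= h, 0 <= t <= h &
    f (x + h *: u + h *: v) - f (x + h *: u) - f (x + h *: v) + f x =
    h ^+ 2 * 'D_v ('D_u f) (x + s *: u + t *: v)].
Proof.
move=> h0 df.
have h00 : 0 <= (0 : R) <= h by rewrite lexx ltW.
have hh : 0 <= h <= h by rewrite lexx ltW.
have D1 (t s : R) : 0 <= s <= h -> 0 <= t <= h ->
    is_derive s (1 : R) (fun r : R => f (x + r *: u + t *: v)) ('D_u f (x + s *: u + t *: v)).
  move=> s0 t0; have [d _] := df s t s0 t0.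
  rewrite (_ : (fun _ => _) = (fun r => f (x + t *: v + r *: u))); last first.
    by apply/funext => r; rewrite addrAC.
  apply: (is_derive_line (f := f) (x := x + t *: v)).
  by rewrite addrAC; exact: derivableP.
pose phi (s : R) := f (x + s *: u + h *: v) - f (x + s *: u + 0 *: v).
have Dphi (s : R) : 0 <= s <= h -> is_derive s (1 : R) phi
    ('D_u f (x + s *: u + h *: v) - 'D_u f (x + s *: u + 0 *: v)).
  by move=> s0; apply: is_deriveB; exact: D1.
have [s s0 Es] : exists2 s, 0 <= s <= h & phi h - phi 0 =
    ('D_u f (x + s *: u + h *: v) - 'D_u f (x + s *: u + 0 *: v)) * h.
  have [|||s] := @MVT_segment R phi (fun s =>
    'D_u f (x + s *: u + h *: v) - 'D_u f (x + s *: u + 0 *: v)) 0 h.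
  - exact: ltW.
  - by move=> s; rewrite in_itv /= => /andP[? ?]; apply: Dphi; rewrite !ltW.
  - by apply: derivable_within_continuous => s; rewrite in_itv /= => s0; have [] := Dphi s s0.
  by rewrite in_itv /= subr0 => s0 E; exists s.
have D2 (t : R) : 0 <= t <= h -> is_derive t (1 : R)
    (fun r : R => 'D_u f (x + s *: u + r *: v)) ('D_v ('D_u f) (x + s *: u + t *: v)).
  move=> t0; have [_ d] := df s t s0 t0.
  exact: (is_derive_line (f := 'D_u f) (x := x + s *: u) (derivableP d)).
have [t t0 Et] : exists2 t, 0 <= t <= h &
    'D_u f (x + s *: u + h *: v) - 'D_u f (x + s *: u + 0 *: v) =
    'D_v ('D_u f) (x + s *: u + t *: v) * h.
  have [|||t] := @MVT_segment R (fun r : R => 'D_u f (x + s *: u + r *: v))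
    (fun t => 'D_v ('D_u f) (x + s *: u + t *: v)) 0 h.
  - exact: ltW.
  - by move=> t; rewrite in_itv /= => /andP[? ?]; apply: D2; rewrite !ltW.
  - by apply: derivable_within_continuous => t; rewrite in_itv /= => t0; have [] := D2 t t0.
  by rewrite in_itv /= subr0 => t0 E; exists t.
exists s, t; split=> //.
rewrite [LHS](_ : _ = phi h - phi 0); last by rewrite /phi !scale0r !addr0; ring.
by rewrite Es Et; ring.
Qed.

Lemma open_continuous2_ball (O : set V) (g1 g2 : V -> R) (x : V) (eta : R) :
  open O -> O x -> {for x, continuous g1} -> {for x, continuous g2} -> 0 < eta ->
  exists2 e : R, 0 < e & forall y, ball x e y ->
    [/\ O y, `|g1 x - g1 y| < eta & `|g2 x - g2 y| < eta].
Proof.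
move=> oO Ox /cvgrPdist_lt/(_ _ _)H1 /cvgrPdist_lt/(_ _ _)H2 eta0.
have /nbhs_ballP[e /= e0 He] : \forall y \near x, [/\ O y,
    `|g1 x - g1 y| < eta & `|g2 x - g2 y| < eta].
  near=> y; split.
  - by near: y; exact: open_nbhs_nbhs.
  - by near: y; exact: H1.
  - by near: y; exact: H2.
by exists e.
Unshelve. all: by end_near. Qed.

(** The second difference of f is symmetric in u and v; divided by h^2 it is
    close to either of the mixed derivatives. *)
Lemma schwarz (O : set V) (f : V -> R) (x u v : V) :
  open O -> Ck 2 O f -> O x -> 'D_u ('D_v f) x = 'D_v ('D_u f) x.
Proof.
move=> oO [df1 /= df2] Ox.
have [E|neq] := eqVneq ('D_u ('D_v f) x) ('D_v ('D_u f) x); first exact: E.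
exfalso.
pose eta := `|'D_u ('D_v f) x - 'D_v ('D_u f) x| / 2.
have eta0 : 0 < eta by rewrite divr_gt0 ?ltr0n ?normr_gt0 ?subr_eq0.
have cuv : {for x, continuous ('D_u ('D_v f))} by apply: ((df2 v).2 u x Ox).
have cvu : {for x, continuous ('D_v ('D_u f))} by apply: ((df2 u).2 v x Ox).
have [e e0 He] := open_continuous2_ball oO Ox cuv cvu eta0.
pose h := e / (`|u| + `|v| + 1).
have den : 0 < `|u| + `|v| + 1 by rewrite ltr_wpDl// addr_ge0.
have h0 : 0 < h by rewrite divr_gt0.
have inB (u' v' : V) (s t : R) : `|u'| + `|v'| = `|u| + `|v| -> 0 <= s <= h -> 0 <= t <= h ->
    ball x e (x + s *: u' + t *: v').
  move=> uv /andP[s0 sh] /andP[t0 th]; rewrite -ball_normE /=.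
  rewrite -addrA opprD addrA subrr sub0r normrN (le_lt_trans (ler_normD _ _))// !normrZ !ger0_norm//.
  apply: (@le_lt_trans _ _ (h * (`|u'| + `|v'|))).
    by rewrite mulrDr lerD// ler_wpM2r.
  by rewrite uv -[ltRHS](divfK (lt0r_neq0 den)) -/h ltr_pM2l// ltrDl.
have key (u' v' : V) : `|u'| + `|v'| = `|u| + `|v| ->
   exists s t, [/\ 0 <= s <= h, 0 <= t <= h &
    f (x + h *: u' + h *: v') - f (x + h *: u') - f (x + h *: v') + f x =
    h ^+ 2 * 'D_v' ('D_u' f) (x + s *: u' + t *: v')].
  move=> uv; apply: (second_difference (f := f) (u := u') (v := v') (x := x) h0) => s t s0 t0.
  have [Oy _ _] := He _ (inB u' v' s t uv s0 t0).
  by split; apply: diff_derivable; [exact: df1|exact: (df2 u').1].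
have [s [t [s0 t0 E1]]] := key u v erefl.
have [s' [t' [s'0 t'0 E2]]] := key v u (addrC _ _).
have [_ _ b1] := He _ (inB u v s t erefl s0 t0).
have [_ b2 _] := He _ (inB v u s' t' (addrC _ _) s'0 t'0).
have hn : h ^+ 2 != 0 by rewrite expf_neq0 ?lt0r_neq0.
rewrite [x + h *: v + h *: u]addrAC in E2.
move: b1 b2 E1 E2; rewrite /eta.
move: ('D_v ('D_u f) (x + s *: u + t *: v)) ('D_u ('D_v f) (x + s' *: v + t' *: u)).
move: ('D_u ('D_v f) x) ('D_v ('D_u f) x) => a b p q bp aq Ep Eq.
have pq : p = q by apply: (mulfI hn); rewrite -Ep -Eq; ring.
move: bp; rewrite pq => bq.
have := ler_distD q a b; rewrite [`|q - b|]distrC => h1.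
by clear -h1 aq bq; lra.
Qed.

End Schwarz.

(** * Global solutions of bounded Lipschitz equations *)

Lemma halving_small (R : realType) (c e : R) : 0 < e ->
  exists k : nat, forall j, (k <= j)%N -> c / 2 ^+ j < e.
Proof.
move=> e0; have : (c / 2 ^+ k) @[k --> \oo] --> (0 : R).
  rewrite -[X in _ --> X](mulr0 c); apply: cvgMl_tmp.
  under eq_fun do rewrite -exprVn.
  by apply: cvg_expr; rewrite ger0_norm ?invr_ge0// invf_lt1// ltr1n.
by move/cvgr_lt/(_ _ e0) => [k _ H]; exists k => j; exact: H.
Qed.

Section Picard.
Variable R : realType.

Lemma derive_eq_increment m n (f g df : R -> 'M[R]_(m, n)) (a b : R) : a <= b ->
  (forall t : R, a <= t <= b -> is_derive t (1 : R) f (df t)) ->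
  (forall t : R, a <= t <= b -> is_derive t (1 : R) g (df t)) ->
  f b - f a = g b - g a.
Proof.
move=> ab Df Dg; apply/eqP; rewrite -subr_eq0 -normr_le0.
rewrite (_ : _ - _ - _ = (f b - g b) - (f a - g a)); last by rewrite !opprB addrACA [RHS]addrACA [- f a + _]addrC.
rewrite -(mul0r (b - a)).
apply: (norm_increment_le_cst (w := fun s => f s - g s) (dw := fun s => df s - df s) ab) => t tab.
  by apply: is_deriveB; [exact: Df|exact: Dg].
by rewrite subrr normr0.
Qed.

(** Antiderivatives on the half-lines ]-B, +oo[ that vanish at 0 agree where
    they are both defined, and so glue. *)
Lemma antiderivative_mx m n (c : R -> 'M[R]_(m, n)) : continuous c ->
  exists2 F : R -> 'M[R]_(m, n), F 0 = 0 & forall t : R, is_derive t (1 : R) F (c t).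
Proof.
move=> cc.
have loc (B : R) : exists F : R -> 'M[R]_(m, n), F 0 = 0 /\
    forall t : R, - B < t -> is_derive t (1 : R) F (c t).
  have ccij i j : continuous (fun t => c t i j).
    by move=> t; have /cvg_mxP := cc t; exact.
  have /choice[G HG] : forall ij : 'I_m * 'I_n, exists F : R -> R, F 0 = 0 /\
      forall t : R, - B < t -> is_derive t (1 : R) F (c t ij.1 ij.2).
    move=> ij; have [F F0 DF] := local_antiderivative B (ccij ij.1 ij.2).
    by exists F.
  exists (fun t => \matrix_(i, j) G (i, j) t); split.
    by apply/matrixP => i j; rewrite !mxE; have [] := HG (i, j).
  move=> t Bt; apply/is_derive_mxP => i j.
  rewrite (_ : (fun _ => _) = G (i, j)); last by apply/funext => s; rewrite mxE.
  by have [_] := HG (i, j); exact.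
have /choice[G HG] := loc.
have same (B B' t : R) : - B < t -> - B' < t -> 0 < B -> 0 < B' -> G B t = G B' t.
  move=> Bt Bt' B0 B'0; have [G0 DG] := HG B; have [G'0 DG'] := HG B'.
  have [t0|/ltW t0] := leP 0 t.
    have := @derive_eq_increment _ _ (G B) (G B') c 0 t t0.
    rewrite G0 G'0 !subr0; apply => s /andP[s0 _].
      by apply: DG; rewrite (lt_le_trans _ s0) ?oppr_lt0.
    by apply: DG'; rewrite (lt_le_trans _ s0) ?oppr_lt0.
  have := @derive_eq_increment _ _ (G B) (G B') c t 0 t0.
  rewrite G0 G'0 !sub0r => H; apply: oppr_inj; apply: H => s /andP[ts _].
    by apply: DG; rewrite (lt_le_trans Bt).
  by apply: DG'; rewrite (lt_le_trans Bt').
exists (fun t => G (`|t| + 1) t) => [|t]; first exact: (HG (`|0| + 1)).1.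
have B0 (s : R) : 0 < `|s| + 1 by rewrite ltr_wpDl.
have Blt (s : R) : - (`|s| + 1) < s.
  by have := ler_norm (- s); rewrite normrN; lra.
have [_ DG] := HG (`|t| + 1 + 1).
have tB : - (`|t| + 1 + 1) < t by have := Blt t; lra.
apply: (near_eq_is_derive _ (DG t tB)).
near=> s; apply: same (Blt s) _ (B0 s); last by rewrite ltr_wpDl // ltW.
have tB1 := Blt t; have : `|t - s| < 1.
  by near: s; move/cvgrPdist_lt: (@cvg_id _ (nbhs t)); apply.
by rewrite ltr_distlC => /andP[]; lra.
Unshelve. all: by end_near. Qed.

Variables (n : nat) (G : 'cV[R]_n -> R -> 'cV[R]_n) (L M : R).
Hypothesis L1 : 1 <= L.
Hypothesis G_lip : forall t y z, `|G y t - G z t| <= L * `|y - z|.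
Hypothesis G_bd : forall t y, `|G y t| <= M.
Hypothesis G_cont : forall y : R -> 'cV[R]_n, continuous y ->
  continuous (fun t => G (y t) t).

Let Ew (t : R) := expR (2 * L * t) + expR (- (2 * L) * t).
Let Sw (t : R) := expR (2 * L * t) - expR (- (2 * L) * t).

Let Ew_ge (t : R) : `|t| <= Ew t.
Proof.
have L0 : 0 <= L by exact: le_trans ler01 L1.
have h (s : R) : s <= expR (2 * L * s).
  have [s0|s0] := leP 0 s; last by rewrite (le_trans (ltW s0))// expR_ge0.
  have : s <= L * s by rewrite ler_peMl.
  by move=> Ls; rewrite (le_trans _ (expR_ge1Dx _))//; lra.
have := h t; have := h (- t); rewrite mulrN -mulNr /Ew.
have := expR_ge0 (2 * L * t); have := expR_ge0 (- (2 * L) * t).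
by rewrite ler_norml => *; apply/andP; split; lra.
Qed.

Let Ew_ge0 (t : R) : 0 <= Ew t.
Proof. exact: le_trans (Ew_ge t). Qed.

Let Sw0 : Sw 0 = 0.
Proof. by rewrite /Sw !mulr0 subrr. Qed.

Let Sw_le (t : R) : `|Sw t| <= Ew t.
Proof.
have := expR_ge0 (2 * L * t); have := expR_ge0 (- (2 * L) * t).
by rewrite /Ew /Sw ler_norml => *; apply/andP; split; lra.
Qed.

Let DSw (c t : R) : is_derive t (1 : R) (fun s => c * Sw s) (c * (2 * L * Ew t)).
Proof.
have D (k : R) : is_derive t (1 : R) (fun s => expR (k * s)) (k * expR (k * t)).
  have Dl : is_derive t (1 : R) (fun s => k * s) k.
    by have := @is_deriveZ R R R id k t 1 1 (is_derive_id _ _); rewrite [_%:A]mulr1.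
  by rewrite [X in is_derive _ _ _ X]mulrC; exact: is_derive1_comp (is_derive_expR _) Dl.
have := @is_deriveZ R R R _ c t 1 _ (is_deriveB (D (2 * L)) (D (- (2 * L)))).
rewrite /GRing.scale /= mulNr opprK -mulrDr; exact.
Qed.

Let weighted_increment (w dw : R -> 'cV[R]_n) (c : R) : 0 <= c -> w 0 = 0 ->
  (forall t : R, is_derive t (1 : R) w (dw t)) ->
  (forall t : R, `|dw t| <= c * (2 * L * Ew t)) ->
  forall t : R, `|w t| <= c * Ew t.
Proof.
move=> c0 w0 Dw dw_le t.
have cS : c * `|Sw t| <= c * Ew t by rewrite ler_wpM2l.
have [t0|/ltW t0] := leP 0 t.
  have := norm_increment_le t0 (fun s _ => Dw s) (fun s _ => DSw c s) (fun s _ => dw_le s).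
  rewrite w0 Sw0 mulr0 !subr0 => h; rewrite (le_trans h)// (le_trans _ cS)//.
  by rewrite ler_wpM2l// ler_norm.
have := norm_increment_le t0 (fun s _ => Dw s) (fun s _ => DSw c s) (fun s _ => dw_le s).
rewrite w0 Sw0 mulr0 !sub0r normrN => h; rewrite (le_trans h)// (le_trans _ cS)//.
by rewrite -mulrN ler_wpM2l// -normrN ler_norm.
Qed.

(** The weight Ew grows like exp(2 L |t|), so that integrating a Lipschitz
    increment halves its weighted size: the iteration converges on the whole
    line at once, without continuation of local solutions. *)
Lemma picard (y0 : 'cV[R]_n) : exists2 y : R -> 'cV[R]_n, y 0 = y0 &
  forall t : R, is_derive t (1 : R) y (G (y t) t).
Proof.
have M0 : 0 <= M by exact: le_trans (G_bd 0 0).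
have L0 : 0 <= L by exact: le_trans ler01 L1.
have /choice[P HP] : forall y : R -> 'cV[R]_n, exists F : R -> 'cV[R]_n,
    continuous y -> F 0 = y0 /\ forall t : R, is_derive t (1 : R) F (G (y t) t).
  move=> y; have [cy|ncy] := pselect (continuous y); last by exists y.
  have [F F0 DF] := antiderivative_mx (G_cont cy).
  exists (fun t => F t + y0) => _; split=> [|t]; first by rewrite F0 add0r.
  rewrite -[X in is_derive _ _ _ X]addr0.
  exact: (is_deriveD (DF t) (is_derive_cst y0 t 1)).
pose Y k := iter k P (cst y0).
have cP y : continuous y -> continuous (P y).
  by move=> cy t; have [_ D] := HP y cy; exact: is_derive_continuous (D t).
have cY k : continuous (Y k).
  by elim: k => [|k IH]; [move=> t; exact: cvg_cst|exact: cP].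
have step y z c : continuous y -> continuous z -> 0 <= c ->
    (forall t, `|y t - z t| <= c * 2 * Ew t) ->
    forall t, `|P y t - P z t| <= c * Ew t.
  move=> cy cz c0 yz; have [Py0 DPy] := HP y cy; have [Pz0 DPz] := HP z cz.
  apply: (weighted_increment (w := fun t => P y t - P z t)
    (dw := fun t => G (y t) t - G (z t) t) c0).
  - by rewrite Py0 Pz0 subrr.
  - move=> t; rewrite (le_trans (G_lip _ _ _))//.
    by rewrite (le_trans (ler_wpM2l L0 (yz t)))//; lra.
have dY k t : `|Y k.+1 t - Y k t| <= M / 2 ^+ k * Ew t.
  elim: k t => [|k IH] t; last first.
    apply: (step _ _ _ (cY k.+1) (cY k)) => [|s].
      by rewrite divr_ge0 ?exprn_ge0.
    by rewrite (le_trans (IH s))// ler_wpM2r// exprS invfM; lra.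
  have [P0 DP] := HP (Y 0%N) (cY 0%N); rewrite expr0 divr1.
  rewrite (le_trans _ (ler_wpM2l M0 (Ew_ge t)))//.
  have -> : Y 0%N t = P (Y 0%N) 0 by rewrite P0.
  have [t0|/ltW t0] := leP 0 t.
    have := norm_increment_le_cst t0 (fun s _ => DP s) (fun s _ => G_bd s _).
    by rewrite subr0 ger0_norm.
  have := norm_increment_le_cst t0 (fun s _ => DP s) (fun s _ => G_bd s _).
  by rewrite sub0r distrC ler0_norm.
have dYj k j t : `|Y (k + j)%N t - Y k t| <= M / 2 ^+ k * 2 * Ew t.
  suff : `|Y (k + j)%N t - Y k t| <= M / 2 ^+ k * (2 - 2 / 2 ^+ j) * Ew t.
    move=> h; rewrite (le_trans h)// ler_wpM2r// ler_wpM2l ?divr_ge0 ?exprn_ge0//.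
    by rewrite gerBl divr_ge0.
  elim: j => [|j IH]; first by rewrite addn0 subrr normr0 expr0 divr1 subrr mulr0 mul0r.
  rewrite -(subrKA (Y (k + j)%N t)) (le_trans (ler_normD _ _))//.
  rewrite addnS (le_trans (lerD (dY _ _) IH))// -mulrDl ler_wpM2r// exprD exprS !invfM.
  by have := mulr_ge0 (mulr_ge0 M0 (_ : 0 <= (2 ^+ k)^-1)) (_ : 0 <= (2 ^+ j)^-1); rewrite !invr_ge0 !exprn_ge0// => /(_ isT isT); lra.
have small (c e : R) : 0 < e -> exists k : nat, c / 2 ^+ k < e.
  by move=> e0; have [k H] := halving_small c e0; exists k; exact: H.
have /choice[y Hy] : forall t : R, exists y : 'cV[R]_n, forall k : nat, `|y - Y k t| <= M / 2 ^+ k * 2 * Ew t.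
  move=> t; have : cvg (Y k t @[k --> \oo]).
    apply/cauchy_cvgP/cauchy_exP => e e0 /=.
    have [k Hk] := small (M * 2 * Ew t) e e0.
    exists (Y k t); exists k => // j /= kj.
    rewrite -ball_normE /= distrC -(subnKC kj) (le_lt_trans (dYj _ _ _))//.
    by rewrite (le_lt_trans _ Hk)//; lra.
  move=> /cvg_ex[/= l Yl]; exists l => k.
  have : `|Y j t - Y k t| @[j --> \oo] --> `|l - Y k t|.
    by apply: cvg_norm; apply: cvgB => //; exact: cvg_cst.
  move=> h; apply: (cvgr_to_le h); near=> j.
  rewrite -(@subnKC k j); last by near: j; exact: nbhs_infty_ge.
  exact: dYj.
have cy : continuous y.
  move=> t; apply/cvgrPdist_lt => e e0.
  pose B := Ew t + 1.
  have [k Hk] := small (M * 2 * B) (e / 3) (divr_gt0 e0 (ltr0n _ 3)).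
  have cE : {for t, continuous Ew}.
    by rewrite /Ew; apply: cvgD; apply: continuous_comp; try exact: continuous_expR;
      apply: cvgMl_tmp; exact: cvg_id.
  near=> s.
  have Yts : `|Y k t - Y k s| < e / 3.
    by near: s; move/cvgrPdist_lt: (cY k t); apply; rewrite divr_gt0.
  have EB : Ew s <= B.
    have : `|Ew t - Ew s| < 1 by near: s; move/cvgrPdist_lt: cE; apply.
    by rewrite ltr_distlC /B => /andP[]; lra.
  have := Hy t k; have := Hy s k.
  have M2 : 0 <= M / 2 ^+ k * 2 by rewrite mulr_ge0// divr_ge0.
  have := ler_wpM2l M2 EB; have := ler_wpM2l M2 (_ : Ew t <= B).
  rewrite lerDl ler01 => /(_ isT).
  move=> h1 h2 h3 h4.
  rewrite (_ : y t - y s = (y t - Y k t) + (Y k t - Y k s) - (y s - Y k s)); last first.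
    by rewrite opprB !subrKA.
  rewrite (le_lt_trans (ler_normB _ _))//.
  rewrite (le_lt_trans (lerD (ler_normD _ _) (lexx _)))//; lra.
have [Py0 DPy] := HP y cy.
suff E : P y = y.
  exists y; first by have := Py0; rewrite E.
  by move=> t; have := DPy t; rewrite E.
apply/funext => t; apply/eqP; rewrite -subr_eq0 -normr_le0.
apply/ler_addgt0Pl => e e0; rewrite addr0 ltW//.
have [k Hk] := small (M * 2 * Ew t) e e0.
have c0 : 0 <= M / 2 ^+ k by rewrite divr_ge0 ?exprn_ge0.
have h1 : `|P y t - Y k.+1 t| <= M / 2 ^+ k * Ew t.
  by apply: (step y (Y k)) => // s; exact: Hy.
have := Hy t k.+1; rewrite exprS invfM distrC => h2.
rewrite -(subrKA (Y k.+1 t)) (le_lt_trans (ler_normD _ _))//.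
rewrite (le_lt_trans _ Hk)// (le_trans (lerD h1 h2))//; lra.
Unshelve. all: by end_near. Qed.

End Picard.

Lemma is_derive_shiftR (R : realType) (W : normedModType R) (f : R -> W) (t c : R) df :
  is_derive (t + c) (1 : R) f df -> is_derive t (1 : R) (fun s => f (s + c)) df.
Proof.
move=> [fd <-]; have E : (fun h : R => h^-1 *: (f (h *: 1 + t + c) - f (t + c))) =
   (fun h => h^-1 *: (f (h *: 1 + (t + c)) - f (t + c))).
  by apply/funext => h; rewrite addrA.
apply: DeriveDef; first by rewrite /derivable E.
by rewrite /derive E.
Qed.

(** * Asymptotic stability from the monodromy matrix *)

Section Clamp.
Variables (R : realType) (n : nat) (rho : R).
Hypothesis rho0 : 0 <= rho.

(** The nearest-point retraction onto the ball of radius rho of the maximum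
    norm. *)
Definition clamp (w : 'cV[R]_n) : 'cV[R]_n :=
  \col_i Num.max (- rho) (Num.min rho (w i 0)).

Lemma clamp_le w : `|clamp w| <= rho.
Proof.
apply: mx_norm_ler => // i j; rewrite mxE ler_norml le_max lexx /=.
by rewrite ge_max ge_min lexx /= andbT (le_trans _ rho0)// oppr_le0.
Qed.

Lemma clamp_id w : `|w| <= rho -> clamp w = w.
Proof.
move=> wr; apply/colP => i; rewrite mxE.
have : `|w i 0| <= rho by exact: le_trans (ler_mx_norm _ _ _) wr.
by rewrite ler_norml => /andP[h1 h2]; rewrite (min_idPr h2) (max_idPr h1).
Qed.

Lemma clamp_lip w w' : `|clamp w - clamp w'| <= `|w - w'|.
Proof.
apply: mx_norm_ler => // i j; rewrite !mxE.
have : `|w i 0 - w' i 0| <= `|w - w'|.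
  by have := ler_mx_norm (w - w') i 0; rewrite !mxE.
move: (w i 0) (w' i 0) => a b; move: `|w - w'| => c; rewrite !ler_distlC.
move=> /andP[h1 h2].
rewrite /Num.max /Num.min; apply/andP; split;
by do ! (case: ifP => //); lra.
Qed.

Lemma clamp_continuous : continuous clamp.
Proof.
move=> w; apply: (@cvgrPdist_lt _ _ _ (nbhs w) (nbhs_filter w) clamp (clamp w)).2 => e e0.
have /cvgrPdist_lt/(_ e e0) : id @ w --> w by exact: cvg_id.
by apply: filterS => v; exact: le_lt_trans (clamp_lip _ _).
Qed.

End Clamp.

Section LyapunovFloquet.
Variables (R : realType) (n : nat) (U : set 'cV[R]_n).
Variables (F : 'cV[R]_n -> R -> 'cV[R]_n) (DF : 'cV[R]_n * R -> 'M[R]_n).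
Variables (P : R) (x : R -> 'cV[R]_n) (X : R -> 'M[R]_n).
Hypothesis oU : open U.
Hypothesis DFE : forall p, U p.1 ->
  forall v, is_derive p.1 v (F ^~ p.2) (DF p *m v).
Hypothesis cDF : forall p, U p.1 -> {for p, continuous DF}.
Hypothesis cF : forall p, U p.1 -> {for p, continuous (fun p => F p.1 p.2)}.
Hypothesis P0 : 0 < P.
Hypothesis perF : forall y t, U y -> F y (t + P) = F y t.
Hypothesis solx : forall t : R, U (x t) /\ is_derive t (1 : R) x (F (x t) t).
Hypothesis perx : forall t : R, x (t + P) = x t.
Hypothesis X0 : X 0 = 1%:M.
Hypothesis DX : forall t : R, is_derive t (1 : R) X (DF (x t, t) *m X t).
Hypothesis contr : forall e : R, 0 < e -> exists2 k, (0 < k)%N & `|X P ^+ k| < e.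

Let K : set ('cV[R]_n * R)%type := (fun t => (x t, t)) @` `[0, P].
Let O : set ('cV[R]_n * R)%type := [set p | U p.1].

Let cx : continuous x.
Proof. by move=> t; have [_ D] := solx t; exact: is_derive_continuous D. Qed.

Let cK : compact K.
Proof.
apply: continuous_compact; last exact: segment_compact.
apply: continuous_subspaceT => t.
exact: (cvg_pair (@cx t) (@cvg_id _ (nbhs t))).
Qed.

Let oO : open O.
Proof.
by move: oU; apply: open_comp => p _; exact: cvg_fst.
Qed.

Let KO : K `<=` O.
Proof. by move=> _ [t _ <-]; have [] := solx t. Qed.

Let cKF p : K p -> {for p, continuous DF}.
Proof. by move=> Kp; apply: cDF; exact: KO. Qed.

Let Kt (t : R) : 0 <= t <= P -> K (x t, t).
Proof. by move=> tP; exists t => //=; rewrite in_itv. Qed.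

Let perxn k t : x (t + k%:R * P) = x t.
Proof.
elim: k => [|k IH]; first by rewrite mul0r addr0.
by rewrite -natr1 mulrDl mul1r addrA perx IH.
Qed.

Let perFn k y t : U y -> F y (t + k%:R * P) = F y t.
Proof.
move=> Uy; elim: k => [|k IH]; first by rewrite mul0r addr0.
by rewrite -natr1 mulrDl mul1r addrA perF// IH.
Qed.

Let reduce (t : R) : exists s, [/\ 0 <= s <= P, x s = x t &
  forall y, U y -> F y s = F y t].
Proof.
have pos (r : R) : 0 <= r -> exists s, [/\ 0 <= s <= P, x s = x r &
    forall y, U y -> F y s = F y r].
  move=> r0; have rP : 0 <= r / P by rewrite divr_ge0// ltW.
  have /andP[h1 h2] := truncn_itv rP.
  exists (r - (Num.trunc (r / P))%:R * P); split.
  - move: h1 h2; rewrite ler_pdivlMr// ltr_pdivrMr// -natr1 mulrDl mul1r => h1 h2.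
    by apply/andP; split; lra.
  - by rewrite -[in RHS](subrK ((Num.trunc (r / P))%:R * P) r) perxn.
  - by move=> y Uy; rewrite -[in RHS](subrK ((Num.trunc (r / P))%:R * P) r) perFn.
have [|t0] := leP 0 t; first exact: pos.
have h := truncnS_gt (- t / P); set k := (Num.trunc (- t / P)).+1 in h.
have [|s [sP xs Fs]] := pos (t + k%:R * P).
  by move: h; rewrite ltr_pdivrMr//; lra.
exists s; split=> //; first by rewrite xs perxn.
by move=> y Uy; rewrite Fs// perFn.
Qed.

Let tube : exists rho L M : R, [/\ 0 < rho, 0 < L & forall (t : R) w w',
   `|w - x t| <= rho -> `|w' - x t| <= rho ->
   [/\ U w, `|F w t - F w' t| <= L * `|w - w'| & `|F w t| <= M]].
Proof.
have [rho [L [rho0 L0 H]]] := lipschitz_tube oO DFE cK KO cKF.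
have cKF0 p : K p -> {for p, continuous (fun p => F p.1 p.2)}.
  by move=> Kp; apply: cF; exact: KO.
have [C C0 HC] := compact_bounded_unif cK cKF0.
exists (rho / 2), L, (C + L * rho); split=> //; first by rewrite divr_gt0.
move=> t w w' wt wt'; have [s [sP xs Fs]] := reduce t.
have r2 : rho / 2 < rho by rewrite ltr_pdivrMr// ltr_pMr// ltr1n.
have ws : `|w - x s| < rho by rewrite xs (le_lt_trans wt).
have ws' : `|w' - x s| < rho by rewrite xs (le_lt_trans wt').
have ss : `|s - s| < rho by rewrite subrr normr0.
have xx : `|x s - x s| < rho by rewrite subrr normr0.
have [Uw Lww'] := H _ w w' s (Kt sP) ws ws' ss.
have [Uw' _] := H _ w' w s (Kt sP) ws' ws ss.
have [_ Lwx] := H _ w (x s) s (Kt sP) ws xx ss.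
split=> //; first by rewrite -!Fs.
rewrite -Fs// -(subrK (F (x s) s) (F w s)) (le_trans (ler_normD _ _))// addrC lerD//.
  exact: (HC _ (Kt sP)).
by rewrite (le_trans Lwx)// ler_wpM2l// ltW.
Qed.

Section WithTube.
Variables (rho0 L M : R).
Hypothesis rho0_gt0 : 0 < rho0.
Hypothesis L_gt0 : 0 < L.
Hypothesis tubeP : forall (t : R) w w',
   `|w - x t| <= rho0 -> `|w' - x t| <= rho0 ->
   [/\ U w, `|F w t - F w' t| <= L * `|w - w'| & `|F w t| <= M].

(** The solutions of the original equation and those of the equation clamped
    to the tube are both of this kind, so that a single decay estimate
    serves attraction and existence. *)
Definition tube_solution (y dy : R -> 'cV[R]_n) := forall t : R, 0 <= t ->
  is_derive t (1 : R) y (dy t) /\ (`|y t - x t| <= rho0 -> dy t = F (y t) t).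

(** B is the linear part of the displacement after time Q. The form with
    arbitrary eta and shrinking rho is stable under composition, which takes
    it from one period to k periods. *)
Definition tube_estimate (Q : R) (B : 'M[R]_n) := exists2 C : R, 1 <= C &
  forall eta : R, 0 < eta -> exists2 rho : R, 0 < rho & forall y dy, tube_solution y dy ->
    `|y 0 - x 0| < rho ->
    (forall t : R, 0 <= t <= Q -> `|y t - x t| <= C * `|y 0 - x 0|) /\
    `|y Q - x 0 - B *m (y 0 - x 0)| <= eta * `|y 0 - x 0|.

Let x_near (t : R) : `|x t - x t| <= rho0.
Proof. by rewrite subrr normr0 ltW. Qed.

(** Gronwall for y - x, then for the difference between y - x and its
    linearization X (y 0 - x 0), whose derivative is controlled by the
    uniform Taylor expansion along the orbit. *)
Lemma one_period_estimate : tube_estimate P (X P).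
Proof.
have [C C0 HC] := compact_bounded_unif cK cKF.
have C1 := gronwall_cst_ge1 n (ltW L_gt0) (ltW P0).
set c1 := gronwall_cst n L P in C1.
have nC0 : 0 <= n%:R * C by rewrite mulr_ge0// ltW.
have C2 := gronwall_cst_ge1 n nC0 (ltW P0).
set c2 := gronwall_cst n (n%:R * C) P in C2.
exists c1 => // eta eta0.
have c10 : 0 < c1 by exact: lt_le_trans C1.
have c20 : 0 < c2 by exact: lt_le_trans C2.
pose a := eta / (c2 * c1).
have a0 : 0 < a by rewrite divr_gt0// mulr_gt0.
have [rT rT0 HT] := taylor_unif oO DFE cK KO cKF a0.
pose m := Num.min rho0 rT.
have m0 : 0 < m by rewrite lt_min rho0_gt0.
exists (m / (2 * c1)) => [|y dy ysol]; first by rewrite divr_gt0// mulr_gt0.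
set d := `|y 0 - x 0| => dm.
have c1d : c1 * d < m / 2.
  move: dm; rewrite invfM mulrA ltr_pdivlMr// mulrC.
  by [].
have Du (t : R) : 0 <= t <= P -> is_derive t (1 : R) (fun s => y s - x s) (dy t - F (x t) t).
  move=> /andP[t0 _]; have [Dy _] := ysol t t0; have [_ Dx] := solx t.
  exact: is_deriveB.
have m2 : m / 2 < m by rewrite ltr_pdivrMr// ltr_pMr// ltr1n.
have [mr mT] : m <= rho0 /\ m <= rT by rewrite !ge_min !lexx orbT.
have u_le (t : R) : 0 <= t <= P -> `|y t - x t| <= c1 * d.
  have := @gronwall R n (fun s => y s - x s) (fun s => dy s - F (x s) s) P L 0 (m / 2)
    (ltW L_gt0) (lexx _) Du; rewrite addr0 -/d -/c1; apply=> // s sP us.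
  have ur : `|y s - x s| <= rho0 by rewrite (le_trans us)// (le_trans (ltW m2)).
  have [_ ->//] := ysol s (proj1 (andP sP)).
  by rewrite addr0; have [] := tubeP ur (x_near s).
split=> //.
pose e s := (y s - x s) - X s *m (y 0 - x 0).
have De (t : R) : 0 <= t <= P -> is_derive t (1 : R) e
    ((dy t - F (x t) t) - DF (x t, t) *m X t *m (y 0 - x 0)).
  by move=> tP; apply: is_deriveB; [exact: Du|exact: is_derive_mulmxr (DX t)].
have e0 : e 0 = 0 by rewrite /e X0 mul1mx subrr.
have PP : 0 <= P <= P by rewrite ltW//= lexx.
have := @gronwall R n e _ P (n%:R * C) (a * (c1 * d)) (c2 * (a * (c1 * d)) + 1) nC0 _ De.
rewrite -/c2 e0 normr0 add0r ltrDl ltr01 => /(_ _ _ isT P PP).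
have -> : c2 * (a * (c1 * d)) = eta * d.
  by rewrite /a mulrA mulrCA invfM; field; rewrite !gt_eqF.
rewrite /e (_ : x P = x 0) => [h|]; last by rewrite -[in LHS](add0r P) perx.
apply: h.
  exact: mulr_ge0 (ltW a0) (mulr_ge0 (ltW c10) (normr_ge0 _)).
move=> s sP _.
have us := u_le s sP.
have us1 : `|y s - x s| < m by rewrite (le_lt_trans us)// (lt_trans c1d).
have [_ dyE] := ysol s (proj1 (andP sP)).
rewrite dyE; last by rewrite (le_trans (ltW us1)).
rewrite -mulmxA (_ : _ - _ = (F (y s) s - F (x s) s - DF (x s, s) *m (y s - x s))
   + DF (x s, s) *m e s); last first.
  by rewrite /e [DF _ *m (_ - X s *m _)]mulmxBr addrA subrK.
rewrite (le_trans (ler_normD _ _))// addrC lerD//.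
  rewrite (le_trans (ler_norm_mulmx _ _))// ler_wpM2r// ler_wpM2l//.
  exact: (HC _ (Kt sP)).
have := HT (x s, s) (y s) s (Kt sP) (lt_le_trans us1 mT) _.
rewrite subrr normr0 => /(_ rT0) /le_trans; apply.
by rewrite ler_wpM2l// ltW.
Qed.

Lemma tube_estimate_iter k : tube_estimate (k%:R * P) (X P ^+ k).
Proof.
elim: k => [|k [C C1 IH]].
  exists 1 => // eta eta0; exists 1 => // y dy ysol _; rewrite mul0r expr0.
  split=> [t|]; last by rewrite mul1mx subrr normr0 mulr_ge0// ltW.
  by rewrite -eq_le => /eqP <-; rewrite mul1r.
have [C' C1' H] := one_period_estimate.
have C0 : 0 < C by exact: lt_le_trans C1.
have C0' : 0 < C' by exact: lt_le_trans C1'.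
exists (C' * C) => [|eta eta0]; first by rewrite -[leLHS]mulr1 ler_pM.
have a0 : 0 < eta / (2 * C) by rewrite divr_gt0// mulr_gt0.
have nX0 : 0 < n%:R * `|X P| + 1 by rewrite ltr_wpDl// mulr_ge0.
have b0 : 0 < eta / (2 * (n%:R * `|X P| + 1)) by rewrite divr_gt0// mulr_gt0.
have [r1 r10 H1] := H _ a0.
have [r2 r20 H2] := IH _ b0.
exists (Num.min r2 (r1 / C)) => [|y dy ysol]; first by rewrite lt_min r20 divr_gt0.
rewrite lt_min ltr_pdivlMr//.
set d := `|y 0 - x 0| => /andP[dr2 dr1].
have d0 : 0 <= d by exact: normr_ge0.
have [yk1 yk2] := H2 y dy ysol dr2; rewrite -/d in yk1 yk2.
have kP0 : 0 <= k%:R * P by rewrite mulr_ge0// ltW.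
have shift_sol : tube_solution (fun t => y (t + k%:R * P)) (fun t => dy (t + k%:R * P)).
  move=> t t0; have [Dy Ey] := ysol (t + k%:R * P) (addr_ge0 t0 kP0).
  split; first exact: is_derive_shiftR Dy.
  move=> yt; rewrite perxn in Ey; rewrite (Ey yt) perFn//.
  by have [] := tubeP yt yt.
have ykd : `|y (k%:R * P) - x 0| <= C * d.
  have E : x (k%:R * P) = x 0 by rewrite -[in LHS](add0r (k%:R * P)) perxn.
  by have := yk1 (k%:R * P); rewrite kP0 lexx E; exact.
have := H1 _ _ shift_sol; rewrite /= !add0r => /(_ _)[|h1 h2].
  by rewrite (le_lt_trans ykd)// mulrC.
split=> [t /andP[t0 tk]|].
  have [tk'|tk'] := leP t (k%:R * P).
    have tk2 : 0 <= t <= k%:R * P by rewrite t0.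
    rewrite (le_trans (yk1 t tk2))// ler_wpM2r// -[leLHS]mul1r.
    by rewrite ler_wpM2r// ltW.
  (* in the last period, the estimate for one period is applied to the shifted
     curve *)
  have tk2 : 0 <= t - k%:R * P <= P.
    by apply/andP; split; [lra|move: tk; rewrite -natr1 mulrDl mul1r; lra].
  have := h1 _ tk2; rewrite subrK (_ : x (t - k%:R * P) = x t); last first.
    by rewrite -(perxn k) subrK.
  by move=> h3; rewrite (le_trans h3)// -mulrA ler_wpM2l// ltW.
rewrite -natr1 mulrDl mul1r [_ + P]addrC exprS -mulmxE -mulmxA.
rewrite [leLHS](_ : _ = `|(y (P + k%:R * P) - x 0 - X P *m (y (k%:R * P) - x 0)) +
   X P *m (y (k%:R * P) - x 0 - X P ^+ k *m (y 0 - x 0))|); last first.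
  by rewrite [X P *m (_ - X P ^+ k *m _)]mulmxBr addrA subrK.
rewrite (le_trans (ler_normD _ _))// (splitr eta) mulrDl lerD//.
  rewrite (le_trans h2)//.
  rewrite (le_trans (ler_wpM2l (ltW a0) ykd))//.
  by rewrite invfM !mulrA divfK ?gt_eqF.
rewrite (le_trans (ler_norm_mulmx _ _))//.
have nA : 0 <= n%:R * `|X P| by rewrite mulr_ge0.
rewrite (le_trans (ler_wpM2l nA yk2))// mulrA ler_wpM2r// invfM.
rewrite [leLHS](_ : _ = eta / 2 * (n%:R * `|X P| / (n%:R * `|X P| + 1))); last by ring.
by rewrite ler_piMr ?divr_ge0 ?ltW// ltr_pdivrMr// mul1r ltrDl.
Qed.

(** Over k periods the linear part is X P ^+ k, which is small for a
    suitable k, so the deviation is at least halved. *)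
Lemma contraction_estimate : exists Q C rho : R, [/\ 0 < Q, 1 <= C, 0 < rho,
    (forall t, x (t + Q) = x t) /\ (forall y t, U y -> F y (t + Q) = F y t) &
  forall y dy, tube_solution y dy -> `|y 0 - x 0| < rho ->
    (forall t : R, 0 <= t <= Q -> `|y t - x t| <= C * `|y 0 - x 0|) /\
    `|y Q - x Q| <= 2^-1 * `|y 0 - x 0|].
Proof.
have e0 : 0 < (4 * n.+1%:R)^-1 :> R by rewrite invr_gt0 mulr_gt0.
have [k k0 Xk] := contr e0.
have [C C1 H] := tube_estimate_iter k.
have [|rho rho_gt0 Hrho] := H 4^-1; first by rewrite invr_gt0.
exists (k%:R * P), C, rho; split=> //; first by rewrite mulr_gt0// ltr0n.
  by split=> [t|y t Uy]; rewrite ?perxn ?perFn.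
move=> y dy ysol yrho; have [h1 h2] := Hrho y dy ysol yrho.
split=> //.
have -> : x (k%:R * P) = x 0 by rewrite -[in LHS](add0r (k%:R * P)) perxn.
rewrite -(subrK (X P ^+ k *m (y 0 - x 0)) (y (k%:R * P) - x 0)).
rewrite (le_trans (ler_normD _ _))//.
have -> : (2^-1 : R) = 4^-1 + 4^-1 by field.
rewrite mulrDl lerD// (le_trans (ler_norm_mulmx _ _))// ler_wpM2r//.
rewrite (le_trans (ler_wpM2l (ler0n _ n) (ltW Xk)))// invfM mulrCA.
by rewrite ler_piMr// ler_pdivrMr// mul1r ler_nat.
Qed.

Lemma tube_decay : exists Q C rho : R, [/\ 0 < Q, 1 <= C, 0 < rho &
  forall y dy, tube_solution y dy -> `|y 0 - x 0| < rho ->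
    forall (j : nat) (t : R), j%:R * Q <= t <= j.+1%:R * Q ->
      `|y t - x t| <= C / 2 ^+ j * `|y 0 - x 0|].
Proof.
have [Q [C [rho [Q0 C1 rho_gt0 [xQ FQ] H]]]] := contraction_estimate.
have xQn j t : x (t + j%:R * Q) = x t.
  elim: j => [|j IH]; first by rewrite mul0r addr0.
  by rewrite -natr1 mulrDl mul1r addrA xQ.
have FQn j y t : U y -> F y (t + j%:R * Q) = F y t.
  move=> Uy; elim: j => [|j IH]; first by rewrite mul0r addr0.
  by rewrite -natr1 mulrDl mul1r addrA FQ.
exists Q, C, rho; split=> // y dy ysol yrho.
set d := `|y 0 - x 0| in yrho *; have d0 : 0 <= d by exact: normr_ge0.
have shift_sol (j : nat) : tube_solution (fun t => y (t + j%:R * Q)) (fun t => dy (t + j%:R * Q)).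
  move=> t t0; have jQ0 : 0 <= j%:R * Q by rewrite mulr_ge0// ltW.
  have [Dy Ey] := ysol (t + j%:R * Q) (addr_ge0 t0 jQ0).
  split; first exact: is_derive_shiftR Dy.
  move=> yt; rewrite xQn in Ey; rewrite (Ey yt) FQn//.
  by have [] := tubeP yt yt.
have yj (j : nat) : `|y (j%:R * Q) - x 0| <= d / 2 ^+ j.
  elim: j => [|j IH]; first by rewrite mul0r expr0 divr1.
  have yr : `|y (0 + j%:R * Q) - x 0| < rho.
    rewrite add0r (le_lt_trans IH)// (le_lt_trans _ yrho)//.
    by rewrite ler_pdivrMr ?exprn_gt0// ler_peMr// exprn_ege1// ler1n.
  have [_] := H _ _ (shift_sol j) yr; rewrite add0r.
  rewrite (_ : x Q = x 0); last by rewrite -[in LHS](add0r Q) xQ.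
  rewrite -[j.+1%:R]natr1 mulrDl mul1r [_ + Q]addrC => /le_trans; apply.
  by rewrite exprS invfM mulrCA ler_wpM2l.
move=> j t /andP[jt tj].
have yr : `|y (0 + j%:R * Q) - x 0| < rho.
  rewrite add0r (le_lt_trans (yj j))// (le_lt_trans _ yrho)//.
  by rewrite ler_pdivrMr ?exprn_gt0// ler_peMr// exprn_ege1// ler1n.
have [+ _] := H _ _ (shift_sol j) yr; rewrite add0r.
have tk : 0 <= t - j%:R * Q <= Q.
  by apply/andP; split; [lra|move: tj; rewrite -natr1 mulrDl mul1r; lra].
move=> /(_ _ tk); rewrite subrK (_ : x (t - j%:R * Q) = x t); last first.
  by rewrite -(xQn j) subrK.
move=> h; rewrite (le_trans h)// mulrAC -mulrA ler_wpM2l ?yj//.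
by rewrite (le_trans _ C1).
Qed.

End WithTube.

(** Attraction and stability follow from the geometric decay in the tube.
    Existence: the field composed with the clamping to the tube is bounded
    and globally Lipschitz, its solution stays in the interior of the tube
    by the same decay, and there it solves the original equation. *)
Lemma floquet_stability : asymptotically_stable U F x.
Proof.
have [rho0 [L [M [rho0_gt0 L0 tubeP]]]] := tube.
have [Q [C [rho [Q0 C1 rho_gt0 H]]]] := tube_decay rho0_gt0 L0 tubeP.
have C0 : 0 < C by exact: lt_le_trans C1.
have C0' := ltW C0.
have box (t : R) : 0 <= t -> exists j : nat, j%:R * Q <= t < j.+1%:R * Q.
  move=> t0; have tQ : 0 <= t / Q by rewrite divr_ge0// ltW.
  have /andP[h1 h2] := truncn_itv tQ; exists (Num.trunc (t / Q)).
  by rewrite -ler_pdivlMr// h1 /= -ltr_pdivrMr.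
have C2 (j : nat) : C / 2 ^+ j <= C.
  by rewrite ler_pdivrMr ?exprn_gt0// ler_peMr// exprn_ege1// ler1n.
have decay y dy : tube_solution rho0 y dy -> `|y 0 - x 0| < rho ->
    forall t : R, 0 <= t -> `|y t - x t| <= C * `|y 0 - x 0|.
  move=> ysol yr t t0; have [j /andP[jt tj]] := box t t0.
  have jtj : j%:R * Q <= t <= j.+1%:R * Q by rewrite jt ltW.
  by rewrite (le_trans (H _ _ ysol yr j t jtj))// ler_wpM2r.
move=> eta eta0.
pose r := Num.min rho (Num.min eta rho0 / (2 * C)).
have m0 : 0 < Num.min eta rho0 by rewrite lt_min eta0.
have r0 : 0 < r by rewrite lt_min rho_gt0 divr_gt0// mulr_gt0.
exists r => // y0; rewrite lt_min => /andP[y0rho].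
rewrite ltr_pdivlMr ?mulr_gt0// => y0m.
have y0C : C * `|y0 - x 0| < Num.min eta rho0.
  rewrite (le_lt_trans _ y0m)// mulrC ler_wpM2l// ler_peMl ?ltW//.
  by rewrite ltr1n.
have [y0eta y0rho0] : C * `|y0 - x 0| < eta /\ C * `|y0 - x 0| < rho0.
  by move: y0C; rewrite lt_min => /andP[].
split; last first.
  move=> y [a a0 ysol] y00.
  have Iy (t : R) : 0 <= t -> [set` `](- a), +oo[] t.
    by move=> t0; rewrite /= in_itv /= andbT (lt_le_trans _ t0)// oppr_lt0.
  have ts : tube_solution rho0 y (fun t => F (y t) t).
    by move=> t t0; split=> //; have [_] := ysol t (Iy t t0).
  rewrite -y00 in y0rho y0eta.
  split=> [t t0|]; first by rewrite (le_lt_trans (decay _ _ ts y0rho t t0)).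
  apply/cvgrPdist_lt => e e0.
  have [k Hk] := halving_small (C * `|y 0 - x 0|) e0.
  near=> t; rewrite sub0r normrN normr_id.
  have kt : k%:R * Q <= t by near: t; apply: nbhs_pinfty_ge; rewrite num_real.
  have t0 : 0 <= t by rewrite (le_trans _ kt)// mulr_ge0// ltW.
  have [j /andP[jt tj]] := box t t0.
  have jtj : j%:R * Q <= t <= j.+1%:R * Q by rewrite jt ltW.
  have kj : (k <= j)%N.
    by rewrite -ltnS -(ltr_nat R) -(ltr_pM2r Q0) (le_lt_trans kt).
  by rewrite (le_lt_trans (H _ _ ts y0rho j t jtj))// mulrAC Hk.
pose G (w : 'cV[R]_n) (t : R) := F (x t + clamp rho0 (w - x t)) t.
have rho0_ge0 := ltW rho0_gt0.
have xc (t : R) w : `|x t + clamp rho0 w - x t| <= rho0.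
  by rewrite addrC addKr clamp_le.
have GL : forall (t : R) y z, `|G y t - G z t| <= (L + 1) * `|y - z|.
  move=> t y z; have [_ h _] := tubeP t _ _ (xc t (y - x t)) (xc t (z - x t)).
  have L0' := ltW L0.
  rewrite (le_trans h)// ler_pM ?lerDl//.
  rewrite opprD addrACA subrr add0r (le_trans (clamp_lip _ _ _))//.
  by rewrite opprB addrA subrK.
have GM : forall (t : R) y, `|G y t| <= M.
  by move=> t y; have [] := tubeP t _ _ (xc t (y - x t)) (xc t (y - x t)).
have Gc : forall y : R -> 'cV[R]_n, continuous y -> continuous (fun t => G (y t) t).
  move=> y cy t.
  have Uc : U (x t + clamp rho0 (y t - x t)).
    by have [] := tubeP t _ _ (xc t (y t - x t)) (xc t (y t - x t)).
  have c1 : (fun s => x s + clamp rho0 (y s - x s)) @ t --> x t + clamp rho0 (y t - x t).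
    have c0 : (fun s => y s - x s) @ t --> y t - x t.
      by apply: cvgB; [exact: cy|exact: cx].
    apply: cvgD; first exact: cx.
    exact: (cvg_comp _ (clamp rho0) c0 (@clamp_continuous _ _ _ (y t - x t))).
  have c2 : (fun s => (x s + clamp rho0 (y s - x s), s)) @ t -->
      (x t + clamp rho0 (y t - x t), t).
    exact: (cvg_pair c1 (@cvg_id _ (nbhs t))).
  (* continuity of F at the clamped point, which lies in U *)
  have c3 := cF (p := (x t + clamp rho0 (y t - x t), t)) Uc.
  exact: (cvg_comp (fun s => (x s + clamp rho0 (y s - x s), s)) (fun p => F p.1 p.2) c2 c3).
have L1 : 1 <= L + 1 by rewrite lerDr ltW.
have [y yy0 Dy] := picard L1 GL GM Gc y0.
have GE (t : R) : `|y t - x t| <= rho0 -> G (y t) t = F (y t) t.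
  by move=> yt; rewrite /G clamp_id// addrC subrK.
have ts : tube_solution rho0 y (fun t => G (y t) t).
  by move=> t t0; split; [exact: Dy|exact: GE].
have near0 : \forall t \near (0 : R), `|y t - x t| < rho0.
  have cy : (fun t => `|y t - x t|) @ (0 : R) --> `|y 0 - x 0|.
    apply: cvg_norm; apply: cvgB; last exact: cx.
    exact: is_derive_continuous (Dy 0).
  apply: (cvgr_lt _ cy); rewrite yy0 (le_lt_trans _ y0rho0)// ler_peMl//.
have /nbhs_ballP[a /= a0 Ha] := near0.
exists y => //; exists a => // t; rewrite /= in_itv /= andbT => ta.
have yt : `|y t - x t| < rho0.
  have [t0|t0] := leP 0 t.
    by rewrite (le_lt_trans (decay _ _ ts _ t t0)) ?yy0.
  by apply: Ha; rewrite -ball_normE /= sub0r normrN ltr0_norm// ltrNl.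
split; first by have [] := tubeP t _ _ (ltW yt) (ltW yt).
by rewrite -GE ?ltW//; exact: Dy.
Unshelve. all: by end_near. Qed.

End LyapunovFloquet.

(** * Powers of a matrix with spectrum in the open disk *)

Section Powers.
Variable R : realType.
Local Notation C := R[i].
Import ComplexField.Normc.

(** A contraction with a vanishing forcing term forgets its initial value. *)
Lemma recurrence_small (a r : nat -> R) (q : R) : 0 <= q < 1 ->
  (forall k, a k.+1 <= q * a k + r k) ->
  (forall e : R, 0 < e -> exists N, forall k, (N <= k)%N -> r k < e) ->
  forall e : R, 0 < e -> exists N, forall k, (N <= k)%N -> a k < e.
Proof.
move=> /andP[q0 q1] ak rk e e0.
have q1' : 0 < 1 - q by rewrite subr_gt0.
have [N HN] := rk (e * (1 - q) / 2) (divr_gt0 (mulr_gt0 e0 q1') (ltr0n _ 2)).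
have aN j : a (N + j)%N <= q ^+ j * a N + e / 2.
  elim: j => [|j IH]; first by rewrite addn0 expr0 mul1r lerDl divr_ge0// ltW.
  rewrite addnS (le_trans (ak _))//.
  have h1 := ltW (HN (N + j)%N (leq_addr _ _)).
  rewrite (le_trans (lerD (ler_wpM2l q0 IH) h1))// exprS.
  by rewrite -subr_ge0 [X in 0 <= X](_ : _ = 0)//; field.
have : (a N * q ^+ j) @[j --> \oo] --> (0 : R).
  rewrite -[X in _ --> X](mulr0 (a N)); apply: cvgMl_tmp.
  by apply: cvg_expr; rewrite ger0_norm.
have e2 : 0 < e / 2 by rewrite divr_gt0.
move/cvgr_lt/(_ _ e2) => [k0 _ Hk]; exists (N + k0)%N => k Nk.
have kN : (N <= k)%N by exact: leq_trans (leq_addr _ _) Nk.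
rewrite -(subnKC kN) (le_lt_trans (aN _))// [ltRHS](splitr e) ltrD2r mulrC.
by apply: Hk; rewrite /= leq_subRL.
Qed.

Definition mx_tends0 m n (u : nat -> 'M[C]_(m, n)) := forall i j, forall e : R, 0 < e ->
  exists N, forall k, (N <= k)%N -> normc (u k i j) < e.

(** Let rs be the eigenvalues with multiplicity. By Cayley-Hamilton the
    product over all of rs of the factors A - z, times A^k, vanishes.
    Removing the last factor A - z turns the sequence a(k) into one with
    a(k+1) = z a(k) + (previous sequence), so smallness persists until no
    factor is left. *)
Lemma power_tends0 n (A : 'M[C]_n.+1) :
  (forall a, eigenvalue A a -> normc a < 1) -> mx_tends0 (fun k => A ^+ k).
Proof.
move=> Aev.
have [rs Ers] := closed_field_poly_normal (char_poly A).
rewrite (monicP (char_poly_monic A)) scale1r in Ers.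
have rs1 z : z \in rs -> normc z < 1.
  by move=> zrs; apply: Aev; rewrite eigenvalue_root_char Ers root_prod_XsubC.
have CH : horner_mx A (\prod_(z <- rs) ('X - z%:P)) = 0.
  by rewrite -Ers Cayley_Hamilton.
have : mx_tends0 (fun k => horner_mx A (\prod_(z <- rs) ('X - z%:P)) * A ^+ k).
  move=> i j e e0; exists 0%N => k _; rewrite CH mul0r mxE.
  by rewrite [normc _]normc0.
clear Ers CH; elim/last_ind: rs rs1 => [_|rs z IH rs1].
  by rewrite big_nil rmorph1; under eq_fun do rewrite mul1r.
move=> H; apply: IH => [y yrs|]; first by apply: rs1; rewrite mem_rcons inE yrs orbT.
have z1 : normc z < 1 by apply: rs1; rewrite mem_rcons inE eqxx.
set M := horner_mx A _.
move=> i j.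
apply: (@recurrence_small (fun k => normc ((M * A ^+ k) i j))
  (fun k => normc ((M * (A - z%:M) * A ^+ k) i j)) (normc z)).
- by rewrite z1 andbT; case: (z) => a b; exact: sqrtr_ge0.
- move=> k.
  have -> : (M * A ^+ k.+1) i j = z * (M * A ^+ k) i j + (M * (A - z%:M) * A ^+ k) i j.
    have -> : M * A ^+ k.+1 = z *: (M * A ^+ k) + M * (A - z%:M) * A ^+ k.
      rewrite mulrBr mulrBl -[M * A * _]mulrA -exprS -scalemx1 -scalerAr.
      by rewrite -[1%:M]/(1 : 'M[C]_n.+1) mulr1 -scalerAl addrC subrK.
    by rewrite mxE [X in X + _]mxE.
  by rewrite (le_trans (le_normcD _ _))// normcM.
- have := H i j; rewrite -cats1 big_cat big_seq1 /= rmorphM /= -/M rmorphB /=.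
  by rewrite horner_mx_X horner_mx_C.
Qed.

Lemma normc_real (a : R) : normc (real_complex R a) = `|a|.
Proof. by rewrite /normc /= expr0n /= addr0 sqrtr_sqr. Qed.

Lemma norm_complex (a : C) : `|a| = real_complex R (normc a).
Proof. by case: a. Qed.

Lemma small_power n (A : 'M[R]_n) :
  (forall a : C, eigenvalue (to_C A) a -> `|a| < 1) ->
  forall e : R, 0 < e -> exists2 k, (0 < k)%N & `|A ^+ k| < e.
Proof.
case: n A => [|n] A Aev e e0.
  exists 1%N => //; rewrite (le_lt_trans _ e0)//.
  by apply: mx_norm_ler => // -[].
have Aev' a : eigenvalue (to_C A) a -> normc a < 1.
  by move=> /Aev; rewrite norm_complex -[1]/(real_complex R 1) ltcR.
have H := power_tends0 Aev'.
have /choice[N HN] : forall ij : 'I_n.+1 * 'I_n.+1, exists N, forall k, (N <= k)%N ->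
    normc ((to_C A ^+ k) ij.1 ij.2) < e / 2.
  by move=> ij; apply: H; rewrite divr_gt0.
exists (\max_ij N ij).+1 => //.
rewrite (@le_lt_trans _ _ (e / 2))//; last by rewrite ltr_pdivrMr// ltr_pMr// ltr1n.
apply: mx_norm_ler => [|i j]; first by rewrite divr_ge0// ltW.
rewrite -normc_real ltW//.
have -> : real_complex R ((A ^+ (\max_ij N ij).+1) i j) =
    (to_C A ^+ (\max_ij N ij).+1) i j.
  by rewrite /to_C -rmorphXn /= mxE.
by apply: (HN (i, j)); rewrite ltnW// ltnS (leq_bigmax (i, j)).
Qed.

End Powers.

(** * Strongly invariant subspaces *)

Section InvariantSubspaces.

Lemma char_poly_trmx (F : comNzRingType) n (A : 'M[F]_n) : char_poly A^T = char_poly A.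
Proof. by rewrite /char_poly -det_tr /char_poly_mx raddfB /= tr_scalar_mx map_trmx trmxK. Qed.

Variable F : fieldType.

(** Completing a basis U of an invariant subspace to a basis P of the whole
    space makes the matrix block triangular. *)
Lemma invariant_block k m (A : 'M[F]_(k + m)) (U : 'M[F]_(k, k + m)) (B : 'M[F]_k) :
  row_free U -> U *m A = B *m U ->
  exists (P : 'M[F]_(k + m)) (E : 'M[F]_(m, k)) (D : 'M[F]_m),
    [/\ P \in unitmx, usubmx P = U & P *m A = block_mx B 0 E D *m P].
Proof.
move=> /eqP rU UA; pose E0 := row_ebase U; pose C0 := col_ebase U.
have EU : U = C0 *m usubmx E0.
  rewrite -[LHS](mulmx_ebase U) rU -mulmxA; congr (_ *m _).
  rewrite -[row_ebase U]vsubmxK pid_mx_row mul_row_col mul1mx mul0mx addr0.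
  by rewrite /E0 -[in RHS](vsubmxK (row_ebase U)) col_mxKu.
pose P := col_mx U (dsubmx E0).
have PE : P = block_mx C0 0 0 1%:M *m E0.
  by rewrite -[in RHS](vsubmxK E0) mul_block_col !mul0mx addr0 add0r mul1mx -EU.
have uP : P \in unitmx.
  rewrite PE unitmx_mul row_ebase_unit andbT unitmxE det_ublock det1 mulr1 -unitmxE.
  exact: col_ebase_unit.
pose Q := P *m A *m invmx P.
have UP : U *m invmx P = row_mx 1%:M 0.
  have -> : U = usubmx P by rewrite /P col_mxKu.
  by rewrite mul_usub_mx mulmxV// scalar_mx_block /block_mx col_mxKu.
have Qu : usubmx Q = row_mx B 0.
  rewrite /Q -!mul_usub_mx /P col_mxKu -/P UA -mulmxA UP.
  by rewrite mul_mx_row mulmx1 mulmx0.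
exists P, (dlsubmx Q), (drsubmx Q); split=> //; first by rewrite /P col_mxKu.
have -> : block_mx B 0 (dlsubmx Q) (drsubmx Q) = Q.
  by rewrite /block_mx -Qu /dlsubmx /drsubmx hsubmxK vsubmxK.
by rewrite /Q mulmxKV.
Qed.

Lemma char_poly_block k m (A P : 'M[F]_(k + m)) (B : 'M[F]_k) E (D : 'M[F]_m) :
  P \in unitmx -> P *m A = block_mx B 0 E D *m P ->
  char_poly A = char_poly B * char_poly D.
Proof.
move=> uP PA; pose Pp := map_mx polyC P.
have H : Pp *m char_poly_mx A = char_poly_mx (block_mx B 0 E D) *m Pp.
  rewrite /char_poly_mx mulmxBr mulmxBl /Pp -!map_mxM PA; congr (_ - _).
  by rewrite mul_mx_scalar mul_scalar_mx.
have Pn0 : \det Pp != 0.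
  by rewrite det_map_mx polyC_eq0 -unitfE -unitmxE.
rewrite /char_poly; apply: (mulfI Pn0); rewrite -det_mulmx H det_mulmx mulrC.
congr (_ * _); rewrite /char_poly_mx map_block_mx [in LHS]scalar_mx_block.
by rewrite opp_block_mx add_block_mx raddf0 oppr0 addr0 det_lblock.
Qed.

(** As a has the same multiplicity for B and for A, it is no eigenvalue of
    the quotient map D; hence D - a is injective and nothing outside U is
    sent into U by A - a. *)
Lemma invariant_absorb N k (A : 'M[F]_N) (U : 'M[F]_(k, N)) (B : 'M[F]_k) (a : F) :
  row_free U -> U *m A = B *m U -> eigenvalue B a ->
  mup a (char_poly B) = mup a (char_poly A) ->
  forall w : 'rV[F]_N, (w *m (A - a%:M) <= U)%MS -> (w <= U)%MS.
Proof.
move=> rU UA Ba mupE.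
have [m Em] : exists m, N = (k + m)%N.
  exists (N - k)%N; rewrite subnKC//; move: rU => /eqP <-; exact: rank_leq_col.
subst N => w wU.
have [P [E [D [uP PU PA]]]] := invariant_block rU UA.
have cA := char_poly_block uP PA.
have Da : ~~ eigenvalue D a.
  apply/negP; rewrite eigenvalue_root_char => Da; move: mupE; rewrite cA mupM ?monic_neq0 ?char_poly_monic//.
  have : (0 < mup a (char_poly D))%N.
    by rewrite mup_geq ?monic_neq0 ?char_poly_monic// expr1 dvdp_XsubCl.
  by move=> h /eqP; rewrite -[X in X == _]addn0 eqn_add2l eq_sym => /eqP h0; rewrite h0 in h.
pose y := w *m invmx P.
have wE : w = y *m P by rewrite /y mulmxKV.
have y0 : rsubmx y *m (D - a%:M) = 0.
  have /submxP[c Hc] := wU.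
  have : y *m (block_mx B 0 E D - a%:M) *m P = row_mx c 0 *m P.
    rewrite mulmxBr mulmxBl -mulmxA -PA mulmxA -wE.
    rewrite mul_mx_scalar -scalemxAl -wE -mul_mx_scalar -mulmxBr Hc.
    by rewrite -[P in RHS]vsubmxK mul_row_col mul0mx addr0 PU.
  move=> /(congr1 (mulmxr (invmx P))); rewrite /= !mulmxK// => h.
  move: (congr1 rsubmx h); rewrite row_mxKr -{1}[y]hsubmxK scalar_mx_block opp_block_mx add_block_mx.
  by rewrite mul_row_block row_mxKr !oppr0 !addr0 mulmx0 add0r.
have y2 : rsubmx y = 0.
  apply/eqP/negPn/negP => y2; move/negP: Da; apply; apply/eigenvalueP.
  exists (rsubmx y) => //; apply/eqP; rewrite -subr_eq0 -mul_mx_scalar -mulmxBr.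
  by rewrite y0.
rewrite wE -[y]hsubmxK y2 -[P]vsubmxK mul_row_col mul0mx addr0 PU.
exact: submxMl.
Qed.

End InvariantSubspaces.

Section RealInvariantSubspaces.
Variable R : realType.
Local Notation C := R[i].

Lemma to_C_mul m n p (A : 'M[R]_(m, n)) (B : 'M[R]_(n, p)) :
  map_mx (real_complex R) (A *m B) = map_mx (real_complex R) A *m map_mx (real_complex R) B.
Proof. exact: map_mxM. Qed.

(** The hypothesis on w says that (Pi - a1)(Pi - a2) w = 0 for the two
    complex eigenvalues a1, a2 = al +- i be; each factor is absorbed in
    turn. For be = 0 the same eigenvalue is absorbed twice, which covers the
    generalized eigenspace of +1. *)
Lemma strongly_invariant_span N k (Pi : 'M[R]_N) (RV : 'M[R]_(N, k)) (B : 'M[R]_k)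
    (al be : R) (w : 'cV[R]_N) :
  strongly_invariant Pi RV B ->
  eigenvalue (to_C B) (Complex al be) -> eigenvalue (to_C B) (Complex al (- be)) ->
  Pi *m (Pi *m w) = (2 * al) *: (Pi *m w) - (al ^+ 2 + be ^+ 2) *: w ->
  exists c : 'cV[R]_k, w = RV *m c.
Proof.
move=> [rV PiV _ mupV] ev1 ev2 Hw.
pose f := real_complex R.
suff : (w^T <= RV^T)%MS.
  by move=> /submxP[c /(congr1 trmx)]; rewrite trmxK trmx_mul trmxK => ->; exists c^T.
rewrite -(map_submx f).
pose U := map_mx f RV^T.
have rU : row_free U by rewrite /row_free mxrank_map.
have UA : U *m (to_C Pi)^T = (to_C B)^T *m U.
  rewrite /U /to_C !map_trmx -!map_mxM -!trmx_mul.
  by rewrite PiV.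
have absorb (a : C) : eigenvalue (to_C B) a -> forall v : 'rV[C]_N,
    (v *m ((to_C Pi)^T - a%:M) <= U)%MS -> (v <= U)%MS.
  move=> Ba; apply: (invariant_absorb rU UA).
    by rewrite eigenvalue_root_char char_poly_trmx -eigenvalue_root_char.
  by rewrite !char_poly_trmx; exact: mupV.
apply: (absorb _ ev1); apply: (absorb _ ev2).
set a1 := Complex al be; set a2 := Complex al (- be).
have a12 : a1 + a2 = f (2 * al).
  by apply/eqP; rewrite eq_complex /= subrr eqxx andbT mulrDl mul1r.
have a1a2 : a1 * a2 = f (al ^+ 2 + be ^+ 2).
  by apply/eqP; rewrite eq_complex /=; apply/andP; split; apply/eqP; ring.
set v := map_mx f w^T; set P := (to_C Pi)^T.
suff -> : v *m (P - a1%:M) *m (P - a2%:M) = 0 by exact: sub0mx.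
have vP : v *m P = map_mx f (Pi *m w)^T.
  by rewrite /v /P /to_C map_trmx -map_mxM -trmx_mul.
have vPP : v *m P *m P = map_mx f (Pi *m (Pi *m w))^T.
  by rewrite vP /P /to_C map_trmx -map_mxM -trmx_mul.
have -> : v *m (P - a1%:M) *m (P - a2%:M) =
    v *m P *m P - (a1 + a2) *: (v *m P) + (a1 * a2) *: v.
  rewrite [v *m _]mulmxBr mulmxBr mulmxBl !mul_mx_scalar -scalemxAl.
  move: (v *m P *m P) (v *m P) => x y; apply/rowP => i; rewrite !mxE; ring.
rewrite vPP vP Hw a12 a1a2 /v -!map_mxZ -raddfB -raddfD /=.
by apply/rowP => i; rewrite !mxE [_ - _ - _]addrAC subrr sub0r addNr.
Qed.

(** Real and imaginary parts of a complex eigenvector. *)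
Lemma real_eigenpair n (A : 'M[R]_n) (al be : R) :
  eigenvalue (to_C A) (Complex al be) ->
  exists r s : 'cV[R]_n, [/\ A *m r = al *: r - be *: s,
    A *m s = be *: r + al *: s & (r != 0) || (s != 0)].
Proof.
move=> ev; have : eigenvalue (to_C A)^T (Complex al be).
  by rewrite eigenvalue_root_char char_poly_trmx -eigenvalue_root_char.
move=> /eigenvalueP[v vA v0].
pose re (z : C) : R := let: Complex a _ := z in a.
pose im (z : C) : R := let: Complex _ b := z in b.
have reD x y : re (x + y) = re x + re y by case: x y => [? ?] [? ?].
have imD x y : im (x + y) = im x + im y by case: x y => [? ?] [? ?].
have re_sum (I : finType) (g : I -> C) : re (\sum_i g i) = \sum_i re (g i).
  by elim/big_rec2: _ => // i x y _ <-; rewrite reD.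
have im_sum (I : finType) (g : I -> C) : im (\sum_i g i) = \sum_i im (g i).
  by elim/big_rec2: _ => // i x y _ <-; rewrite imD.
have vA' i : \sum_j v 0 j * real_complex R (A i j) = Complex al be * v 0 i.
  move: (congr1 (fun M : 'rV_n => M 0 i) vA); rewrite !mxE => <-.
  by apply: eq_bigr => j _; rewrite !mxE.
exists (\col_i re (v 0 i)), (\col_i im (v 0 i)); split.
- apply/colP => i; rewrite !mxE; move: (congr1 re (vA' i)); rewrite re_sum.
  rewrite [RHS](_ : _ = al * re (v 0 i) - be * im (v 0 i)); last by case: (v 0 i).
  by move=> <-; apply: eq_bigr => j _; rewrite mxE; case: (v 0 j) => x y /=; ring.
- apply/colP => i; rewrite !mxE; move: (congr1 im (vA' i)); rewrite im_sum.
  rewrite [RHS](_ : _ = be * re (v 0 i) + al * im (v 0 i)); last first.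
    by case: (v 0 i) => x y /=; ring.
  by move=> <-; apply: eq_bigr => j _; rewrite mxE; case: (v 0 j) => x y /=; ring.
- rewrite -negb_and; apply: contra v0 => /andP[/eqP r0 /eqP s0]; apply/eqP/rowP => i.
  move/colP/(_ i): r0; move/colP/(_ i): s0; rewrite !mxE.
  by case: (v 0 i) => x y /= -> ->.
Qed.

Lemma real_eigenvector n (A : 'M[R]_n) (al : R) :
  eigenvalue (to_C A) (Complex al 0) -> exists2 v : 'cV[R]_n, v != 0 & A *m v = al *: v.
Proof.
move=> /real_eigenpair[r [s [Ar As /orP[r0|s0]]]].
  by exists r; rewrite // Ar scale0r subr0.
by exists s; rewrite // As scale0r add0r.
Qed.

(** Skew forms on the plane are multiples of the determinant. *)
Lemma skew2 (Z : 'M[R]_(1.*2)) (u v : 'cV[R]_(1.*2)) : Z^T = - Z ->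
  (u^T *m Z *m v) 0 0 = (u 0 0 * v 1 0 - u 1 0 * v 0 0) * Z 0 1.
Proof.
move=> ZT.
have Zij i j : Z j i = - Z i j by move/matrixP/(_ i j): ZT; rewrite !mxE.
have Z00 : Z 0 0 = 0 by have := Zij 0 0; lra.
have Z11 : Z 1 1 = 0 by have := Zij 1 1; lra.
rewrite mxE !big_ord_recl big_ord0 !mxE !big_ord_recl !big_ord0 !mxE.
have -> : lift ord0 ord0 = 1 :> 'I_(1.*2) by exact: val_inj.
have -> : ord0 = 0 :> 'I_(1.*2) by exact: val_inj.
by rewrite Z00 Z11 (Zij 0 1) !mulr0; ring.
Qed.

(** If G 0 1 = 0 then G = 0 and both sides vanish, since the inverse of 0 is
    0 for matrices and for scalars. *)
Lemma tr_invmx_skew2 (G H : 'M[R]_(1.*2)) : G^T = - G ->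
  \tr (invmx G *m H) = (H 0 1 - H 1 0) / G 0 1.
Proof.
move=> GT.
have Gij i j : G j i = - G i j by move/matrixP/(_ i j): GT; rewrite !mxE.
have G00 : G 0 0 = 0 by have := Gij 0 0; lra.
have G11 : G 1 1 = 0 by have := Gij 1 1; lra.
have o1 : lift ord0 ord0 = 1 :> 'I_(1.*2) by exact: val_inj.
have o0 : ord0 = 0 :> 'I_(1.*2) by exact: val_inj.
have all2 (i : 'I_(1.*2)) : i = 0 \/ i = 1.
  by case: i => [[|[|//]] ?]; [left|right]; exact: val_inj.
have [g0|g0] := eqVneq (G 0 1) 0.
  have -> : G = 0.
    by apply/matrixP => i j; rewrite mxE; case: (all2 i) (all2 j) => -> [->|->];
      rewrite ?G00 ?G11 // (Gij 0 1) g0 oppr0.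
  have i0 : invmx (0 : 'M[R]_(1.*2)) = 0.
    by rewrite invmx_out// inE /= unitmxE det0 unitr0.
  by rewrite i0 mul0mx mxtrace0 mxE invr0 mulr0.
pose G' : 'M[R]_(1.*2) := \matrix_(i, j) (if (i == 0) && (j == 1) then - (G 0 1)^-1
   else if (i == 1) && (j == 0) then (G 0 1)^-1 else 0).
have GG' : G *m G' = 1%:M.
  apply/matrixP => i j; rewrite !mxE !big_ord_recl big_ord0 o1 o0 !mxE.
  by case: (all2 i) (all2 j) => -> [->|->] /=; rewrite ?G00 ?G11 ?(Gij 0 1); field.
have -> : invmx G = G'.
  have uG : G \in unitmx by case: (mulmx1_unit GG').
  by rewrite -[LHS]mulmx1 -GG' mulKmx.
rewrite /mxtrace !big_ord_recl big_ord0 o1 o0 !mxE !big_ord_recl !big_ord0 o1 o0 !mxE /=.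
by field.
Qed.

End RealInvariantSubspaces.

(** * Regularity of the Hamiltonian and of the perturbation *)

Lemma open_eq_continuous (T W : topologicalType) (O : set T) (f g : T -> W) (p : T) :
  open O -> O p -> (forall q, O q -> f q = g q) -> g @ p --> g p -> f @ p --> f p.
Proof.
move=> oO Op fg gp; rewrite (fg p Op); apply: (cvg_trans _ gp); apply: near_eq_cvg.
have : \forall q \near p, O q by exact: (open_nbhs_nbhs (conj oO Op)).
by apply: filterS => q Oq; rewrite fg.
Qed.

Section Jacobian.
Variable R : realType.

Lemma derive_sum_delta N (W : normedModType R) (g : 'cV[R]_N -> W) (x v : 'cV[R]_N) :
  differentiable g x ->
  'D_v g x = \sum_j v j 0 *: 'D_(delta_mx j 0 : 'cV[R]_N) g x.
Proof.
move=> dg; rewrite deriveE//.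
have {1}-> : v = \sum_j v j 0 *: (delta_mx j 0 : 'cV[R]_N).
  by rewrite {1}[v]matrix_sum_delta; apply: eq_bigr => j _; rewrite big_ord1.
rewrite linear_sum; apply: eq_bigr => j _.
by rewrite linearZ /= deriveE.
Qed.

Lemma is_derive_jac N k (f : 'cV[R]_N -> 'cV[R]_k) (x : 'cV[R]_N) :
  (forall i, differentiable (fun y => f y i 0) x) ->
  forall v, is_derive x v f (jac f x *m v).
Proof.
move=> df v.
have Dfv u : is_derive x u f (\col_i 'D_u (fun y => f y i 0) x).
  apply/is_derive_mxP => i j; rewrite ord1 mxE.
  by apply: derivableP; exact: diff_derivable.
have -> : jac f x *m v = \col_i 'D_v (fun y => f y i 0) x; last exact: Dfv.
apply/colP => i; rewrite !mxE derive_sum_delta//; apply: eq_bigr => j _.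
rewrite mxE; have [_ ->] := Dfv (delta_mx j 0).
by rewrite mxE mulrC.
Qed.

Lemma is_derive_curve_jac N k (f : 'cV[R]_N -> 'cV[R]_k) (c : R -> 'cV[R]_N) (t : R) dc :
  (forall i, differentiable (fun y => f y i 0) (c t)) ->
  is_derive t (1 : R) c dc ->
  is_derive t (1 : R) (fun s => f (c s)) (jac f (c t) *m dc).
Proof.
move=> df Dc; apply/is_derive_mxP => i j; rewrite ord1.
have := is_derive_jac df dc => /is_derive_mxP/(_ i 0) [_ <-].
exact: (is_derive_curve (f := fun y => f y i 0)) (df i) Dc.
Qed.

End Jacobian.

Section Regularity.
Variables (R : realType) (n : nat) (sys : mech_system R n) (r0 : nat).
Hypothesis hr0 : (3 <= r0)%N.
Hypothesis hsys : standing_assumptions sys r0.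
Local Notation N := (n + n)%N.
Local Notation V := 'cV[R]_(n + n).
Local Notation U := (dom sys).
Local Notation H := (ham sys).
Local Notation J := (sympJ R n).
Local Notation e_ i := (delta_mx i 0 : V).

Definition hess (x : V) : 'M[R]_(n + n) := \matrix_(i, j) 'D_(e_ j) ('D_(e_ i) H) x.

Lemma dom_open : open U. Proof. by case: hsys. Qed.

Let CkH : Ck 4 U H.
Proof.
have Ckw (f : V -> R) k : Ck k.+1 U f -> Ck k U f.
  elim: k f => [|k IH] f [d1 d2]; last by split=> // v; exact: IH.
  by move=> x Ux; exact: differentiable_continuous (d1 x Ux).
have [_ _ h _ _] := hsys; case: r0 hr0 h => [|[|[|r]]]// _.
by elim: r => [//|r IH] h; apply: IH; exact: Ckw.
Qed.

Lemma ham_differentiable x : U x -> differentiable H x.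
Proof. by case: CkH => h _; exact: h. Qed.

Lemma dham_differentiable x v : U x -> differentiable ('D_v H) x.
Proof. by case: CkH => _ /(_ v)[h _]; exact: h. Qed.

Lemma d2ham_differentiable x v u : U x -> differentiable ('D_u ('D_v H)) x.
Proof. by case: CkH => _ /(_ v)[_ /(_ u)[h _]]; exact: h. Qed.

Lemma d3ham_continuous x v u w : U x -> {for x, continuous ('D_w ('D_u ('D_v H)))}.
Proof.
case: CkH => _ /(_ v)[_ /(_ u)[_ /(_ w)[h _]]] Ux.
exact: differentiable_continuous (h x Ux).
Qed.

Let grad_comp i : (fun y => grad H y i 0) = 'D_(e_ i) H.
Proof. by apply/funext => y; rewrite mxE. Qed.

Lemma grad_differentiable x i : U x -> differentiable (fun y => grad H y i 0) x.
Proof. by move=> Ux; rewrite grad_comp; exact: dham_differentiable. Qed.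

Lemma jac_grad x : U x -> jac (grad H) x = hess x.
Proof.
move=> Ux; apply/matrixP => i j; rewrite !mxE.
have D : derivable (grad H) x (e_ j).
  by have [] := is_derive_jac (fun i => grad_differentiable i Ux) (e_ j).
by rewrite derive_mx// mxE grad_comp.
Qed.

Lemma is_derive_grad x v : U x -> is_derive x v (grad H) (hess x *m v).
Proof.
move=> Ux; rewrite -jac_grad//.
by apply: is_derive_jac => i; exact: grad_differentiable.
Qed.

(** The symmetry that makes J D^2H infinitesimally symplectic. *)
Lemma hess_sym x : U x -> (hess x)^T = hess x.
Proof.
move=> Ux; have C2 : Ck 2 U H.
  split=> [y Uy|v]; first exact: ham_differentiable.
  split=> [y Uy|u y Uy]; first exact: dham_differentiable.
  exact: differentiable_continuous (d2ham_differentiable v u Uy).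
apply/matrixP => i j; rewrite [LHS]mxE /hess !mxE.
exact: (schwarz (e_ i) (e_ j) dom_open C2 Ux).
Qed.

Lemma hess_continuous x : U x -> {for x, continuous hess}.
Proof.
move=> Ux; apply: (cvg_mxP (F := nbhs x) hess (hess x)).2 => i j.
have E : (fun y => hess y i j) = 'D_(e_ j) ('D_(e_ i) H).
  by apply/funext => y; rewrite mxE.
have c := differentiable_continuous (d2ham_differentiable (e_ i) (e_ j) Ux).
change {for x, continuous (fun y => hess y i j)}.
by rewrite E; exact: c.
Qed.

Lemma grad_continuous x : U x -> {for x, continuous (grad H)}.
Proof.
move=> Ux; apply: (cvg_mxP (F := nbhs x) (grad H) (grad H x)).2 => i j.
have c := differentiable_continuous (dham_differentiable (e_ i) Ux).
change {for x, continuous (fun y => grad H y i j)}.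
by rewrite ord1 grad_comp; exact: c.
Qed.

Lemma grad_lipschitz (K : set V) : compact K -> K `<=` U ->
  exists rho L : R, [/\ 0 < rho, 0 < L & forall k w, K k -> `|w - k| < rho ->
    [/\ U w, `|grad H w - grad H k| <= L * `|w - k| &
        `|hess w - hess k| <= L * `|w - k|]].
Proof.
move=> cK KU.
pose K' : set (V * R)%type := (fun x : V => (x, 0 : R)) @` K.
pose O' : set (V * R)%type := [set p | U p.1].
have cK' : compact K'.
  apply: continuous_compact cK; apply: continuous_subspaceT => x.
  exact: (cvg_pair (@cvg_id _ (nbhs x)) (@cvg_cst _ (0 : R) _ (nbhs x) _)).
have oO' : open O'.
  by move: dom_open; apply: open_comp => p _; exact: cvg_fst.
have K'O' : K' `<=` O' by move=> _ [x Kx <-]; exact: KU.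
have at0 (w k : V) (rho : R) : 0 < rho -> `|w - k| < rho -> `|(0 : R) - 0| < rho.
  by move=> r0' _; rewrite subrr normr0.
pose F1 (w : V) (_ : R) := grad H w.
have D1 p : O' p -> forall v, is_derive p.1 v (F1 ^~ p.2) (hess p.1 *m v).
  by move=> Op v; exact: is_derive_grad.
have c1 p : K' p -> {for p, continuous (fun p : V * R => hess p.1)}.
  move=> Kp; apply: (cvg_comp fst hess cvg_fst).
  exact: (hess_continuous (K'O' p Kp)).
have [rho1 [L1 [rho10 L10 H1]]] := lipschitz_tube oO' D1 cK' K'O' c1.
pose F2 (w : V) (_ : R) : 'cV[R]_(N * N) := (mxvec (hess w))^T.
pose DF2 (p : V * R) : 'M[R]_(N * N, N) := jac (F2 ^~ p.2) p.1.
have F2c k : exists i j, forall r, (fun w => F2 w r k 0) = 'D_(e_ j) ('D_(e_ i) H).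
  case/mxvec_indexP: k => i j; exists i, j => r; apply/funext => w.
  by rewrite /F2 mxE mxvecE mxE.
have D2 p : O' p -> forall v, is_derive p.1 v (F2 ^~ p.2) (DF2 p *m v).
  move=> Op v; apply: is_derive_jac => k; have [i [j Eij]] := F2c k.
  by rewrite Eij; exact: d2ham_differentiable.
have DF2E q k a i j : (forall r, (fun w => F2 w r k 0) = 'D_(e_ j) ('D_(e_ i) H)) ->
    O' q -> DF2 q k a = 'D_(e_ a) ('D_(e_ j) ('D_(e_ i) H)) q.1.
  move=> Eij Oq; have [D _] := D2 q Oq (e_ a).
  have e1 := derive_mx D.
  by rewrite /DF2 mxE e1 mxE Eij.
have c2 p : K' p -> {for p, continuous DF2}.
  move=> Kp; apply: (cvg_mxP (F := nbhs p) DF2 (DF2 p)).2 => k a.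
  have [i [j Eij]] := F2c k.
  pose g : V -> R := 'D_(e_ a) ('D_(e_ j) ('D_(e_ i) H)).
  have EO q : O' q -> DF2 q k a = (g \o fst) q by exact: DF2E.
  have Op : O' p := K'O' p Kp.
  have c3 : g @ p.1 --> g p.1.
    exact: (d3ham_continuous (v := e_ i) (u := e_ j) (w := e_ a) Op).
  have c4 : (g \o fst) @ p --> (g \o fst) p by exact: (cvg_comp fst g cvg_fst c3).
  exact: (open_eq_continuous oO' Op EO c4).
have [rho2 [L2 [rho20 L20 H2]]] := lipschitz_tube oO' D2 cK' K'O' c2.
exists (Num.min rho1 rho2), (L1 + L2); split; rewrite ?lt_min ?rho10 ?addr_gt0//.
move=> k w Kk; rewrite lt_min => /andP[w1 w2].
have Kk' : K' (k, 0) by exists k.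
have k1 : `|k - k| < rho1 by rewrite subrr normr0.
have k2 : `|k - k| < rho2 by rewrite subrr normr0.
have [Uw h1] := H1 _ w k 0 Kk' w1 k1 (at0 w k _ rho10 w1).
have [_ h2] := H2 _ w k 0 Kk' w2 k2 (at0 w k _ rho20 w2).
split=> //; first by rewrite (le_trans h1)// ler_wpM2r// lerDl ltW.
apply: mx_norm_ler => [|i j]; first by rewrite mulr_ge0// ltW// addr_gt0.
apply: (@le_trans _ _ (L2 * `|w - k|)); last by rewrite ler_wpM2r// lerDr ltW.
apply: (le_trans _ h2).
have -> : (hess w - hess k) i j = (F2 w 0 - F2 k 0) (mxvec_index i j) 0.
  by rewrite /F2; move: (hess w) (hess k) => A B; rewrite !mxE !mxvecE.
exact: ler_mx_norm.
Qed.

End Regularity.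

Section PerturbationRegularity.
Variables (R : realType) (n : nat) (sys : mech_system R n) (r0 : nat).
Hypothesis hr0 : (3 <= r0)%N.
Hypothesis hsys : standing_assumptions sys r0.
Local Notation N := (n + n)%N.
Local Notation V := 'cV[R]_(n + n).
Local Notation E4 := ('cV[R]_(n + n) * R * R * R)%type.
Local Notation U := (dom sys).
Local Notation e_ i := (delta_mx i 0 : V).

(** Smoothness of the perturbation at e = 0 is that of an extension f across
    this boundary. Along e >= 0 the perturbation and its x-derivative
    coincide with f and with a matrix fX made of partial derivatives of f,
    and both are jointly continuous in (x, t, delta, e); all later estimates
    are made with f and fX. *)
Lemma pert_extension : exists (f : E4 -> V) (fX : E4 -> 'M[R]_(n + n)),
  [/\ (forall x t d e, U x -> 0 < d -> 0 <= e ->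
        pert sys x t d e = f (x, t, d, e) /\ dpert sys x t d e = fX (x, t, d, e)),
      (forall x t d e, U x -> 0 < d -> 0 <= e -> {for (x, t, d, e), continuous f}),
      (forall x t d e, U x -> 0 < d -> 0 <= e -> {for (x, t, d, e), continuous fX}),
      (forall x t d e, U x -> 0 < d -> 0 <= e -> forall v,
        is_derive x v (fun y => pert sys y t d e) (fX (x, t, d, e) *m v)) &
      (forall (c : R -> V) (s : R) dc t d e, U (c s) -> 0 < d -> 0 <= e ->
        is_derive s (1 : R) c dc ->
        is_derive s (1 : R) (fun r => pert sys (c r) t d e) (fX (c s, t, d, e) *m dc))].
Proof.
have [oU _ _ [Of [f [oO domO fE Cf Cf2]]] _] := hsys.
have [k Ek] : exists k, r0.-1 = k.+1 by case: r0 hr0 => [|[|[|r]]]// _; exists r.+1.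
rewrite Ek in Cf Cf2.
have inO x t d e : U x -> 0 < d -> 0 <= e -> Of (x, t, d, e).
  by move=> Ux d0 e0; apply: domO; split.
have fdiff w : Of w -> differentiable f w by move=> Ow; exact: (Cf.1 w Ow).
pose emb (v : V) : E4 := (v, 0, 0, 0).
have Dcont v w : Of w -> {for w, continuous (fun w' => 'D_(emb v) f w')}.
  move=> Ow; have [h _] := Cf2 (emb v) erefl.
  exact: differentiable_continuous (h w Ow).
pose gf t d e (y : V) := f (y, t, d, e).
have gfD x t d e v : 'D_v (gf t d e) x = 'D_(emb v) f (x, t, d, e).
  rewrite /derive; set g1 := fun h => h^-1 *: _; set g2 := fun h => h^-1 *: _.
  suff -> : g1 = g2 by [].
  rewrite funeqE /g1 /g2 => h /=; congr (_ *: (_ - _)).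
  rewrite /gf /emb.
  have -> : h *: ((v, 0, 0, 0) : E4) + (x, t, d, e) =
    (h *: v + x, h * 0 + t, h * 0 + d, h * 0 + e) by [].
  by rewrite mulr0 !add0r.
have gfdiff x t d e i : Of (x, t, d, e) -> differentiable (fun y => gf t d e y i 0) x.
  move=> Ow.
  have d1 : differentiable (fun y : V => (y, t, d, e) : E4) x.
    apply: differentiable_pair; last exact: differentiable_cst.
    apply: differentiable_pair; last exact: differentiable_cst.
    apply: differentiable_pair; last exact: differentiable_cst.
    by [].
  have d2 : differentiable (gf t d e) x.
    exact: (differentiable_comp d1 (fdiff _ Ow)).
  exact: (differentiable_comp d2 (differentiable_coord _ _ _)).
pose fX (w : E4) : 'M[R]_(n + n) := \matrix_(i, j) ('D_(emb (e_ j)) f w) i 0.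
have gfjac x t d e : Of (x, t, d, e) -> jac (gf t d e) x = fX (x, t, d, e).
  by move=> Ow; apply/matrixP => i j; rewrite !mxE gfD.
have pgf x t d e : U x -> 0 < d -> 0 <= e -> gf t d e x = pert sys x t d e.
  by move=> Ux d0 e0; rewrite /gf fE//; split.
have near_pgf x t d e : U x -> 0 < d -> 0 <= e ->
    \near x, gf t d e x = pert sys x t d e.
  move=> Ux d0 e0; have : \forall y \near x, U y.
    exact: (open_nbhs_nbhs (conj oU Ux)).
  by apply: filterS => y Uy; exact: pgf.
have Dpert x t d e : U x -> 0 < d -> 0 <= e -> forall v,
    is_derive x v (fun y => pert sys y t d e) (fX (x, t, d, e) *m v).
  move=> Ux d0 e0 v; have Ow := inO x t d e Ux d0 e0.
  apply: (near_eq_is_derive (near_pgf x t d e Ux d0 e0)).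
  rewrite -gfjac//; apply: is_derive_jac => i; exact: gfdiff.
exists f, fX; split.
- move=> x t d e Ux d0 e0; split; first by rewrite -pgf.
  apply/matrixP => i j; rewrite mxE.
  have [_ ->] := Dpert x t d e Ux d0 e0 (e_ j).
  by rewrite -colE mxE.
- move=> x t d e Ux d0 e0; exact: differentiable_continuous (fdiff _ (inO x t d e Ux d0 e0)).
- move=> x t d e Ux d0 e0; set w := (x, t, d, e).
  have Ow : Of w by exact: inO.
  apply: (cvg_mxP (F := nbhs w) fX (fX w)).2 => i j.
  have c := Dcont (e_ j) w Ow.
  have E : (fun w' => fX w' i j) = (fun w' => ('D_(emb (e_ j)) f w') i 0).
    by apply/funext => w'; rewrite mxE.
  change {for w, continuous (fun w' => fX w' i j)}; rewrite E.
  exact: ((cvg_mxP (F := nbhs w) _ _).1 c i 0).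
- exact: Dpert.
- move=> c s dc t d e Uc d0 e0 Dc; have Ow := inO (c s) t d e Uc d0 e0.
  have near_c : \near s, gf t d e (c s) = pert sys (c s) t d e.
    have cc : c @ s --> c s := is_derive_continuous Dc.
    exact: (cc _ (near_pgf (c s) t d e Uc d0 e0)).
  apply: (near_eq_is_derive near_c).
  rewrite -gfjac//; apply: is_derive_curve_jac => // i; exact: gfdiff.
Qed.

End PerturbationRegularity.

(** * Conservation laws of the variational equation and their drift *)

Lemma is_derive_small (R : realType) (W : normedModType R) (g : R -> W) (t : R) dg (eta : R) :
  0 < eta -> is_derive t (1 : R) g dg -> exists2 rho : R, 0 < rho &
  forall s, `|s - t| < rho -> `|g s - g t - (s - t) *: dg| <= eta * `|s - t|.
Proof.
move=> eta0 [gd <-].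
have /cvgrPdist_lt/(_ eta eta0) [rho /= rho0 H] : h^-1 *: (g (h *: 1 + t) - g t) @[h --> 0^'] --> 'D_1 g t.
  exact: gd.
exists rho => // s st; have [->|sn] := eqVneq s t.
  by rewrite !subrr scale0r subrr !normr0 mulr0.
have s0 : s - t != 0 by rewrite subr_eq0.
have st' : ball_ Num.norm 0 rho (s - t) by rewrite /ball_ /= sub0r normrN.
have := H _ st' s0; rewrite [_ *: 1]mulr1 subrK.
move: ('D_1 g t) => D h; rewrite -[g s - g t](scale1r) -(divff s0) -scalerA -scalerBr normrZ mulrC.
by rewrite ler_wpM2r// distrC ltW.
Qed.

Section SymplecticIdentities.
Variables (R : realType) (n : nat) (sys : mech_system R n) (r0 : nat).
Hypothesis hr0 : (3 <= r0)%N.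
Hypothesis hsys : standing_assumptions sys r0.
Local Notation V := 'cV[R]_(n + n).
Local Notation U := (dom sys).
Local Notation G := (grad (ham sys)).
Local Notation J := (sympJ R n).

Lemma sympJ_tr : J^T = - J.
Proof.
rewrite /sympJ tr_block_mx opp_block_mx !trmx0 trmx1 linearN /= trmx1.
by rewrite !oppr0 opprK.
Qed.

Lemma sympJ_sqr : J *m J = - 1%:M.
Proof.
rewrite /sympJ mulmx_block !mul0mx !mulmx0 !mul1mx !mulmx1 !add0r !addr0.
by rewrite scalar_mx_block opp_block_mx !oppr0.
Qed.

Lemma sympJ_trJ : J^T *m J = 1%:M.
Proof. by rewrite sympJ_tr mulNmx sympJ_sqr opprK. Qed.

(** In (X^T J X)' the Hamiltonian part J D^2H cancels, since D^2H is
    symmetric and J^2 = -1; only the perturbation is left. *)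
Lemma sympl_identity (d e : R) (x : R -> V) X (t : R) : U (x t) ->
  variational sys d e x X ->
  is_derive t (1 : R) (fun s => (X s)^T *m J *m X s)
    (e *: ((X t)^T *m ((dpert sys (x t) t d e)^T *m J + J *m dpert sys (x t) t d e) *m X t)).
Proof.
move=> Ux [_ /(_ t) DX].
apply: is_derive_eq.
  exact: is_derive_mulmx (is_derive_mulmxr J (is_derive_trmx DX)) DX.
rewrite (jac_grad hr0 hsys Ux).
have S := hess_sym hr0 hsys Ux.
move: (hess sys (x t)) S (dpert sys (x t) t d e) (X t) => S ST D Y.
rewrite trmx_mul -!mulmxA -mulmxDr scalemxAr; congr (_ *m _).
rewrite !mulmxA -mulmxDl scalemxAl; congr (_ *m _).
rewrite linearD /= linearZ /= trmx_mul ST mulmxDl mulmxDr mulmxA sympJ_sqr.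
rewrite -!mulmxA sympJ_trJ mulmx1 mulNmx mul1mx.
by rewrite addrACA addrC addrN addr0 -scalemxAl -scalemxAr -scalerDr.
Qed.

(** The terms DH^T J D^2H X coming from the two factors cancel: for e = 0
    the differential of the energy is carried along by the variational flow. *)
Lemma energy_identity (d e : R) (x : R -> V) X (t : R) : U (x t) ->
  is_derive t (1 : R) x (field sys d e (x t) t) ->
  variational sys d e x X ->
  is_derive t (1 : R) (fun s => (G (x s))^T *m X s)
    (e *: (((pert sys (x t) t d e)^T *m hess sys (x t) +
            (G (x t))^T *m dpert sys (x t) t d e) *m X t)).
Proof.
move=> Ux Dx [_ /(_ t) DX].
have DG := is_derive_curve_jac (fun i => grad_differentiable hr0 hsys i Ux) Dx.
apply: is_derive_eq; first exact: is_derive_mulmx (is_derive_trmx DG) DX.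
rewrite (jac_grad hr0 hsys Ux) /field /ham_field.
have S := hess_sym hr0 hsys Ux.
move: (hess sys (x t)) S (dpert sys (x t) t d e) (X t) (pert sys (x t) t d e) (G (x t)).
move=> S ST D Y g h.
rewrite mulmxA -mulmxDl scalemxAl; congr (_ *m _).
have -> : (S *m (J *m h + e *: g))^T = - (h^T *m J *m S) + e *: (g^T *m S).
  rewrite trmx_mul ST linearD /= linearZ /= trmx_mul sympJ_tr mulmxDl.
  by rewrite mulmxN mulNmx scalemxAl.
have -> : h^T *m (J *m S + e *: D) = h^T *m J *m S + e *: (h^T *m D).
  by rewrite mulmxDr mulmxA scalemxAr.
by rewrite addrACA addNr add0r -scalerDr.
Qed.

Lemma unperturbed_symplectic (d : R) (x : R -> V) X (t : R) :
  (forall s, U (x s)) -> variational sys d 0 x X -> 0 <= t -> (X t)^T *m J *m X t = J.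
Proof.
move=> Ux HX t0; have [X1 _] := HX.
have D s : 0 <= s <= t -> is_derive s (1 : R) (fun s => (X s)^T *m J *m X s) 0.
  by move=> _; have := sympl_identity (Ux s) HX; rewrite scale0r.
have D0 s : 0 <= s <= t -> is_derive s (1 : R) (fun _ : R => (0 : 'M[R]_(n + n))) 0.
  by move=> _; exact: is_derive_cst.
have := derive_eq_increment t0 D D0.
by rewrite X1 trmx1 mul1mx mulmx1 subrr => /eqP; rewrite subr_eq0 => /eqP.
Qed.

Lemma unperturbed_energy (d : R) (x : R -> V) X (t : R) :
  conservative_orbit sys x -> variational sys d 0 x X -> 0 <= t ->
  (G (x t))^T *m X t = (G (x 0))^T.
Proof.
move=> Hx HX t0; have [X1 _] := HX.
have D s : 0 <= s <= t -> is_derive s (1 : R) (fun s => (G (x s))^T *m X s) 0.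
  move=> _; have [Ux Dx] := Hx s I.
  have Dx' : is_derive s (1 : R) x (field sys d 0 (x s) s).
    by rewrite /field scale0r addr0.
  by have := energy_identity Ux Dx' HX; rewrite scale0r.
have D0 s : 0 <= s <= t -> is_derive s (1 : R) (fun _ : R => (0 : 'rV[R]_(n + n))) 0.
  by move=> _; exact: is_derive_cst.
have := derive_eq_increment t0 D D0.
by rewrite X1 mulmx1 subrr => /eqP; rewrite subr_eq0 => /eqP.
Qed.

(** The velocity of an orbit solves the variational equation. Here this is
    read off from the two conservation laws. *)
Lemma orbit_velocity (d : R) (x : R -> V) X (t : R) :
  conservative_orbit sys x -> variational sys d 0 x X -> 0 <= t ->
  X t *m ham_field sys (x 0) = ham_field sys (x t).
Proof.
move=> Hx HX t0.
have S := unperturbed_symplectic (fun s => (Hx s I).1) HX t0.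
have E := unperturbed_energy Hx HX t0.
(* J X^T J is minus the inverse of X *)
have XJX : X t *m (J *m (X t)^T *m J) = - 1%:M.
  have h : (J *m (X t)^T *m J) *m X t = - 1%:M.
    by rewrite -!mulmxA [(X t)^T *m _]mulmxA S sympJ_sqr.
  have h2 : (- (J *m (X t)^T *m J)) *m X t = 1%:M by rewrite mulNmx h opprK.
  by move: (mulmx1C h2); rewrite mulmxN => /(congr1 -%R); rewrite opprK.
have E2 : G (x 0) = (X t)^T *m G (x t).
  by rewrite -[LHS]trmxK -E trmx_mul trmxK.
rewrite /ham_field E2.
have -> : X t *m (J *m ((X t)^T *m G (x t))) = X t *m (J *m (X t)^T *m J) *m (- J *m G (x t)).
  rewrite -!mulmxA; congr (_ *m (_ *m (_ *m _))).
  by rewrite mulNmx mulmxN mulmxA sympJ_sqr mulNmx mul1mx opprK.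
by rewrite XJX !mulNmx mulmxN mul1mx opprK.
Qed.

End SymplecticIdentities.

(** * Averaging along the perturbed orbit *)

Section Closeness.
Variables (R : realType) (n : nat) (sys : mech_system R n) (r0 : nat).
Hypothesis hr0 : (3 <= r0)%N.
Hypothesis hsys : standing_assumptions sys r0.
Local Notation N := (n + n)%N.
Local Notation V := 'cV[R]_(n + n).
Local Notation E4 := ('cV[R]_(n + n) * R * R * R)%type.
Local Notation U := (dom sys).
Local Notation G := (grad (ham sys)).
Local Notation J := (sympJ R n).
Variables (f : E4 -> V) (fX : E4 -> 'M[R]_(n + n)).
Hypothesis pE : forall x t d e, U x -> 0 < d -> 0 <= e ->
  pert sys x t d e = f (x, t, d, e) /\ dpert sys x t d e = fX (x, t, d, e).
Hypothesis cf : forall x t d e, U x -> 0 < d -> 0 <= e -> {for (x, t, d, e), continuous f}.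
Hypothesis cfX : forall x t d e, U x -> 0 < d -> 0 <= e -> {for (x, t, d, e), continuous fX}.

Variables (x0 : R -> V) (X0 : R -> 'M[R]_(n + n)) (d0 dd T1 S : R).
Hypothesis hx0 : conservative_orbit sys x0.
Hypothesis hX0 : variational sys dd 0 x0 X0.
Hypothesis d0_gt0 : 0 < d0.
Hypothesis ST1 : 0 < S < T1.

Variables (x : R -> R -> V) (X : R -> R -> 'M[R]_(n + n)) (delta Te : R -> R).
Hypothesis hx : \forall e \near 0^'+, perturbed_orbit sys (delta e) e (x e).
Hypothesis hX : \forall e \near 0^'+, variational sys (delta e) e (x e) (X e).
Hypothesis hxO : exists K : R, \forall e \near 0^'+, `|x e 0 - x0 0| <= K * e.
Hypothesis hdO : exists K : R, \forall e \near 0^'+, `|delta e - d0| <= K * e.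
Hypothesis hTO : exists K : R, \forall e \near 0^'+, `|Te e - S| <= K * e.

Definition conservative_args (t : R) : E4 := (x0 t, t, d0, 0).
Definition perturbed_args (e t : R) : E4 := (x e t, t, delta e, e).

Let cx0 : continuous x0.
Proof. by move=> t; have [_ D] := hx0 (t := t) I; exact: is_derive_continuous D. Qed.

Let cX0 : continuous X0.
Proof. by move=> t; have [_ D] := hX0; exact: is_derive_continuous (D t). Qed.

Let Ux0 t : U (x0 t). Proof. by have [] := hx0 (t := t) I. Qed.

Lemma conservative_args_continuous : continuous conservative_args.
Proof.
move=> t; rewrite /conservative_args.
have c1 : (fun s => (x0 s, s)) @ t --> (x0 t, t).
  have c0 : x0 @ t --> x0 t by exact: cx0.
  exact: (cvg_pair c0 (@cvg_id _ (nbhs t))).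
have c2 : (fun s => (x0 s, s, d0)) @ t --> (x0 t, t, d0).
  exact: (cvg_pair c1 (@cvg_cst _ d0 _ (nbhs t) _)).
exact: (cvg_pair c2 (@cvg_cst _ (0 : R) _ (nbhs t) _)).
Qed.

Lemma mul_small (K eta : R) : 0 < eta -> \forall e \near (0 : R)^'+, K * e < eta.
Proof.
move=> eta0; near=> e.
have e0 : 0 < e by near: e; exact: nbhs_right_gt.
have K1 : 0 < `|K| + 1 by rewrite ltr_wpDl.
rewrite (le_lt_trans (_ : _ <= (`|K| + 1) * e))//.
  by rewrite ler_wpM2r ?(ltW e0)// (le_trans (ler_norm _))// lerDl.
rewrite mulrC -ltr_pdivlMr//; near: e; apply: nbhs_right_lt; exact: divr_gt0.
Unshelve. all: by end_near. Qed.

Let K0 : set E4 := conservative_args @` `[0, T1].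
Let K1 : set V := x0 @` `[0, T1].

Let cK0 : compact K0.
Proof.
apply: continuous_compact; last exact: segment_compact.
by apply: continuous_subspaceT => t; exact: conservative_args_continuous.
Qed.

Let cK1 : compact K1.
Proof.
apply: continuous_compact; last exact: segment_compact.
by apply: continuous_subspaceT => t; exact: cx0.
Qed.

Let K1U : K1 `<=` U.
Proof. by move=> _ [t _ <-]; exact: Ux0. Qed.

Let cfK p : K0 p -> {for p, continuous f}.
Proof. by move=> [t _ <-]; exact: cf. Qed.

Let cfXK p : K0 p -> {for p, continuous fX}.
Proof. by move=> [t _ <-]; exact: cfX. Qed.

Let K0t (t : R) : 0 <= t <= T1 -> K0 (conservative_args t).
Proof. by move=> tT; exists t => //=; rewrite in_itv. Qed.

Let K1t (t : R) : 0 <= t <= T1 -> K1 (x0 t).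
Proof. by move=> tT; exists t => //=; rewrite in_itv. Qed.

Lemma we_dist (e t : R) : `|perturbed_args e t - conservative_args t| =
  Num.max (Num.max `|x e t - x0 t| `|delta e - d0|) `|e|.
Proof.
rewrite /perturbed_args /conservative_args !prod_normE /= subr0; congr (Num.max (Num.max _ _) _).
by rewrite subrr normr0; apply/max_idPl.
Qed.

Let JN := N%:R * `|J|.

(** Gronwall for x_e - x_0: the field is within O(e) of the Hamiltonian
    field, which is Lipschitz near the orbit. The time interval [0, T1]
    exceeds S, because l delta(e) may exceed m tau. *)
Lemma orbit_close : exists2 C : R, 0 < C & \forall e \near 0^'+,
  forall t : R, 0 <= t <= T1 -> `|x e t - x0 t| <= C * e.
Proof.
have [rho1 [L [rho10 L0 HL]]] := grad_lipschitz hr0 hsys cK1 K1U.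
have [M M0 HM] := compact_bounded_unif cK0 cfK.
have [rho2 rho20 H2] := compact_unif cK0 cfK ltr01.
have [Kx HKx] := hxO; have [Kd HKd] := hdO.
pose rho := Num.min rho1 rho2.
have rho_gt0 : 0 < rho by rewrite lt_min rho10.
pose L' := JN * L.
have JN0 : 0 <= JN by rewrite mulr_ge0.
have L'0 : 0 <= L' by rewrite mulr_ge0// ltW.
have T0 : 0 <= T1 by case/andP: ST1 => S0 S1; rewrite ltW// (lt_trans S0).
have c1 := gronwall_cst_ge1 N L'0 T0; set c := gronwall_cst N L' T1 in c1.
have c0 : 0 < c by exact: lt_le_trans c1.
pose C := c * (`|Kx| + (M + 1)).
have C0 : 0 < C by rewrite mulr_gt0// ltr_wpDl// addr_gt0.
exists C => //; near=> e.
have e_gt0 : 0 < e by near: e; exact: nbhs_right_gt.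
have e_ge0 := ltW e_gt0.
have Hx : perturbed_orbit sys (delta e) e (x e) by near: e; exact: hx.
have xi_le : `|x e 0 - x0 0| <= Kx * e by near: e; exact: HKx.
have de_le : `|delta e - d0| <= Kd * e by near: e; exact: HKd.
have de_rho : Kd * e < rho2 by near: e; exact: mul_small.
have de_pos : Kd * e < d0 by near: e; exact: mul_small.
have e_rho : e < rho2 by near: e; exact: nbhs_right_lt.
have C_rho : C * e < rho / 2 by near: e; apply: mul_small; rewrite divr_gt0.
have dpos : 0 < delta e.
  have : `|delta e - d0| < d0 by exact: le_lt_trans de_pos.
  by rewrite ltr_distlC => /andP[_ h]; move: h; rewrite ltrDr.
have Du (t : R) : 0 <= t <= T1 -> is_derive t (1 : R) (fun s => x e s - x0 s)
    (field sys (delta e) e (x e t) t - ham_field sys (x0 t)).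
  move=> tT; have [_ D1] := Hx t I; have [_ D2] := hx0 (t := t) I.
  exact: is_deriveB.
have init : c * (`|x e 0 - x0 0| + e * (M + 1)) <= C * e.
  rewrite /C -mulrA ler_wpM2l ?(ltW c0)// mulrDl [(M + 1) * e]mulrC lerD2r.
  by rewrite (le_trans xi_le)// ler_wpM2r// ler_norm.
move=> t tT; apply: (le_trans _ init).
apply: (gronwall (u := fun s => x e s - x0 s) (rho := rho / 2) L'0 _ Du _ _ tT).
- by rewrite mulr_ge0// addr_ge0// ltW.
- move=> s sT us.
  have us' : `|x e s - x0 s| < rho by rewrite (le_lt_trans us)// ltr_pdivrMr// ltr_pMr// ltr1n.
  have [us1 us2] : `|x e s - x0 s| < rho1 /\ `|x e s - x0 s| < rho2.
    by move: us'; rewrite lt_min => /andP[].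
  have [Ux hG _] := HL _ _ (K1t sT) us1.
  have [pe _] := pE s Ux dpos e_ge0.
  have -> : field sys (delta e) e (x e s) s - ham_field sys (x0 s) =
     J *m (G (x e s) - G (x0 s)) + e *: f (perturbed_args e s).
    by rewrite /field /ham_field pe mulmxBr addrAC.
  rewrite (le_trans (ler_normD _ _))// lerD//.
    rewrite (le_trans (ler_norm_mulmx _ _))// -/JN /L' -[JN * L * _]mulrA ler_wpM2l//.
  rewrite normrZ ger0_norm// ler_wpM2l// -(subrK (f (conservative_args s)) (f _)).
  rewrite (le_trans (ler_normD _ _))// addrC lerD ?(HM _ (K0t sT))//.
  apply/ltW/(H2 _ _ (K0t sT)); rewrite we_dist !gt_max us2 (le_lt_trans de_le)//=.
  by rewrite ger0_norm.
- by rewrite (le_lt_trans init)// (lt_le_trans C_rho).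
Unshelve. all: by end_near. Qed.

Lemma delta_pos : \forall e \near 0^'+, 0 < delta e.
Proof.
have [Kd HKd] := hdO; near=> e.
have de_le : `|delta e - d0| <= Kd * e by near: e; exact: HKd.
have de_pos : Kd * e < d0 by near: e; exact: mul_small.
have : `|delta e - d0| < d0 by exact: le_lt_trans de_pos.
by rewrite ltr_distlC => /andP[_ h]; move: h; rewrite ltrDr.
Unshelve. all: by end_near. Qed.

(** Gronwall column by column: the generators of the two variational
    equations differ by O(e). *)
Lemma fundamental_close : exists2 C : R, 0 < C & \forall e \near 0^'+,
  forall t : R, 0 <= t <= T1 -> `|X e t - X0 t| <= C * e.
Proof.
have [rho1 [L [rho10 L0 HL]]] := grad_lipschitz hr0 hsys cK1 K1U.
have [M M0 HM] := compact_bounded_unif cK0 cfXK.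
have [rho2 rho20 H2] := compact_unif cK0 cfXK ltr01.
have [Cx Cx0 HCx] := orbit_close.
have [Kd HKd] := hdO.
have [B B0 HB] : exists2 B : R, 0 < B & forall t : R, 0 <= t <= T1 -> `|X0 t| <= B.
  have cX0' k : `[0, T1]%classic k -> {for k, continuous X0} by move=> _; exact: cX0.
  have [B B0 HB] := compact_bounded_unif (@segment_compact R 0 T1) cX0'.
  by exists B => // t tT; apply: HB; rewrite /= in_itv.
have [Bh Bh0 HBh] : exists2 B : R, 0 < B & forall t : R, 0 <= t <= T1 -> `|hess sys (x0 t)| <= B.
  have ch k : K1 k -> {for k, continuous (hess sys)}.
    by move=> /K1U Uk; exact: (hess_continuous hr0 hsys Uk).
  have [B' B'0 HB'] := compact_bounded_unif cK1 ch.
  by exists B' => // t tT; apply: HB'; exact: K1t.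
pose N' : R := N%:R.
have N'0 : 0 <= N' by exact: ler0n.
have JN0 : 0 <= JN by rewrite mulr_ge0.
have M1 : 0 <= M + 1 by rewrite addr_ge0// ltW.
have Bh1 : 0 <= Bh + 1 by rewrite addr_ge0// ltW.
have LCx : 0 <= L * Cx by rewrite mulr_ge0 ?(ltW L0) ?(ltW Cx0).
have Bge0 := ltW B0.
pose L' := N' * (JN * (Bh + 1) + (M + 1)).
have L'0 : 0 <= L'.
  by rewrite mulr_ge0// addr_ge0// mulr_ge0.
have T0 : 0 <= T1 by case/andP: ST1 => S0 S1; rewrite ltW// (lt_trans S0).
have c1 := gronwall_cst_ge1 N L'0 T0; set c := gronwall_cst N L' T1 in c1.
have c0 : 0 < c by exact: lt_le_trans c1.
pose eta := N' * (JN * (L * Cx) + (M + 1)) * B.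
have eta0 : 0 <= eta.
  by rewrite mulr_ge0// mulr_ge0// addr_ge0// mulr_ge0.
exists (c * eta + 1); first by rewrite ltr_wpDl// mulr_ge0// ltW.
near=> e.
have e_gt0 : 0 < e by near: e; exact: nbhs_right_gt.
have e_ge0 := ltW e_gt0.
have e_lt1 : e < 1 by near: e; exact: nbhs_right_lt.
have HX : variational sys (delta e) e (x e) (X e) by near: e; exact: hX.
have dpos : 0 < delta e by near: e; exact: delta_pos.
have de_le : `|delta e - d0| <= Kd * e by near: e; exact: HKd.
have de_rho : Kd * e < rho2 by near: e; exact: mul_small.
have e_rho : e < rho2 by near: e; exact: nbhs_right_lt.
have xe_le : forall t : R, 0 <= t <= T1 -> `|x e t - x0 t| <= Cx * e by near: e; exact: HCx.
have Cx_rho1 : Cx * e < rho1 by near: e; exact: mul_small.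
have Cx_rho2 : Cx * e < rho2 by near: e; exact: mul_small.
have LCx1 : L * Cx * e < 1 by near: e; exact: mul_small.
pose A t := J *m hess sys (x e t) + e *: fX (perturbed_args e t).
pose A0 t := J *m hess sys (x0 t).
have facts (t : R) : 0 <= t <= T1 -> [/\ U (x e t),
    J *m jac G (x e t) + e *: dpert sys (x e t) t (delta e) e = A t,
    `|A t - A0 t| <= e * (JN * (L * Cx) + (M + 1)) & `|A t| <= JN * (Bh + 1) + (M + 1)].
  move=> tT; have xt := xe_le t tT.
  have [Ux _ hH] := HL _ _ (K1t tT) (le_lt_trans xt Cx_rho1).
  have fXb : `|fX (perturbed_args e t)| <= M + 1.
    rewrite -(subrK (fX (conservative_args t)) (fX _)).
    rewrite (le_trans (ler_normD _ _))// addrC lerD ?(HM _ (K0t tT))//.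
    apply/ltW/(H2 _ _ (K0t tT)); rewrite we_dist !gt_max (le_lt_trans xt)//=.
    by rewrite (le_lt_trans de_le)//= ger0_norm.
  have hH' : `|hess sys (x e t) - hess sys (x0 t)| <= L * Cx * e.
    by rewrite (le_trans hH)// -mulrA ler_wpM2l// ltW.
  have [_ de] := pE t Ux dpos e_ge0.
  split=> //; first by rewrite (jac_grad hr0 hsys Ux) de.
    rewrite /A /A0 addrAC -mulmxBr (le_trans (ler_normD _ _))// mulrDr lerD//.
      rewrite (le_trans (ler_norm_mulmx _ _))// -/JN mulrCA ler_wpM2l//.
      by rewrite (le_trans hH')// mulrC.
    by rewrite normrZ ger0_norm// ler_wpM2l.
  rewrite /A (le_trans (ler_normD _ _))// lerD//.
    rewrite (le_trans (ler_norm_mulmx _ _))// -/JN ler_wpM2l//.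
    rewrite -(subrK (hess sys (x0 t)) (hess sys (x e t))) (le_trans (ler_normD _ _))//.
    by rewrite addrC lerD// ?HBh// (le_trans hH')// ltW.
  by rewrite normrZ ger0_norm// (le_trans _ fXb)// ler_piMl// ltW.
have [X10 DX] := HX; have [X00 DX0] := hX0.
(* u is the j-th column of X e - X0; it solves a linear equation with a
   forcing term of size e. *)
have main : forall (j : 'I_N) (s : R), 0 <= s <= T1 ->
    `|(X e s - X0 s) *m (delta_mx j 0 : 'cV[R]_N)| <= c * (eta * e).
  move=> j s sT; set ej := delta_mx j 0.
  have ej1 : `|ej| <= 1.
    by apply: mx_norm_ler => // a b; rewrite mxE; case: (_ && _); rewrite ?normr1 ?normr0.
  pose u r := (X e r - X0 r) *m ej.
  have Du : forall s : R, 0 <= s <= T1 -> is_derive s (1 : R) u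
      (A s *m u s + (A s - A0 s) *m (X0 s *m ej)).
    move=> {sT}s sT; have [Ux EA _ _] := facts s sT.
    have EA0 : J *m jac G (x0 s) + 0 *: dpert sys (x0 s) s dd 0 = A0 s.
      by rewrite scale0r addr0 (jac_grad hr0 hsys (Ux0 s)).
    have D1 := DX s; rewrite EA in D1.
    have D2 := DX0 s; rewrite EA0 in D2.
    rewrite (_ : _ + _ = (A s *m X e s - A0 s *m X0 s) *m ej).
      exact: is_derive_mulmxr (is_deriveB D1 D2).
    by rewrite /u !mulmxA -mulmxDl mulmxBr mulmxBl addrA subrK.
  have u0 : u 0 = 0 by rewrite /u X10 X00 subrr mul0mx.
  have hg := @gronwall R N u _ T1 L' (eta * e) (c * (eta * e) + 1) L'0 (mulr_ge0 eta0 e_ge0) Du.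
  rewrite u0 normr0 add0r -/c in hg.
  apply: (fun h h' => hg h h' s sT); last by rewrite ltrDl.
  move=> {sT}s sT _; have [_ _ hA hA'] := facts s sT.
  rewrite (le_trans (ler_normD _ _))// lerD//.
    rewrite (le_trans (ler_norm_mulmx _ _))// ler_wpM2r//.
    by rewrite -/N' /L' ler_wpM2l.
  rewrite (le_trans (ler_norm_mulmx _ _))// -/N'.
  have hXs : `|X0 s *m ej| <= B.
    apply: mx_norm_ler => [|a b]; first exact: ltW.
    rewrite ord1 /ej -colE mxE (le_trans (ler_mx_norm _ _ _))// HB//.
  have -> : eta * e = N' * (e * (JN * (L * Cx) + (M + 1)) * B) by rewrite /eta; ring.
  by rewrite -mulrA ler_wpM2l// ler_pM.
move=> t tT; apply: mx_norm_ler => [|a b].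
  by rewrite mulr_ge0// addr_ge0// mulr_ge0// ltW.
have -> : (X e t - X0 t) a b = ((X e t - X0 t) *m (delta_mx b 0 : 'cV[R]_N)) a 0.
  by rewrite -colE !mxE.
rewrite (le_trans (ler_mx_norm _ _ _))// (le_trans (main b t tT))//.
by rewrite mulrA ler_wpM2r// lerDl.
Unshelve. all: by end_near. Qed.

Lemma time_in : \forall e \near 0^'+, 0 <= Te e <= T1.
Proof.
have [K HK] := hTO; case/andP: ST1 => S0 ST.
near=> e.
have h1 : `|Te e - S| <= K * e by near: e; exact: HK.
have h2 : K * e < S by near: e; exact: mul_small.
have h3 : K * e < T1 - S by near: e; apply: mul_small; rewrite subr_gt0.
move: h1; rewrite ler_distlC => /andP[h4 h5].
by apply/andP; split; lra.
Unshelve. all: by end_near. Qed.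

(** The end times l delta(e) and m tau differ by O(e) as well. *)
Lemma endpoint_close : exists C : R, \forall e \near 0^'+,
  `|X e (Te e) - X0 S| <= C * e.
Proof.
have [C C0 HC] := fundamental_close; have [K HK] := hTO; have [_ DX0] := hX0.
have [rho rho0 Hrho] := is_derive_small ltr01 (DX0 S).
set D := (_ *m X0 S) in Hrho.
exists (C + (`|D| + 1) * K); near=> e.
have e_gt0 : 0 < e by near: e; exact: nbhs_right_gt.
have TT : 0 <= Te e <= T1 by near: e; exact: time_in.
have HCe : forall t : R, 0 <= t <= T1 -> `|X e t - X0 t| <= C * e by near: e; exact: HC.
have TK : `|Te e - S| <= K * e by near: e; exact: HK.
have TK' : K * e < rho by near: e; exact: mul_small.
have h := Hrho _ (le_lt_trans TK TK').
rewrite -(subrKA (X0 (Te e))) (le_trans (ler_normD _ _))// mulrDl lerD ?HCe//.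
rewrite -(subrK ((Te e - S) *: D) (X0 (Te e) - X0 S)) (le_trans (ler_normD _ _))//.
rewrite (le_trans (lerD h (lexx _)))// normrZ mul1r -mulrA mulrDl mul1r addrC lerD//.
by rewrite mulrC ler_wpM2l.
Unshelve. all: by end_near. Qed.

(** A quantity Fe that drifts at rate e Phi changes by e times the integral
    of Phi along the conservative orbit, up to o(e): the arguments of Phi
    converge uniformly on [0, T1], and the end times differ by O(e). The
    integral enters as the value Lam S of an antiderivative. *)
Lemma averaging (p q : nat) (Phi : E4 * 'M[R]_(n + n) -> 'M[R]_(p, q))
    (Lam : R -> 'M[R]_(p, q)) (Fe : R -> R -> 'M[R]_(p, q)) :
  (forall t : R, {for (conservative_args t, X0 t), continuous Phi}) ->
  Lam 0 = 0 ->
  (forall t : R, is_derive t (1 : R) Lam (Phi (conservative_args t, X0 t))) ->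
  (\forall e \near 0^'+, forall t : R, 0 <= t <= T1 ->
     is_derive t (1 : R) (Fe e) (e *: Phi (perturbed_args e t, X e t))) ->
  forall eta : R, 0 < eta -> \forall e \near 0^'+,
    `|Fe e (Te e) - Fe e 0 - e *: Lam S| <= eta * e.
Proof.
move=> cPhi Lam0 DLam DFe eta eta0.
have T1_gt0 : 0 < T1 by case/andP: ST1 => S0 S1; rewrite (lt_trans S0).
pose Kp : set (E4 * 'M[R]_(n + n))%type := (fun t => (conservative_args t, X0 t)) @` `[0, T1].
have cKp : compact Kp.
  apply: continuous_compact; last exact: segment_compact.
  apply: continuous_subspaceT => t.
  have h1 : conservative_args @ t --> conservative_args t by exact: conservative_args_continuous.
  have h2 : X0 @ t --> X0 t by exact: cX0.
  exact: (cvg_pair h1 h2).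
have cPhiK k : Kp k -> {for k, continuous Phi} by move=> [t _ <-]; exact: cPhi.
have a0 : 0 < eta / (2 * T1) by rewrite divr_gt0// mulr_gt0.
have [rho rho0 Hrho] := compact_unif cKp cPhiK a0.
have [Cx Cx0 HCx] := orbit_close; have [CX CX0 HCX] := fundamental_close.
have [K HK] := hTO; have [Kd HKd] := hdO.
have [rhoS rhoS0 HS] := is_derive_small ltr01 (DLam S).
set D := Phi (conservative_args S, X0 S) in HS.
near=> e.
have e_gt0 : 0 < e by near: e; exact: nbhs_right_gt.
have e_ge0 := ltW e_gt0.
have TT : 0 <= Te e <= T1 by near: e; exact: time_in.
have xe_le : forall t : R, 0 <= t <= T1 -> `|x e t - x0 t| <= Cx * e by near: e; exact: HCx.
have Xe_le : forall t : R, 0 <= t <= T1 -> `|X e t - X0 t| <= CX * e by near: e; exact: HCX.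
have de_le : `|delta e - d0| <= Kd * e by near: e; exact: HKd.
have TK : `|Te e - S| <= K * e by near: e; exact: HK.
have DF : forall t : R, 0 <= t <= T1 -> is_derive t (1 : R) (Fe e) (e *: Phi (perturbed_args e t, X e t)).
  by near: e; exact: DFe.
have s1 : Cx * e < rho by near: e; exact: mul_small.
have s2 : CX * e < rho by near: e; exact: mul_small.
have s3 : Kd * e < rho by near: e; exact: mul_small.
have s4 : e < rho by near: e; exact: nbhs_right_lt.
have s5 : K * e < rhoS by near: e; exact: mul_small.
have s6 : (`|D| + 1) * K * e < eta / 2 by near: e; apply: mul_small; rewrite divr_gt0.
case/andP: (TT) => Te0 TeT.
have inT t : 0 <= t <= Te e -> 0 <= t <= T1.
  by move=> /andP[h1 h2]; rewrite h1 (le_trans h2).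
have key : `|(Fe e (Te e) - e *: Lam (Te e)) - (Fe e 0 - e *: Lam 0)| <=
    e * (eta / (2 * T1)) * (Te e - 0).
  apply: (norm_increment_le_cst (w := fun s => Fe e s - e *: Lam s)
    (dw := fun s => e *: Phi (perturbed_args e s, X e s) - e *: Phi (conservative_args s, X0 s)) Te0) => t tT.
    by apply: is_deriveB; [exact: DF (inT t tT)|exact: is_deriveZ (DLam t)].
  rewrite -scalerBr normrZ ger0_norm// ler_wpM2l//; apply/ltW/Hrho.
    by exists t => //=; rewrite in_itv /= inT.
  rewrite prod_normE /= gt_max we_dist !gt_max.
  rewrite (le_lt_trans (xe_le t (inT t tT)))// (le_lt_trans de_le)// ger0_norm// s4 /=.
  exact: le_lt_trans (Xe_le t (inT t tT)) s2.
have LS : `|Lam (Te e) - Lam S| <= eta / 2.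
  have h := HS _ (le_lt_trans TK s5).
  rewrite -(subrK ((Te e - S) *: D) (Lam (Te e) - Lam S)) (le_trans (ler_normD _ _))//.
  rewrite (le_trans (lerD h (lexx _)))// normrZ mul1r.
  rewrite (le_trans _ (ltW s6))// -mulrA mulrDl mul1r addrC lerD//.
  by rewrite mulrC ler_wpM2l.
rewrite (_ : _ - _ - _ = (Fe e (Te e) - e *: Lam (Te e)) - (Fe e 0 - e *: Lam 0) +
    e *: (Lam (Te e) - Lam S)); last first.
  rewrite Lam0 scaler0 subr0 scalerBr.
  by rewrite [RHS]addrAC subrKA [RHS]addrAC.
rewrite (le_trans (ler_normD _ _))// [eta]splitr mulrDl lerD//.
  rewrite (le_trans key)// subr0.
  rewrite (_ : eta / 2 * e = e * (eta / (2 * T1)) * T1); last first.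
    by field; rewrite gt_eqF.
  by rewrite ler_wpM2l// mulr_ge0// ltW.
by rewrite normrZ ger0_norm// mulrC ler_wpM2r.
Unshelve. all: by end_near. Qed.

End Closeness.

(** * Linearization of the family of periodic orbits *)

Section Family.
Variables (R : realType) (n : nat) (sys : mech_system R n) (r0 : nat).
Hypothesis hr0 : (3 <= r0)%N.
Hypothesis hsys : standing_assumptions sys r0.
Local Notation N := (n + n)%N.
Local Notation V := 'cV[R]_(n + n).
Local Notation U := (dom sys).
Local Notation G := (grad (ham sys)).
Local Notation J := (sympJ R n).
Variables (m : nat) (tau dd : R) (z : V) (x0 : R -> V) (X0 : R -> 'M[R]_(n + n)).
Hypothesis hm : (0 < m)%N.
Hypothesis hx0 : conservative_orbit sys x0.
Hypothesis hx0z : x0 0 = z.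
Hypothesis tau0 : 0 < tau.
Hypothesis pertau : periodic x0 tau.
Hypothesis hX0 : variational sys dd 0 x0 X0.
Variables (Iset : set R) (zeta : R -> V) (T : R -> R).
Hypothesis hF : energy_family sys z tau Iset zeta T.

Local Notation S := (m%:R * tau).
Local Notation h := (ham sys z).
Local Notation u1 := (ham_field sys z).
Local Notation u2 := ('D_1 zeta h).
Local Notation dT := (derive1 T h).

Lemma periodic_nat (W : zmodType) (y : R -> W) (P : R) (k : nat) :
  periodic y P -> forall t, y (t + k%:R * P) = y t.
Proof.
move=> py; elim: k => [|k IH] t; first by rewrite mul0r addr0.
by rewrite -natr1 mulrDl mul1r addrA py IH.
Qed.

Let S0 : 0 < S. Proof. by rewrite mulr_gt0// ltr0n. Qed.

Let x0S : x0 S = z.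
Proof. by rewrite -[S]add0r periodic_nat. Qed.

Let cx0 : continuous x0.
Proof. by move=> t; have [_ D] := hx0 (t := t) I; exact: is_derive_continuous D. Qed.

Let cX0 : continuous X0.
Proof. by move=> t; have [_ D] := hX0; exact: is_derive_continuous (D t). Qed.

Let Ux0 t : U (x0 t). Proof. by have [] := hx0 (t := t) I. Qed.

Let T1 := S + 1.
Let K1 : set V := x0 @` `[0, T1].

Let cK1 : compact K1.
Proof.
apply: continuous_compact; last exact: segment_compact.
by apply: continuous_subspaceT => t; exact: cx0.
Qed.

Let K1U : K1 `<=` U.
Proof. by move=> _ [t _ <-]; exact: Ux0. Qed.

Let K1t (t : R) : 0 <= t <= T1 -> K1 (x0 t).
Proof. by move=> tT; exists t => //=; rewrite in_itv. Qed.

Let K' : set (V * R)%type := (fun t => (x0 t, 0 : R)) @` `[0, T1].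
Let O' : set (V * R)%type := [set p | U p.1].

Lemma grad_taylor (eta : R) : 0 < eta -> exists2 rho : R, 0 < rho &
  forall (t : R) w, 0 <= t <= T1 -> `|w - x0 t| < rho ->
    `|G w - G (x0 t) - hess sys (x0 t) *m (w - x0 t)| <= eta * `|w - x0 t|.
Proof.
move=> eta0.
have cK' : compact K'.
  apply: continuous_compact; last exact: segment_compact.
  apply: continuous_subspaceT => t.
  have c0 : x0 @ t --> x0 t by exact: cx0.
  exact: (cvg_pair c0 (@cvg_cst _ (0 : R) _ (nbhs t) _)).
have oO' : open O'.
  by move: (dom_open hsys); apply: open_comp => p _; exact: cvg_fst.
have K'O' : K' `<=` O' by move=> _ [t _ <-]; exact: Ux0.
pose F1 (w : V) (_ : R) := G w.
have D1 p : O' p -> forall v, is_derive p.1 v (F1 ^~ p.2) (hess sys p.1 *m v).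
  by move=> Op v; exact: (is_derive_grad hr0 hsys).
have c1 p : K' p -> {for p, continuous (fun p : V * R => hess sys p.1)}.
  move=> Kp; have ch : hess sys @ p.1 --> hess sys p.1.
    exact: (hess_continuous hr0 hsys (K'O' p Kp)).
  exact: (cvg_comp fst (hess sys) cvg_fst ch).
have [rho rho0 H] := taylor_unif oO' D1 cK' K'O' c1 eta0.
exists rho => // t w tT wt.
have Kt : K' (x0 t, 0) by exists t => //=; rewrite in_itv.
by apply: (H (x0 t, 0) w 0 Kt wt); rewrite /= subrr normr0.
Qed.

Lemma conservative_close : exists C rho : R, [/\ 0 < C, 0 < rho & forall y : R -> V,
  conservative_orbit sys y -> `|y 0 - z| < rho ->
  forall t : R, 0 <= t <= T1 -> `|y t - x0 t| <= C * `|y 0 - z|].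
Proof.
have [rho [L [rho0 L0 HL]]] := grad_lipschitz hr0 hsys cK1 K1U.
pose L' := N%:R * `|J| * L.
have JN0 : 0 <= N%:R * `|J| by rewrite mulr_ge0.
have L'0 : 0 <= L' by rewrite mulr_ge0// ltW.
have T10 : 0 <= T1 by rewrite addr_ge0// ltW.
have c1 := gronwall_cst_ge1 N L'0 T10; set c := gronwall_cst N L' T1 in c1.
have c0 : 0 < c by exact: lt_le_trans c1.
exists c, (rho / 2 / c); split=> //; first by rewrite !divr_gt0.
move=> y Hy; rewrite ltr_pdivlMr// mulrC => yrho t tT.
have Du (s : R) : 0 <= s <= T1 -> is_derive s (1 : R) (fun r => y r - x0 r)
    (ham_field sys (y s) - ham_field sys (x0 s)).
  move=> sT; have [_ D1] := Hy s I; have [_ D2] := hx0 (t := s) I.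
  exact: is_deriveB.
have := @gronwall R N (fun r => y r - x0 r) _ T1 L' 0 (rho / 2) L'0 (lexx _) Du.
rewrite addr0 hx0z -/c => H; apply: (H _ yrho t tT) => s sT us.
have us' : `|y s - x0 s| < rho by rewrite (le_lt_trans us)// ltr_pdivrMr// ltr_pMr// ltr1n.
have [_ hG _] := HL _ _ (K1t sT) us'.
rewrite addr0 /ham_field -mulmxBr (le_trans (ler_norm_mulmx _ _))//.
by rewrite /L' -[_ * L * _]mulrA ler_wpM2l.
Qed.

(** For a conservative solution y the form X0^T J (y - x0) is constant to
    first order in y - x0. Using it instead of X0^{-1} (y - x0) avoids
    inverting X0. *)
Lemma family_linearization (eta : R) : 0 < eta -> exists2 rho : R, 0 < rho &
  forall y : R -> V, conservative_orbit sys y -> `|y 0 - z| < rho ->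
    `|(X0 S)^T *m J *m (y S - z) - J *m (y 0 - z)| <= eta * `|y 0 - z|.
Proof.
move=> eta0.
have [C [rho1 [C0 rho10 HC]]] := conservative_close.
have cX0' k : `[0, T1]%classic k -> {for k, continuous X0} by move=> _; exact: cX0.
have [B B0 HB] := compact_bounded_unif (@segment_compact R 0 T1) cX0'.
have N1 : 0 < (N%:R + 1 : R) by rewrite ltr_wpDl.
pose a := eta / ((N%:R + 1) * B * C * S).
have a0 : 0 < a by rewrite divr_gt0// !mulr_gt0// ltr0n.
have [rho2 rho20 HT] := grad_taylor a0.
exists (Num.min rho1 (rho2 / C)) => [|y Hy]; first by rewrite lt_min rho10 divr_gt0.
rewrite lt_min ltr_pdivlMr// => /andP[y1 y2].
have ST : S <= T1 by rewrite /T1 lerDl.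
have inT (s : R) : 0 <= s <= S -> 0 <= s <= T1.
  by move=> /andP[s0 sS]; rewrite s0 (le_trans sS).
have [X01 DX] := hX0.
pose E (s : R) := (X0 s)^T *m J *m (y s - x0 s).
have DE (s : R) : 0 <= s <= S -> is_derive s (1 : R) E
   (- ((X0 s)^T *m (G (y s) - G (x0 s) - hess sys (x0 s) *m (y s - x0 s)))).
  move=> sS; have [_ D1] := Hy s I; have [_ D2] := hx0 (t := s) I.
  apply: is_derive_eq.
    exact: is_derive_mulmx (is_derive_mulmxr J (is_derive_trmx (DX s))) (is_deriveB D1 D2).
  rewrite scale0r addr0 (jac_grad hr0 hsys (Ux0 s)) !trmx_mul (hess_sym hr0 hsys (Ux0 s)).
  rewrite /ham_field -mulmxBr (_ : (y - x0) s = y s - x0 s)//.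
  move: (hess sys (x0 s)) (X0 s)^T (y s - x0 s) (G (y s) - G (x0 s)) => A Y v g.
  rewrite -!mulmxA [J^T *m _]mulmxA sympJ_trJ mul1mx [J *m (J *m _)]mulmxA sympJ_sqr.
  by rewrite mulNmx mul1mx mulmxN -mulmxBr -mulmxN opprB.
have key : `|E S - E 0| <= N%:R * B * (a * (C * `|y 0 - z|)) * (S - 0).
  apply: (norm_increment_le_cst (ltW S0) DE) => s sS.
  rewrite normrN (le_trans (ler_norm_mulmx _ _))// mx_norm_trmx.
  have ys : `|y s - x0 s| <= C * `|y 0 - z| by exact: HC (inT s sS).
  have hB : `|X0 s| <= B by apply: HB; rewrite /= in_itv; exact: inT.
  rewrite ler_pM// ?mulr_ge0// ?ler_wpM2l//.
  have := HT s (y s) (inT s sS) _; rewrite (le_lt_trans ys) ?[C * _]mulrC// => /(_ isT) h1.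
  by rewrite (le_trans h1)// ler_wpM2l// ?(ltW a0)// mulrC.
move: key; rewrite /E x0S X01 trmx1 mul1mx hx0z => key; rewrite (le_trans key)//.
rewrite subr0 [leLHS](_ : _ = (N%:R / (N%:R + 1)) * (eta * `|y 0 - z|)); last first.
  by rewrite /a; field; rewrite !gt_eqF// ltr0n.
rewrite ler_piMl// ?mulr_ge0// ?(ltW eta0)//.
by rewrite ler_pdivrMr// mul1r lerDl.
Qed.

(** Near z the velocity of y is close to u1, so that changing the final time
    from S to b moves the end point by (S - b) u1 to first order. *)
Lemma time_slip (eta : R) : 0 < eta -> exists2 rho : R, 0 < rho &
  forall (y : R -> V) (b : R), conservative_orbit sys y -> `|y 0 - z| < rho ->
    `|b - S| < rho -> `|y S - y b - (S - b) *: u1| <= eta * `|S - b|.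
Proof.
move=> eta0.
have [C [rho1 [C0 rho10 HC]]] := conservative_close.
have Uz : U z by rewrite -hx0z.
have cG : {for z, continuous G} by exact: (grad_continuous hr0 hsys Uz).
have ch : (fun w => ham_field sys w) @ z --> u1.
  exact: (cvg_mulmx (@cvg_cst _ J _ (nbhs z) _) cG).
have /nbhs_ballP[e /= e0 He] : \forall w \near z, `|u1 - ham_field sys w| < eta.
  by move/(@cvgrPdist_lt _ _ _ (nbhs z)): ch; apply.
have [Ux0S Dx0] := hx0 (t := S) I.
have /nbhs_ballP[e2 /= e20 He2] : \forall s \near S, `|x0 S - x0 s| < e / 2.
  have cS : x0 @ S --> x0 S by exact: cx0.
  by move/(@cvgrPdist_lt _ _ _ (nbhs S)): cS; apply; rewrite divr_gt0.
pose rho := Num.min (Num.min rho1 (e / 2 / C)) (Num.min e2 (Num.min 1 S)).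
exists rho; first by rewrite !lt_min rho10 !divr_gt0// e20 ltr01 S0.
move=> y b Hy; rewrite !lt_min ltr_pdivlMr// => /andP[/andP[y1 y2] _].
move=> /andP[_ /and3P[b1 b2 b3]].
have near_t (t : R) : `|t - S| <= `|b - S| -> `|ham_field sys (y t) - u1| <= eta.
  move=> tb; have tS : `|t - S| < 1 by exact: le_lt_trans b2.
  have tS' : `|t - S| < S by exact: le_lt_trans b3.
  have tT : 0 <= t <= T1.
    move: tS tS'; rewrite !ltr_distlC /T1 => /andP[h1 h2] /andP[h3 h4].
    by apply/andP; split; lra.
  rewrite distrC ltW//; apply: He; rewrite -ball_normE /=.
  rewrite -(subrKA (x0 t)) (le_lt_trans (ler_normD _ _))// [ltRHS](splitr e) ltrD//.
    rewrite -x0S; apply: He2; rewrite -ball_normE /= distrC.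
    exact: le_lt_trans b1.
  by rewrite distrC (le_lt_trans (HC y Hy y1 t tT))// mulrC.
pose g (t : R) := y t - t *: u1.
have Dg (t : R) : is_derive t (1 : R) g (ham_field sys (y t) - u1).
  have [_ D1] := Hy t I; apply: is_deriveB D1 _; exact: is_derive_scalel.
rewrite (_ : _ - _ - _ = g S - g b); last first.
  by rewrite /g scalerBl opprB opprD opprK [RHS]addrACA [- (S *: u1) + _]addrC.
have [bS|/ltW bS] := leP b S.
  rewrite [`|S - b|]ger0_norm ?subr_ge0//.
  apply: (norm_increment_le_cst bS (fun t _ => Dg t)) => t /andP[h1 h2]; apply: near_t.
  by rewrite ler0_norm ?subr_le0// ler0_norm ?subr_le0//; lra.
rewrite [`|S - b|]distrC [`|b - S|]ger0_norm ?subr_ge0// distrC.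
apply: (norm_increment_le_cst bS (fun t _ => Dg t)) => t /andP[h1 h2]; apply: near_t.
by rewrite ger0_norm ?subr_ge0// ger0_norm ?subr_ge0//; lra.
Qed.

Let Dzeta : is_derive h (1 : R) zeta u2.
Proof.
case: hF => [[_ Ih] _ [dz _] _ _].
by apply: derivableP; apply: diff_derivable; exact: dz.
Qed.

Let DT : is_derive h (1 : R) T dT.
Proof.
case: hF => [[_ Ih] _ _ [dz _] _]; rewrite derive1E.
by apply: derivableP; apply: diff_derivable; exact: dz.
Qed.

(** The derivative at h of c = H(zeta c). *)
Lemma energy_normalization : inner (G z) u2 = 1.
Proof.
case: hF => [[oI Ih] [zh _] _ _ HI].
have Uz : U (zeta h) by rewrite zh -hx0z.
have D := is_derive_curve (ham_differentiable hr0 hsys Uz) Dzeta.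
have D1 : is_derive h (1 : R) (fun c => ham sys (zeta c)) 1.
  have nI : \forall c \near h, Iset c by exact: (open_nbhs_nbhs (conj oI Ih)).
  apply: (near_eq_is_derive _ (is_derive_id h 1)).
  by apply: filterS nI => c Ic; have [-> _] := HI c Ic.
have E : 'D_u2 (ham sys) (zeta h) = 1 by have [_ <-] := D; have [_ ->] := D1.
rewrite -[RHS]E derive_sum_delta ?zh; last first.
  by rewrite -zh; exact: (ham_differentiable hr0 hsys Uz).
rewrite /inner mxE; apply: eq_bigr => i _.
by rewrite !mxE mulrC.
Qed.

(** The orbit through zeta c closes up after time m T(c). Linearizing the
    flow along x0 and the final time around S, the relation y_c(m T(c)) =
    zeta c becomes, at first order in c - h, Pi u2 = u2 - m T'(h) u1 up to
    the symplectic factor X0^T J = J Pi^{-1}. *)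
Lemma family_monodromy : (X0 S)^T *m J *m (u2 - (m%:R * dT) *: u1) = J *m u2.
Proof.
case: (hF) => [[oI Ih] [zh Th] _ _ HI].
pose Q := (X0 S)^T *m J.
(* The linearized period relation: rr c is o(c - h) by the flow estimates, so
   its derivative at h vanishes. *)
pose rr (c : R) := Q *m (zeta c - z - (m%:R * (T c - tau)) *: u1) - J *m (zeta c - z).
have Drr : is_derive h (1 : R) rr (Q *m (u2 - (m%:R * dT) *: u1) - J *m u2).
  have D1 : is_derive h (1 : R) (fun c => zeta c - z) u2.
    rewrite -[u2]subr0; exact: (is_deriveB Dzeta (is_derive_cst z h 1)).
  have D2 : is_derive h (1 : R) (fun c => (m%:R * (T c - tau)) *: u1) ((m%:R * dT) *: u1).
    have D3 : is_derive h (1 : R) (fun c => m%:R * (T c - tau)) (m%:R * dT).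
      have D4 := is_deriveB DT (is_derive_cst tau h 1); rewrite subr0 in D4.
      exact: (is_deriveZ (m%:R : R) D4).
    move: u1 => w; apply/is_derive_mxP => i j.
    rewrite (_ : (fun _ => _) = (fun c => w i j * (m%:R * (T c - tau)))); last first.
      by apply/funext => c; rewrite mxE mulrC.
    rewrite mxE [_ * w i j]mulrC; exact: (is_deriveZ (w i j) D3).
  exact: is_deriveB (is_derive_mulmxl Q (is_deriveB D1 D2)) (is_derive_mulmxl J D1).
set D := (_ - J *m u2) in Drr.
suff : D = 0 by move=> /eqP; rewrite subr_eq0 => /eqP.
have rrh : rr h = 0 by rewrite /rr zh Th !subrr mulr0 scale0r subrr !mulmx0 subrr.
apply/eqP; rewrite -normr_le0; apply/ler_addgt0Pl => eps eps0; rewrite addr0.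
pose Cz := `|u2| + 1; pose CT := m%:R * (`|dT| + 1).
have Cz0 : 0 < Cz by rewrite ltr_wpDl.
have m0 : 0 < m%:R :> R by rewrite ltr0n.
have CT0 : 0 < CT by rewrite mulr_gt0// ltr_wpDl.
have nQ : 0 < N%:R * `|Q| + 1 by rewrite ltr_wpDl// mulr_ge0.
pose a := eps / (2 * (Cz + (N%:R * `|Q| + 1) * CT)).
have a0 : 0 < a by rewrite divr_gt0// mulr_gt0// addr_gt0// mulr_gt0.
have [r1 r10 H1] := family_linearization a0.
have [r2 r20 H2] := time_slip a0.
have [r3 r30 H3] := is_derive_small ltr01 Dzeta.
have [r4 r40 H4] := is_derive_small ltr01 DT.
have [r5 r50 H5] := is_derive_small (divr_gt0 eps0 (ltr0n _ 2)) Drr.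
have /nbhs_ballP[r6 /= r60 H6] : \forall c \near h, Iset c.
  exact: (open_nbhs_nbhs (conj oI Ih)).
pose k := Num.min (Num.min (Num.min r1 r2 / Cz) (r2 / CT)) (Num.min r3 (Num.min r4 (Num.min r5 r6))) / 2.
have kk0 : 0 < Num.min (Num.min (Num.min r1 r2 / Cz) (r2 / CT)) (Num.min r3 (Num.min r4 (Num.min r5 r6))).
  by rewrite !lt_min r30 r40 r50 r60 !divr_gt0// lt_min r10.
have k0 : 0 < k by rewrite divr_gt0.
have : k < Num.min (Num.min (Num.min r1 r2 / Cz) (r2 / CT)) (Num.min r3 (Num.min r4 (Num.min r5 r6))).
  by rewrite /k ltr_pdivrMr// ltr_pMr// ltr1n.
rewrite !lt_min !ltr_pdivlMr// lt_min.
move=> /andP[/andP[/andP[k1 k2] k2'] /and4P[k3 k4 k5 k6]].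
pose c := h + k.
have ck : c - h = k by rewrite /c addrC addKr.
have nk : `|c - h| = k by rewrite ck gtr0_norm.
have Ic : Iset c.
  by apply: H6; rewrite -ball_normE /= distrC nk.
have zc : `|zeta c - z| <= Cz * k.
  have := H3 c; rewrite nk => /(_ k3); rewrite zh ck => h3.
  rewrite -(subrK (k *: u2) (zeta c - z)) (le_trans (ler_normD _ _))//.
  by rewrite (le_trans (lerD h3 (lexx _)))// normrZ gtr0_norm// /Cz; lra.
have Tc : m%:R * `|T c - tau| <= CT * k.
  have := H4 c; rewrite nk => /(_ k4); rewrite Th ck => h4.
  rewrite /CT -mulrA ler_wpM2l ?(ltW m0)//.
  rewrite -(subrK (k *: dT) (T c - tau)) (le_trans (ler_normD _ _))//.
  by rewrite (le_trans (lerD h4 (lexx _)))// normrZ gtr0_norm//; lra.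
have [_ [y [Hy yc [Tc0 pT _]]]] := HI c Ic.
have yb : y (m%:R * T c) = zeta c by rewrite -yc -[m%:R * T c]add0r periodic_nat.
have bS : S - m%:R * T c = - (m%:R * (T c - tau)) by ring.
have nbS : `|m%:R * T c - S| <= CT * k.
  by rewrite distrC bS normrN normrM ger0_norm ?(ltW m0).
have y0z : `|y 0 - z| <= Cz * k by rewrite yc.
have y0r1 : `|y 0 - z| < r1 by rewrite (le_lt_trans y0z)// mulrC.
have y0r2 : `|y 0 - z| < r2 by rewrite (le_lt_trans y0z)// mulrC.
have br2 : `|m%:R * T c - S| < r2 by rewrite (le_lt_trans nbS)// mulrC.
have L1 := H1 y Hy y0r1.
have L2 := H2 y _ Hy y0r2 br2.
rewrite yb bS scaleNr opprK in L2.
have L3 : `|rr c| <= eps / 2 * k.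
  have -> : rr c = (Q *m (y S - z) - J *m (y 0 - z)) -
      Q *m (y S - zeta c + (m%:R * (T c - tau)) *: u1).
    rewrite /rr yc [RHS]addrAC; congr (_ - _); rewrite -mulmxBr; congr (_ *m _).
    by rewrite opprD addrA opprB [y S - z + _]addrC subrKA.
  rewrite (le_trans (ler_normB _ _))//.
  have e1 : `|Q *m (y S - z) - J *m (y 0 - z)| <= a * (Cz * k).
    by rewrite (le_trans L1)// ler_wpM2l// ltW.
  have e2 : `|Q *m (y S - zeta c + (m%:R * (T c - tau)) *: u1)| <=
      (N%:R * `|Q| + 1) * (a * (CT * k)).
    rewrite (le_trans (ler_norm_mulmx _ _))// ler_pM// ?mulr_ge0//; first by rewrite lerDl.
    by rewrite (le_trans L2)// ler_wpM2l ?(ltW a0)// -bS distrC.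
  rewrite (le_trans (lerD e1 e2))//.
  rewrite [leLHS](_ : _ = a * (Cz + (N%:R * `|Q| + 1) * CT) * k); last by ring.
  rewrite ler_wpM2r ?(ltW k0)// /a.
  rewrite [leLHS](_ : _ = eps / 2)//; field.
  by rewrite gt_eqF// addr_gt0// mulr_gt0.
have := H5 c; rewrite nk => /(_ k5); rewrite rrh subr0 ck => L4.
have : `|k *: D| <= eps * k.
  rewrite -[k *: D](subKr (rr c)) (le_trans (ler_normB _ _))//.
  by rewrite (le_trans (lerD L3 L4))// -mulrDl -splitr.
by rewrite normrZ gtr0_norm// mulrC ler_pM2r.
Qed.

(** The transpose of the linearized period relation; the energy differential
    DH(z)^T is fixed by Pi. *)
Lemma family_covector : u2^T *m J *m X0 S = u2^T *m J + (m%:R * dT) *: (G z)^T.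
Proof.
have := congr1 trmx family_monodromy.
rewrite !trmx_mul trmxK sympJ_tr [in RHS]mulmxN mulNmx mulmxN => /oppr_inj.
rewrite mulmxA linearB /= linearZ /= mulmxBl mulmxBl => /eqP.
rewrite subr_eq -scalemxAl -scalemxAl => /eqP ->; congr (_ + _ *: _).
rewrite /ham_field trmx_mul -[(G z)^T *m J^T *m J]mulmxA sympJ_trJ mulmx1.
have := unperturbed_energy hr0 hsys hx0 hX0 (ltW S0).
by rewrite hx0z x0S.
Qed.

End Family.

(** * Contraction and Melnikov derivative as averaged drifts *)

Section Drift.
Variables (R : realType) (n : nat) (sys : mech_system R n) (r0 : nat).
Hypothesis hr0 : (3 <= r0)%N.
Hypothesis hsys : standing_assumptions sys r0.
Local Notation N := (n + n)%N.
Local Notation V := 'cV[R]_(n + n).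
Local Notation E4 := ('cV[R]_(n + n) * R * R * R)%type.
Local Notation U := (dom sys).
Local Notation G := (grad (ham sys)).
Local Notation J := (sympJ R n).
Variables (f : E4 -> V) (fX : E4 -> 'M[R]_(n + n)).
Hypothesis pE : forall x t d e, U x -> 0 < d -> 0 <= e ->
  pert sys x t d e = f (x, t, d, e) /\ dpert sys x t d e = fX (x, t, d, e).
Hypothesis cf : forall x t d e, U x -> 0 < d -> 0 <= e -> {for (x, t, d, e), continuous f}.
Hypothesis cfX : forall x t d e, U x -> 0 < d -> 0 <= e -> {for (x, t, d, e), continuous fX}.
Hypothesis Dpert : forall (c : R -> V) (s : R) dc t d e, U (c s) -> 0 < d -> 0 <= e ->
  is_derive s (1 : R) c dc ->
  is_derive s (1 : R) (fun r => pert sys (c r) t d e) (fX (c s, t, d, e) *m dc).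

(** Rate of change of X^T J X, divided by e. *)
Definition sympl_drift (p : E4 * 'M[R]_(n + n)) : 'M[R]_(n + n) :=
  p.2^T *m ((fX p.1)^T *m J + J *m fX p.1) *m p.2.

(** Differential in x of the power DH^T g of the perturbation. *)
Definition power_drift (w : E4) : 'rV[R]_(n + n) :=
  (f w)^T *m hess sys w.1.1.1 + (G w.1.1.1)^T *m fX w.

(** Rate of change of DH(x)^T X, divided by e. *)
Definition energy_drift (p : E4 * 'M[R]_(n + n)) : 'rV[R]_(n + n) :=
  power_drift p.1 *m p.2.

Lemma sympl_drift_continuous x t d e Y : U x -> 0 < d -> 0 <= e ->
  {for ((x, t, d, e), Y), continuous sympl_drift}.
Proof.
move=> Ux d0 e0; set p := (_, Y).
have c1 : (fun p : E4 * 'M[R]_(n + n) => fX p.1) @ p --> fX (x, t, d, e).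
  have ch : fX @ (x, t, d, e) --> fX (x, t, d, e) by exact: cfX.
  exact: (cvg_comp fst fX cvg_fst ch).
have c2 : (fun p : E4 * 'M[R]_(n + n) => p.2) @ p --> Y by exact: cvg_snd.
apply: (cvg_mulmx _ c2); apply: (cvg_mulmx (cvg_trmx c2)).
apply: cvgD.
  exact: (cvg_mulmx (cvg_trmx c1) (@cvg_cst _ J _ (nbhs p) _)).
exact: (cvg_mulmx (@cvg_cst _ J _ (nbhs p) _) c1).
Qed.

Lemma power_drift_continuous x t d e : U x -> 0 < d -> 0 <= e ->
  {for (x, t, d, e), continuous power_drift}.
Proof.
move=> Ux d0 e0; set w := (x, t, d, e).
have c1 : fX @ w --> fX w by exact: cfX.
have c2 : f @ w --> f w by exact: cf.
have c0 : (fun w : E4 => w.1.1.1) @ w --> x.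
  have a1 : (fun w : E4 => w.1) @ w --> (x, t, d) by exact: cvg_fst.
  have a2 : (fun w : E4 => w.1.1) @ w --> (x, t).
    have b2 : (fun w : V * R * R => w.1) @ (x, t, d) --> (x, t) by exact: cvg_fst.
    exact: (cvg_comp _ _ a1 b2).
  have b3 : (fun w : V * R => w.1) @ (x, t) --> x by exact: cvg_fst.
  exact: (cvg_comp _ _ a2 b3).
have c3 : (fun w : E4 => hess sys w.1.1.1) @ w --> hess sys x.
  have ch : hess sys @ x --> hess sys x by exact: (hess_continuous hr0 hsys Ux).
  exact: (cvg_comp _ _ c0 ch).
have c4 : (fun w : E4 => G w.1.1.1) @ w --> G x.
  have ch : G @ x --> G x by exact: (grad_continuous hr0 hsys Ux).
  exact: (cvg_comp _ _ c0 ch).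
exact: cvgD (cvg_mulmx (cvg_trmx c2) c3) (cvg_mulmx (cvg_trmx c4) c1).
Qed.

Lemma energy_drift_continuous x t d e Y : U x -> 0 < d -> 0 <= e ->
  {for ((x, t, d, e), Y), continuous energy_drift}.
Proof.
move=> Ux d0 e0; set p := (_, Y).
have c1 : (fun p : E4 * 'M[R]_(n + n) => power_drift p.1) @ p --> power_drift (x, t, d, e).
  have ch : power_drift @ (x, t, d, e) --> power_drift (x, t, d, e).
    exact: power_drift_continuous.
  exact: (cvg_comp fst power_drift cvg_fst ch).
have c2 : (fun p : E4 * 'M[R]_(n + n) => p.2) @ p --> Y by exact: cvg_snd.
exact: cvg_mulmx c1 c2.
Qed.

Variables (x0 : R -> V) (X0 : R -> 'M[R]_(n + n)) (d0 dd S : R).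
Hypothesis hx0 : conservative_orbit sys x0.
Hypothesis hX0 : variational sys dd 0 x0 X0.
Hypothesis d0_gt0 : 0 < d0.
Hypothesis S0 : 0 < S.

Let cx0 : continuous x0.
Proof. by move=> t; have [_ D] := hx0 (t := t) I; exact: is_derive_continuous D. Qed.

Let cX0 : continuous X0.
Proof. by move=> t; have [_ D] := hX0; exact: is_derive_continuous (D t). Qed.

Let Ux0 t : U (x0 t). Proof. by have [] := hx0 (t := t) I. Qed.

Local Notation conservative_args := (conservative_args x0 d0).

Lemma drift_along_continuous p q (Phi : E4 * 'M[R]_(n + n) -> 'M[R]_(p, q)) (t : R) :
  {for (conservative_args t, X0 t), continuous Phi} -> {for t, continuous (fun t => Phi (conservative_args t, X0 t))}.
Proof.
move=> cPhi.
have h1 : conservative_args @ t --> conservative_args t by exact: (conservative_args_continuous hx0).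
have h2 : X0 @ t --> X0 t by exact: cX0.
have h3 : (fun s => (conservative_args s, X0 s)) @ t --> (conservative_args t, X0 t) by exact: (cvg_pair h1 h2).
have h4 : Phi @ (conservative_args t, X0 t) --> Phi (conservative_args t, X0 t) by exact: cPhi.
exact: (cvg_comp _ _ h3 h4).
Qed.

(** Since X0 is symplectic, J X0^{-1} = X0^T J, and the trace over a plane
    of a matrix against a skew form picks out the antisymmetric part of R^T
    X0^T J dg X0 R, which is the drift of the symplectic form. *)
Lemma contraction_trace (RV : 'M[R]_(n + n, 1.*2)) (t : R) : 0 <= t ->
  \tr (sympl_left_inv RV *m invmx (X0 t) *m dpert sys (x0 t) t d0 0 *m X0 t *m RV) =
  (RV^T *m sympl_drift (conservative_args t, X0 t) *m RV) 0 1 / (RV^T *m J *m RV) 0 1.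
Proof.
move=> t0; have [_ ->] := pE t (Ux0 t) d0_gt0 (lexx 0).
have XJX := unperturbed_symplectic hr0 hsys Ux0 hX0 t0.
have uX : X0 t \in unitmx.
  have E1 : (J^T *m ((X0 t)^T *m J)) *m X0 t = 1%:M by rewrite -mulmxA XJX sympJ_trJ.
  by have [] := mulmx1_unit E1.
have JX : J *m invmx (X0 t) = (X0 t)^T *m J.
  by rewrite -[RHS](mulmxK uX) XJX.
pose H := RV^T *m ((X0 t)^T *m J *m fX (conservative_args t) *m X0 t) *m RV.
have WT : (RV^T *m J *m RV)^T = - (RV^T *m J *m RV).
  by rewrite !trmx_mul trmxK sympJ_tr mulNmx mulmxN mulmxA.
have -> : sympl_left_inv RV *m invmx (X0 t) *m fX (x0 t, t, d0, 0) *m X0 t *m RV =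
    invmx (RV^T *m J *m RV) *m H.
  by rewrite /sympl_left_inv /H -JX !mulmxA.
rewrite (tr_invmx_skew2 H WT).
have -> : H 0 1 - H 1 0 = (H - H^T) 0 1 by rewrite [RHS]mxE [X in _ = _ + X]mxE [H^T _ _]mxE.
suff -> : H - H^T = RV^T *m sympl_drift (conservative_args t, X0 t) *m RV by [].
rewrite /H /sympl_drift /=.
rewrite !trmx_mul !trmxK sympJ_tr !mulmxA !mulmxN !mulNmx opprK.
by rewrite !mulmxDr !mulmxDl addrC !mulmxA.
Qed.

(** The integrand is the derivative of the ratio of the two skew forms RV^T
    Lam RV and RV^T J RV on the plane. *)
Lemma volume_contraction_drift (m l : nat) (tau : R) (RV : 'M[R]_(n + n, 1.*2))
    (Lam : R -> 'M[R]_(n + n)) :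
  S = m%:R * tau -> d0 = m%:R * tau / l%:R -> Lam 0 = 0 ->
  (forall t : R, is_derive t (1 : R) Lam (sympl_drift (conservative_args t, X0 t))) ->
  volume_contraction sys m l tau x0 X0 (RV : 'M[R]_(n + n, 1.*2)) =
  - S^-1 * ((RV^T *m Lam S *m RV) 0 1 / (RV^T *m J *m RV) 0 1).
Proof.
move=> ES Ed Lam0 DLam; rewrite /volume_contraction -Ed -ES mulr1; congr (_ * _).
pose om := (RV^T *m J *m RV) 0 1.
pose c (t : R) := (RV^T *m sympl_drift (conservative_args t, X0 t) *m RV) 0 1 / om.
pose F (t : R) := (RV^T *m Lam t *m RV) 0 1 / om.
rewrite (_ : \int[_]_(t in _) _ = \int[lebesgue_measure]_(t in `[0, S]) c t); last first.
  apply: eq_Rintegral => t; rewrite inE /= in_itv /= => /andP[t0 _].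
  by rewrite contraction_trace.
have -> : (RV^T *m Lam S *m RV) 0 1 / (RV^T *m J *m RV) 0 1 = F S - F 0.
  by rewrite /F Lam0 mulmx0 mul0mx [X in _ - X / _]mxE mul0r subr0.
apply: (@Rintegral_primitive _ c F _ _ S0) => t _.
- have c1 : (fun t => sympl_drift (conservative_args t, X0 t)) @ t --> sympl_drift (conservative_args t, X0 t).
    by apply: drift_along_continuous; exact: sympl_drift_continuous.
  have c2 : (fun t => RV^T *m sympl_drift (conservative_args t, X0 t) *m RV) @ t -->
      RV^T *m sympl_drift (conservative_args t, X0 t) *m RV.
    exact: (cvg_mulmx (cvg_mulmx (@cvg_cst _ RV^T _ (nbhs t) _) c1)
                      (@cvg_cst _ RV _ (nbhs t) _)).
  have c4 := (cvg_mxP (F := nbhs t) _ _).1 c2 0 1.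
  by rewrite /prop_for /continuous_at /c; apply: cvgMr_tmp; exact: c4.
- have D1 := is_derive_mulmxr RV (is_derive_mulmxl RV^T (DLam t)).
  have D2 := (is_derive_mxP _ _ _ _).1 D1 0 1.
  have D3 := is_deriveZ om^-1 D2.
  rewrite /c mulrC; rewrite (_ : F = fun t => om^-1 * (RV^T *m Lam t *m RV) 0 1)//.
  by apply/funext => s; rewrite /F mulrC.
Qed.

(** The s-derivative of the integrand DH(x0(t+s))^T g(x0(t+s), t) at s = 0
    is power_drift applied to the velocity of x0, which is X0 t u1.
    Differentiation under the integral is done on antiderivatives: K s t - K
    0 t - s D 0 t is o(s) uniformly in t in [0, S], and so is its
    antiderivative at S. *)
Lemma melnikov_derive (m l : nat) (tau : R) (Lam : R -> 'rV[R]_(n + n)) :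
  S = m%:R * tau -> d0 = tau * m%:R / l%:R -> Lam 0 = 0 ->
  (forall t : R, is_derive t (1 : R) Lam (energy_drift (conservative_args t, X0 t))) ->
  derive1 (melnikov sys m l tau x0) 0 = (Lam S *m ham_field sys (x0 0)) 0 0.
Proof.
move=> ES Ed Lam0 DLam; set u1 := ham_field sys (x0 0).
pose W (p : R * R) : E4 := (x0 (p.1 + p.2), p.1, d0, 0).
have cW p : W @ p --> W p.
  have a0 : (fun p : R * R => p.1 + p.2) @ p --> p.1 + p.2.
    by apply: cvgD; [exact: cvg_fst|exact: cvg_snd].
  have a1 : (fun p : R * R => x0 (p.1 + p.2)) @ p --> x0 (p.1 + p.2).
    have cc : x0 @ (p.1 + p.2) --> x0 (p.1 + p.2) by exact: cx0.
    exact: (cvg_comp _ _ a0 cc).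
  have a2 : (fun p : R * R => p.1) @ p --> p.1 by exact: cvg_fst.
  have a4 : (fun p : R * R => (x0 (p.1 + p.2), p.1, d0)) @ p --> (x0 (p.1 + p.2), p.1, d0).
    exact: (cvg_pair (cvg_pair a1 a2) (@cvg_cst _ d0 _ (nbhs p) _)).
  exact: (cvg_pair a4 (@cvg_cst _ (0 : R) _ (nbhs p) _)).
pose K (s t : R) : 'M[R]_1 := (G (x0 (t + s)))^T *m f (W (t, s)).
pose D (s t : R) : 'M[R]_1 := power_drift (W (t, s)) *m ham_field sys (x0 (t + s)).
have cK s (t : R) : K s @ t --> K s t.
  have b1 : (fun t : R => (t, s)) @ t --> (t, s).
    exact: (cvg_pair (@cvg_id _ (nbhs t)) (@cvg_cst _ s _ (nbhs t) _)).
  have b2 : (fun t : R => W (t, s)) @ t --> W (t, s) by exact: (cvg_comp _ _ b1 (cW _)).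
  have b3 : f @ W (t, s) --> f (W (t, s)) by exact: cf.
  have b4 : (fun t : R => t + s) @ t --> t + s.
    exact: (cvgD (@cvg_id _ (nbhs t)) (@cvg_cst _ s _ (nbhs t) _)).
  have b5 : x0 @ (t + s) --> x0 (t + s) by exact: cx0.
  have b6 : G @ x0 (t + s) --> G (x0 (t + s)) by exact: (grad_continuous hr0 hsys (Ux0 _)).
  have b7 : (fun t : R => G (x0 (t + s))) @ t --> G (x0 (t + s)).
    exact: (cvg_comp _ _ (cvg_comp _ _ b4 b5) b6).
  exact: (cvg_mulmx (cvg_trmx b7) (cvg_comp _ _ b2 b3)).
have cD p : (fun p : R * R => D p.2 p.1) @ p --> D p.2 p.1.
  have b3 : power_drift @ W p --> power_drift (W p) by exact: power_drift_continuous.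
  have b2 : (fun p => power_drift (W p)) @ p --> power_drift (W p).
    exact: (cvg_comp _ _ (cW p) b3).
  have a0 : (fun p : R * R => p.1 + p.2) @ p --> p.1 + p.2.
    by apply: cvgD; [exact: cvg_fst|exact: cvg_snd].
  have b5 : x0 @ (p.1 + p.2) --> x0 (p.1 + p.2) by exact: cx0.
  have b6 : G @ x0 (p.1 + p.2) --> G (x0 (p.1 + p.2)).
    exact: (grad_continuous hr0 hsys (Ux0 _)).
  have b7 : (fun p : R * R => G (x0 (p.1 + p.2))) @ p --> G (x0 (p.1 + p.2)).
    exact: (cvg_comp _ _ (cvg_comp _ _ a0 b5) b6).
  rewrite (_ : (fun _ => _) = (fun p : R * R => power_drift (W p) *m (J *m G (x0 (p.1 + p.2))))); last first.
    by apply/funext => -[? ?].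
  rewrite (_ : D _ _ = power_drift (W p) *m (J *m G (x0 (p.1 + p.2)))); last by case: (p).
  exact: (cvg_mulmx b2 (cvg_mulmx (@cvg_cst _ J _ (nbhs p) _) b7)).
have DK (t s : R) : is_derive s (1 : R) (K ^~ t) (D s t).
  have Dx : is_derive s (1 : R) (fun s => x0 (t + s)) (ham_field sys (x0 (t + s))).
    have [_ h] := hx0 (t := t + s) I; rewrite addrC in h.
    have := is_derive_shiftR h; rewrite addrC.
    by under [fun s => x0 (t + s)]eq_fun do rewrite addrC.
  have DG := is_derive_curve_jac (fun i => grad_differentiable hr0 hsys i (Ux0 (t + s))) Dx.
  have Df := Dpert t (Ux0 (t + s)) d0_gt0 (lexx 0) Dx.
  have E : (fun r => pert sys (x0 (t + r)) t d0 0) = (fun r => f (W (t, r))).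
    by apply/funext => r; have [-> _] := pE t (Ux0 (t + r)) d0_gt0 (lexx 0).
  rewrite {}E in Df.
  apply: is_derive_eq; first exact: is_derive_mulmx (is_derive_trmx DG) Df.
  rewrite (jac_grad hr0 hsys (Ux0 _)) /D /power_drift /W /=.
  move: (ham_field sys _) (fX _) (G _) (f _) => v A g w.
  rewrite mulmxDl mulmxA; congr (_ + _).
  rewrite -[LHS]trmxK trmx_mul !trmxK mulmxA.
  by rewrite [LHS]mx11_scalar [RHS]mx11_scalar; congr (_%:M); rewrite mxE.
have DS (t : R) : 0 <= t -> D 0 t = energy_drift (conservative_args t, X0 t) *m u1.
  move=> t0; rewrite /energy_drift /= -mulmxA (orbit_velocity hr0 hsys hx0 hX0 t0).
  by rewrite /D /W /= addr0.
have /choice[F HF] : forall s, exists F : R -> 'M[R]_1, F 0 = 0 /\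
    forall t : R, is_derive t (1 : R) F (K s t).
  by move=> s; have [F ? ?] := antiderivative_mx (cK s); exists F.
have ME s : melnikov sys m l tau x0 s = (F s S) 0 0.
  have [F0 DF] := HF s; rewrite /melnikov -ES -Ed.
  rewrite (_ : \int[_]_(t in _) _ = \int[lebesgue_measure]_(t in `[0, S]) (K s t 0 0)); last first.
    apply: eq_Rintegral => t _; rewrite /inner.
    by have [-> _] := pE t (Ux0 (t + s)) d0_gt0 (lexx 0).
  have -> : F s S 0 0 = F s S 0 0 - F s 0 0 0 by rewrite F0 mxE subr0.
  apply: (@Rintegral_primitive _ (fun t => K s t 0 0) (fun t => F s t 0 0) _ _ S0) => t _.
  - by exact: ((cvg_mxP (F := nbhs t) _ _).1 (cK s t) 0 0).
  - by exact: ((is_derive_mxP _ _ _ _).1 (DF t) 0 0).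
have key (eta : R) : 0 < eta -> exists2 rho : R, 0 < rho & forall s : R, `|s| < rho ->
    `|F s S - F 0 S - s *: (Lam S *m u1)| <= eta * `|s|.
  move=> eta0.
  (* uniformity in t of the modulus of continuity of D at s = 0 *)
  pose C : set (R * R) := (fun t => (t, 0 : R)) @` `[0, S].
  have cC : compact C.
    apply: continuous_compact; last exact: segment_compact.
    apply: continuous_subspaceT => t.
    exact: (cvg_pair (@cvg_id _ (nbhs t)) (@cvg_cst _ (0 : R) _ (nbhs t) _)).
  have a0 : 0 < eta / S by rewrite divr_gt0.
  have [rho rho0 Hr] := compact_unif cC (fun k _ => cD k) a0.
  exists rho => // s srho.
  have Hs (t : R) : 0 <= t <= S -> `|K s t - K 0 t - s *: D 0 t| <= eta / S * `|s|.
    move=> tS; pose g (r : R) := K r t - r *: D 0 t.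
    have Dg (r : R) : is_derive r (1 : R) g (D r t - D 0 t).
      exact: is_deriveB (DK t r) (is_derive_scalel _ _).
    have bg (r : R) : `|r| <= `|s| -> `|D r t - D 0 t| <= eta / S.
      move=> rs; apply/ltW; apply: (Hr (t, 0) (t, r)); first by exists t => //=; rewrite in_itv.
      by rewrite prod_normE /= subrr normr0 subr0 gt_max rho0 (le_lt_trans rs).
    rewrite (_ : _ - _ - _ = g s - g 0); last by rewrite /g scale0r subr0 addrAC.
    have [s0|/ltW s0] := leP 0 s.
      have := norm_increment_le_cst s0 (fun r _ => Dg r); rewrite subr0 ger0_norm//; apply.
      by move=> r /andP[h1 h2]; apply: bg; rewrite !ger0_norm.
    have := norm_increment_le_cst s0 (fun r _ => Dg r); rewrite sub0r ler0_norm// distrC; apply.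
    by move=> r /andP[h1 h2]; apply: bg; rewrite !ler0_norm// lerN2.
  have := norm_increment_le_cst (ltW S0)
    (w := fun t => F s t - F 0 t - s *: (Lam t *m u1))
    (dw := fun t => K s t - K 0 t - s *: (energy_drift (conservative_args t, X0 t) *m u1))
    (c := eta / S * `|s|).
  rewrite subr0 (HF s).1 (HF 0).1 Lam0 mul0mx scaler0 !subr0 mulrAC divfK ?gt_eqF//; apply.
    move=> t _; apply: is_deriveB; last first.
      by have := is_deriveZ s (is_derive_mulmxr u1 (DLam t)).
    by apply: is_deriveB; [exact: (HF s).2|exact: (HF 0).2].
  by move=> t tS; case/andP: (tS) => t0 _; rewrite -(DS _ t0) mulrAC; exact: Hs.
rewrite /derive1; apply: cvg_lim => //.
apply/(@cvgrPdist_le _ _ _ (0 : R)^') => eta eta0.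
have [rho rho0 Hr] := key eta eta0.
near=> s.
have s0 : s != 0 by near: s; exact: nbhs_dnbhs_neq.
have sr : `|s| < rho by near: s; exact: dnbhs0_lt.
have H := le_trans (ler_mx_norm _ 0 0) (Hr s sr).
rewrite addr0 !ME distrC.
have E : (F s S - F 0 S - s *: (Lam S *m u1)) 0 0 =
    s * (s^-1 *: (F s S 0 0 - F 0 S 0 0) - (Lam S *m u1) 0 0).
  by move: (Lam S *m u1) => v; rewrite !mxE /GRing.scale /= mulrBr mulrA divff// mul1r.
by move: H; rewrite E normrM mulrC ler_pM2r// normr_gt0.
Unshelve. all: by end_near. Qed.

End Drift.

(** * Limits of multipliers *)

Section UltraLimits.
Variables (R : realType) (T : Type) (F : set_system T).
Context {FU : UltraFilter F}.

(** A cluster point in [-M, M] of an ultrafilter is its limit. *)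
Lemma ultra_bounded_cvg (f : T -> R) (M : R) :
  (\forall e \near F, `|f e| <= M) -> exists l : R, f @ F --> l.
Proof.
move=> fM.
have PF : ProperFilter F by exact: ultra_proper.
have : (f @ F) `[- M, M]%classic.
  by apply: filterS fM => e; rewrite /= in_itv /= ler_norml.
move=> /(@segment_compact R (- M) M (f @ F) _)[l [_ cl]].
exists l => B Bl.
have [//|FB] := in_ultra_setVsetC (f @^-1` B) FU.
have [|y [By By']] := cl (~` B) B _ Bl; first by [].
by [].
Qed.

Lemma ultra_bounded_cvg_mx m n (f : T -> 'M[R]_(m, n)) (M : R) :
  (\forall e \near F, `|f e| <= M) -> exists l : 'M[R]_(m, n), f @ F --> l.
Proof.
move=> fM.
have PF : ProperFilter F by exact: ultra_proper.
have H i j : exists l : R, (fun e => f e i j) @ F --> l.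
  apply: (@ultra_bounded_cvg _ M); apply: filterS fM => e; apply: le_trans.
  exact: ler_mx_norm.
have /choice[l Hl] : forall ij : 'I_m * 'I_n, exists l : R,
    (fun e => f e ij.1 ij.2) @ F --> l by move=> [i j]; exact: H.
exists (\matrix_(i, j) l (i, j)); apply/cvg_mxP => i j; rewrite mxE.
exact: (Hl (i, j)).
Qed.

End UltraLimits.

Section Quadratic.
Variable R : realType.

(** Over the complex numbers A satisfies (A - mu)(A - conj mu) w = 0. Which
    of the two roots is an eigenvalue depends on w, whence the sign
    ambiguity in be'. *)
Lemma quadratic_eigenvalue N (A : 'M[R]_N) (al be : R) (w : 'cV[R]_N) : w != 0 ->
  A *m (A *m w) = (2 * al) *: (A *m w) - (al ^+ 2 + be ^+ 2) *: w ->
  exists be', be' ^+ 2 = be ^+ 2 /\ eigenvalue (to_C A) (Complex al be').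
Proof.
move=> w0 Aw.
pose mu := Complex al be; pose mu' := Complex al (- be).
pose W := (map_mx (real_complex R) w)^T; pose B := (to_C A)^T.
have W0 : W != 0 by rewrite trmx_eq0 map_mx_eq0.
have ev a : eigenvalue B a = eigenvalue (to_C A) a.
  by rewrite !eigenvalue_root_char char_poly_trmx.
have trlin (a b : R[i]) (x y : 'cV[R[i]]_N) : (a *: x - b *: y)^T = a *: x^T - b *: y^T.
  by apply/matrixP => i j; rewrite !mxE.
have key : (W *m B - mu' *: W) *m B = mu *: (W *m B - mu' *: W).
  have E : W *m B *m B = (mu + mu') *: (W *m B) - (mu * mu') *: W.
    have -> : mu + mu' = real_complex R (2 * al).
      by apply/eqP; rewrite eq_complex /= subrr eqxx andbT; apply/eqP; ring.
    have -> : mu * mu' = real_complex R (al ^+ 2 + be ^+ 2).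
      by apply/eqP; rewrite eq_complex /=; apply/andP; split; apply/eqP; ring.
    rewrite -!trmx_mul -!to_C_mul Aw map_mxB !map_mxZ.
    exact: trlin.
  rewrite mulmxBl E -scalemxAl scalerBr scalerDl scalerA addrAC addrK.
  by [].
have [C0|C0] := eqVneq (W *m B - mu' *: W) 0.
  exists (- be); split; first by rewrite sqrrN.
  by rewrite -ev; apply/eigenvalueP; exists W => //; apply/eqP; rewrite -subr_eq0 C0.
exists be; split=> //; rewrite -ev; apply/eigenvalueP.
by exists (W *m B - mu' *: W).
Qed.

End Quadratic.

Section PlaneBasis.
Variable R : realType.

(** The real and imaginary parts of mu are Rayleigh quotients: with q =
    |r|^2 + |s|^2, al q = <A r, r> + <A s, s> and be q = <A s, r> - <A r,
    s>. *)
Lemma eigenvalue_bound N (A : 'M[R]_N) (al be : R) :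
  eigenvalue (to_C A) (Complex al be) ->
  `|al| <= 2 * (N%:R * N%:R) * `|A| /\ `|be| <= 2 * (N%:R * N%:R) * `|A|.
Proof.
move=> /real_eigenpair[r [s [Ar As rs0]]].
pose q := inner r r + inner s s.
have r2 := sqr_norm_le_inner r; have s2 := sqr_norm_le_inner s.
have q0 : 0 < q.
  case/orP: rs0 => [r0|s0].
    by rewrite ltr_pwDl// ?inner_ge0// (lt_le_trans _ r2)// exprn_gt0// normr_gt0.
  by rewrite ltr_wpDl// ?inner_ge0// (lt_le_trans _ s2)// exprn_gt0// normr_gt0.
have bnd (u v : 'cV[R]_N) : `|u| ^+ 2 <= q -> `|v| ^+ 2 <= q ->
    `|inner (A *m u) v| <= N%:R * N%:R * `|A| * q.
  move=> uq vq; rewrite (le_trans (norm_inner_le _ _))//.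
  rewrite (le_trans (_ : _ <= N%:R * (N%:R * `|A| * `|u|) * `|v|))//.
    by rewrite ler_wpM2r// ler_wpM2l// ler_norm_mulmx.
  rewrite [leLHS](_ : _ = N%:R * N%:R * `|A| * (`|u| * `|v|)); last by ring.
  rewrite ler_wpM2l// ?mulr_ge0//.
  have : `|u| * `|v| <= Num.max (`|u|) (`|v|) ^+ 2.
    by rewrite expr2 ler_pM// le_max lexx// orbT.
  by move=> /le_trans; apply; case: (leP (`|u|) (`|v|)).
have rq : `|r| ^+ 2 <= q by rewrite (le_trans r2)// lerDl inner_ge0.
have sq : `|s| ^+ 2 <= q by rewrite (le_trans s2)// lerDr inner_ge0.
have innerDl (x y z : 'cV[R]_N) : inner (x + y) z = inner x z + inner y z.
  by rewrite /inner linearD /= mulmxDl mxE.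
have innerZl (c : R) (x z : 'cV[R]_N) : inner (c *: x) z = c * inner x z.
  by rewrite /inner linearZ /= -scalemxAl mxE.
have Eal : al * q = inner (A *m r) r + inner (A *m s) s.
  rewrite Ar As -scaleNr !innerDl !innerZl [inner s r]innerC /q.
  by move: (inner _ _) (inner _ _) (inner _ _) => x y z; ring.
have Ebe : be * q = inner (A *m s) r - inner (A *m r) s.
  rewrite Ar As -scaleNr !innerDl !innerZl [inner s r]innerC /q.
  by move: (inner _ _) (inner _ _) (inner _ _) => x y z; ring.
rewrite -(ler_pM2r q0) -[in X in _ /\ X](ler_pM2r q0) -[q in `|al| * q]gtr0_norm//.
rewrite -[q in `|be| * q]gtr0_norm// -!normrM Eal Ebe; split.
  rewrite (le_trans (ler_normD _ _))// (le_trans (lerD (bnd _ _ rq rq) (bnd _ _ sq sq)))//.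
  by rewrite -!mulrA [leRHS]mulrDl mul1r.
rewrite (le_trans (ler_normB _ _))// (le_trans (lerD (bnd _ _ sq rq) (bnd _ _ rq sq)))//.
by rewrite -!mulrA [leRHS]mulrDl mul1r.
Qed.

Lemma skew_formC N (J : 'M[R]_N) (x y : 'cV[R]_N) : J^T = - J ->
  (x^T *m J *m y) 0 0 = - (y^T *m J *m x) 0 0.
Proof.
move=> JT; have -> : (x^T *m J *m y) 0 0 = (x^T *m J *m y)^T 0 0 by rewrite [RHS]mxE.
by rewrite !trmx_mul trmxK JT mulNmx mulmxN mulmxA mxE.
Qed.

Lemma skew_form0 N (J : 'M[R]_N) (x : 'cV[R]_N) : J^T = - J -> (x^T *m J *m x) 0 0 = 0.
Proof.
move=> JT; have /eqP := skew_formC x x JT.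
by rewrite -addr_eq0 -mulr2n mulrn_eq0 /= => /eqP.
Qed.

(** Gram-Schmidt applied to w and A w. The form A^T J A - J on the plane is
    computed on w, A w from A^2 w = 2 al A w - |mu|^2 w: the value of J on A
    w, A^2 w is |mu|^2 times that on w, A w. Normalizing keeps the basis
    from degenerating when mu tends to the real axis. *)
Lemma plane_basis N (A J : 'M[R]_N) (al be : R) : J^T = - J -> be != 0 ->
  eigenvalue (to_C A) (Complex al be) ->
  exists a b : 'cV[R]_N, [/\ `|a| = 1, `|b| = 1, inner a b = 0 &
   [/\ A *m (A *m a) = (2 * al) *: (A *m a) - (al ^+ 2 + be ^+ 2) *: a,
    A *m (A *m b) = (2 * al) *: (A *m b) - (al ^+ 2 + be ^+ 2) *: b &
    (a^T *m (A^T *m J *m A - J) *m b) 0 0 =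
      (al ^+ 2 + be ^+ 2 - 1) * (a^T *m J *m b) 0 0]].
Proof.
move=> JT be0 /real_eigenpair[r [s [Ar As rs0]]].
set rho := al ^+ 2 + be ^+ 2.
have lin (B : 'M[R]_N) (c d : R) (x y : 'cV[R]_N) :
    B *m (c *: x + d *: y) = c *: (B *m x) + d *: (B *m y).
  by rewrite mulmxDr -!scalemxAr.
have Ar2 : A *m (A *m r) = (2 * al) *: (A *m r) - rho *: r.
  rewrite {1}Ar -scaleNr lin Ar As; apply/colP => i; rewrite !mxE /rho.
  by move: (r i 0) (s i 0) => x y; ring.
have As2 : A *m (A *m s) = (2 * al) *: (A *m s) - rho *: s.
  rewrite {1}As lin Ar As; apply/colP => i; rewrite !mxE /rho.
  by move: (r i 0) (s i 0) => x y; ring.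
have [w w0 Aw] : exists2 w : 'cV[R]_N, w != 0 & A *m (A *m w) = (2 * al) *: (A *m w) - rho *: w.
  by case/orP: rs0 => ?; [exists r|exists s].
have ww : 0 < inner w w.
  by rewrite (lt_le_trans _ (sqr_norm_le_inner w))// exprn_gt0// normr_gt0.
pose c := inner w (A *m w) / inner w w; pose b := A *m w - c *: w.
have Ab : A *m b = (2 * al - c) *: (A *m w) - rho *: w.
  rewrite /b mulmxBr -scalemxAr Aw; apply/colP => i; rewrite !mxE.
  by move: (\sum_(_ | _) _) (w i 0) => x y; ring.
have b0 : b != 0.
  apply/eqP => bE; have AwE : A *m w = c *: w by apply/eqP; rewrite -subr_eq0 -/b bE.
  move: Aw; rewrite AwE -scalemxAr AwE !scalerA -scalerBl => /eqP.
  rewrite -subr_eq0 -scalerBl scaler_eq0 (negPf w0) orbF => /eqP.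
  rewrite (_ : _ - _ = (c - al) ^+ 2 + be ^+ 2); last by rewrite /rho; ring.
  by move/eqP; rewrite paddr_eq0 ?sqr_ge0// !sqrf_eq0 (negPf be0) andbF.
have wb : inner w b = 0.
  rewrite /b /inner mulmxBr -scalemxAr mxE [X in _ + X]mxE [X in _ - X]mxE.
  by rewrite -[(w^T *m (A *m w)) 0 0]/(inner w (A *m w)) -[(w^T *m w) 0 0]/(inner w w)
    /c divfK ?subrr// gt_eqF.
have nw : 0 < `|w| by rewrite normr_gt0.
have nb : 0 < `|b| by rewrite normr_gt0.
have form : (w^T *m (A^T *m J *m A - J) *m b) 0 0 = (rho - 1) * (w^T *m J *m b) 0 0.
  have Bd (x : 'cV[R]_N) (d e : R) (y y' : 'cV[R]_N) : (x^T *m J *m (d *: y - e *: y')) 0 0 =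
      d * (x^T *m J *m y) 0 0 - e * (x^T *m J *m y') 0 0.
    rewrite mulmxBr -!scalemxAr; move: (x^T *m J *m y) (x^T *m J *m y') => u v.
    by rewrite !mxE.
  have -> : (w^T *m (A^T *m J *m A - J) *m b) 0 0 =
      ((A *m w)^T *m J *m (A *m b)) 0 0 - (w^T *m J *m b) 0 0.
    rewrite [_ *m (_ - J)]mulmxBr mulmxBl trmx_mul !mulmxA; move: (_ *m b) (_ *m b) => u v.
    by rewrite !mxE.
  rewrite Ab Bd /b -[A *m w]scale1r Bd !scale1r !skew_form0// [in LHS]skew_formC//.
  by move: (_ 0 0) => k; ring.
exists (`|w|^-1 *: w), (`|b|^-1 *: b); split.
- by rewrite normrZ gtr0_norm ?invr_gt0// mulVf// gt_eqF.
- by rewrite normrZ gtr0_norm ?invr_gt0// mulVf// gt_eqF.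
- have scI (x y : R) (u v : 'cV[R]_N) : inner (x *: u) (y *: v) = y * (x * inner u v).
    rewrite /inner -scalemxAr [(_ *: _)^T]linearZ /= -scalemxAl.
    by move: (_ *m v) => k; rewrite !mxE.
  by rewrite scI wb !mulr0.
split.
- rewrite -!scalemxAr Aw scalerBr !scalerA; congr (_ *: _ - _ *: _); exact: mulrC.
- rewrite -!scalemxAr.
  have -> : A *m (A *m b) = (2 * al) *: (A *m b) - rho *: b.
    rewrite Ab /b mulmxBr -!scalemxAr Aw; apply/colP => i; rewrite !mxE.
    by move: (\sum_(_ | _) _) (w i 0) => x y; ring.
  rewrite scalerBr !scalerA; congr (_ *: _ - _ *: _); exact: mulrC.
have sc (M : 'M[R]_N) (x y : R) : ((x *: w)^T *m M *m (y *: b)) 0 0 =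
    x * y * (w^T *m M *m b) 0 0.
  rewrite -scalemxAr [(_ *: _)^T]linearZ /= -!scalemxAl.
  by move: (_ *m b) => k; rewrite !mxE mulrCA mulrA.
by rewrite !sc form; ring.
Qed.

End PlaneBasis.

Section Multipliers.
Variables (R : realType) (N : nat).
Variables (Pi J L0 : 'M[R]_N) (p g row0 : 'rV[R]_N) (u1 : 'cV[R]_N) (kappa C : R).
Variables (A : R -> 'M[R]_N) (Gx : R -> 'rV[R]_N).
Hypothesis JT : J^T = - J.
Hypothesis hA : \forall e \near 0^'+, `|A e - Pi| <= C * e.
Hypothesis hG : \forall e \near 0^'+, `|Gx e - g| <= C * e.
Hypothesis hL : forall eta : R, 0 < eta -> \forall e \near 0^'+,
  `|(A e)^T *m J *m A e - J - e *: L0| <= eta * e.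
Hypothesis hrow : forall eta : R, 0 < eta -> \forall e \near 0^'+,
  `|Gx e *m A e - Gx e - e *: row0| <= eta * e.
Hypothesis hp : p *m Pi = p + kappa *: g.
Hypothesis hpu : (p *m u1) 0 0 = -1.
Hypothesis hfix : forall v : 'cV[R]_N, Pi *m v = v -> exists s : R, v = s *: u1.
Hypothesis hdM : 0 < kappa * (row0 *m u1) 0 0.
Hypothesis hreal : forall al : R, eigenvalue (to_C Pi) (Complex al 0) -> al = 1.
Hypothesis hplane : forall al be : R, eigenvalue (to_C Pi) (Complex al be) ->
  exists (RV : 'M[R]_(N, 1.*2)) (B : 'M[R]_(1.*2)),
   [/\ strongly_invariant Pi RV B, eigenvalue (to_C B) (Complex al be),
       eigenvalue (to_C B) (Complex al (- be)) &
       (RV^T *m L0 *m RV) 0 1 / (RV^T *m J *m RV) 0 1 < 0].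

Lemma near0_scaled m n (f : R -> 'M[R]_(m, n)) (l : 'M[R]_(m, n)) :
  (forall eta : R, 0 < eta -> \forall e \near 0^'+, `|f e - e *: l| <= eta * e) ->
  (e^-1 *: f e) @[e --> 0^'+] --> l.
Proof.
move=> H; apply/(@cvgrPdist_le _ _ _ 0^'+) => eta eta0; near=> e.
have e0 : 0 < e by near: e; exact: nbhs_right_gt.
have He : `|f e - e *: l| <= eta * e by near: e; exact: H.
rewrite -(ler_pM2r e0) (le_trans _ He)// distrC mulrC -{1}(gtr0_norm e0) -normrZ.
by rewrite scalerBr scalerA divff ?gt_eqF// scale1r.
Unshelve. all: by end_near. Qed.

Lemma near0_bigO m n (f : R -> 'M[R]_(m, n)) (l : 'M[R]_(m, n)) (K : R) :
  (\forall e \near 0^'+, `|f e - l| <= K * e) -> f @ 0^'+ --> l.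
Proof.
move=> H; apply/(@cvgrPdist_lt _ _ _ 0^'+) => eta eta0; near=> e.
rewrite distrC (@le_lt_trans _ _ (K * e))//; first by near: e.
by near: e; exact: mul_small.
Unshelve. all: by end_near. Qed.

Section Along.
Variable F : set_system R.
Context {FU : UltraFilter F}.
Hypothesis sF : (0 : R)^'+ `<=` F.

Let PF : ProperFilter F. Proof. exact: ultra_proper. Qed.

Let cA : A @ F --> Pi.
Proof. by have := near0_bigO hA; apply: cvg_trans => B HB; exact: sF. Qed.

Let cL : (e^-1 *: ((A e)^T *m J *m A e - J)) @[e --> F] --> L0.
Proof. by have := near0_scaled hL; apply: cvg_trans => B HB; exact: sF. Qed.

Let crow : (e^-1 *: (Gx e *m A e - Gx e)) @[e --> F] --> row0.
Proof. by have := near0_scaled hrow; apply: cvg_trans => B HB; exact: sF. Qed.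

Let boundA : \forall e \near F, `|A e| <= `|Pi| + 1.
Proof.
have h1 : \forall e \near F, `|Pi - A e| < 1.
  by move/(@cvgrPdist_lt _ _ _ F _): cA; apply.
apply: filterS h1 => e h.
rewrite -(subrK Pi (A e)) (le_trans (ler_normD _ _))// addrC lerD2l distrC.
exact: ltW.
Qed.

Let limit_relation (al rho : R -> R) (w : R -> 'cV[R]_N) (al1 rho1 : R) w1 :
  (\forall e \near F, A e *m (A e *m w e) = (2 * al e) *: (A e *m w e) - rho e *: w e) ->
  al @ F --> al1 -> rho @ F --> rho1 -> w @ F --> w1 ->
  Pi *m (Pi *m w1) = (2 * al1) *: (Pi *m w1) - rho1 *: w1.
Proof.
move=> H cal crho cw.
have cAw : (fun e => A e *m w e) @ F --> Pi *m w1 by exact: cvg_mulmx cA cw.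
have c1 : (fun e => A e *m (A e *m w e)) @ F --> Pi *m (Pi *m w1).
  exact: cvg_mulmx cA cAw.
have c2 : (fun e => (2 * al e) *: (A e *m w e) - rho e *: w e) @ F -->
    (2 * al1) *: (Pi *m w1) - rho1 *: w1.
  have c0 : (fun e => 2 * al e) @ F --> 2 * al1 by apply: cvgMl_tmp; exact: cal.
  exact: (cvgB (cvgZ c0 cAw) (cvgZ crho cw)).
have c3 : (fun e => A e *m (A e *m w e)) @ F --> (2 * al1) *: (Pi *m w1) - rho1 *: w1.
  apply: cvg_trans c2; by apply: near_eq_cvg; apply: filterS H => e ->.
exact: (@cvg_unique _ (@norm_hausdorff _ _) _ _ _ _ c1 c3).
Qed.

Let cvg00 (f : R -> 'M[R]_1) (l : 'M[R]_1) : f @ F --> l -> (fun e => f e 0 0) @ F --> l 0 0.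
Proof. by move=> fl; exact: ((cvg_mxP (F := F) _ _).1 fl 0 0). Qed.

Let norm1_cvg (w : R -> 'cV[R]_N) : (\forall e \near F, `|w e| = 1) ->
  exists2 w1 : 'cV[R]_N, w @ F --> w1 & `|w1| = 1.
Proof.
move=> wn; have [|w1 cw] := @ultra_bounded_cvg_mx _ _ F _ _ _ w 1.
  by apply: filterS wn => e ->.
exists w1 => //; have c1 : (fun e => `|w e|) @ F --> (`|w1| : R) by exact: cvg_norm.
have c2 : (fun e => `|w e|) @ F --> (1 : R).
  apply: cvg_trans (@cvg_cst _ (1 : R) _ F _); apply: near_eq_cvg.
  by apply: filterS wn => e ->.
exact: (@cvg_unique _ (@norm_hausdorff _ _) _ _ _ _ c1 c2).
Qed.

(** The bounded quantity Q collects the O(e) terms of nu p v = m T'(h)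
    DH(xi)^T v + O(e), divided by e; as nu -> 0 its contribution nu Q
    disappears in the limit. *)
Lemma no_real_multiplier :
  ~ (\forall e \near F, exists al : R, eigenvalue (to_C (A e)) (Complex al 0)).
Proof.
move=> Hev.
have /choice[q Hq] : forall e, exists q : R * 'cV[R]_N,
    (exists al : R, eigenvalue (to_C (A e)) (Complex al 0)) ->
    [/\ eigenvalue (to_C (A e)) (Complex q.1 0), `|q.2| = 1 & A e *m q.2 = q.1 *: q.2].
  move=> e; have [[al ev]|nev] := pselect (exists al : R, eigenvalue (to_C (A e)) (Complex al 0)).
    have [v v0 Av] := real_eigenvector ev.
    exists (al, `|v|^-1 *: v) => _ /=; split=> //.
      by rewrite normrZ normfV normr_id mulVf// normr_eq0.
    by rewrite -scalemxAr Av scalerA mulrC -scalerA.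
  by exists (0, 0).
pose al e := (q e).1; pose v e := (q e).2.
have H : \forall e \near F, [/\ eigenvalue (to_C (A e)) (Complex (al e) 0), `|v e| = 1 &
    A e *m v e = al e *: v e] by apply: filterS Hev => e; exact: Hq.
have [v1 cv v1n] : exists2 v1, v @ F --> v1 & `|v1| = 1.
  by apply: norm1_cvg; apply: filterS H => e [].
have [|al1 cal] := @ultra_bounded_cvg _ _ F _ al (2 * (N%:R * N%:R) * (`|Pi| + 1)).
  apply: filterS2 H boundA => e [ev _ _] bA.
  have [h _] := eigenvalue_bound ev; rewrite (le_trans h)// ler_wpM2l// !mulr_ge0//.
have v10 : v1 != 0 by rewrite -normr_eq0 v1n oner_neq0.
have cAv : (fun e => A e *m v e) @ F --> Pi *m v1 by exact: cvg_mulmx cA cv.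
have Piv : Pi *m v1 = al1 *: v1.
  have c2 : (fun e => A e *m v e) @ F --> al1 *: v1.
    apply: cvg_trans (cvgZ cal cv); apply: near_eq_cvg.
    by apply: filterS H => e [_ _ ->].
  exact: (@cvg_unique _ (@norm_hausdorff _ _) _ _ _ _ cAv c2).
have al11 : al1 = 1.
  apply: hreal.
  have [|be' [/eqP]] := @quadratic_eigenvalue _ _ Pi al1 0 v1 v10.
    rewrite Piv -scalemxAr Piv !scalerA -scalerBl; congr (_ *: _).
    by ring.
  by rewrite expr0n /= sqrf_eq0 => /eqP ->.
rewrite al11 scale1r in Piv; rewrite al11 in cal.
have [s sE] := hfix Piv.
have s0 : s != 0 by apply: contraNneq v10 => s0; rewrite sE s0 scale0r.
pose Q (e : R) : 'M[R]_1 := e^-1 *: (kappa *: ((g - Gx e) *m v e) + p *m (A e - Pi) *m v e).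
pose K := `|kappa| * (N%:R * C) + N%:R * (N%:R * `|p| * C).
have [|Q1 cQ] := @ultra_bounded_cvg_mx _ _ F _ _ _ Q K.
  have F0 : \forall e \near F, 0 < e by apply: sF; exact: nbhs_right_gt.
  near=> e.
  have e0 : 0 < e by near: e.
  have vn : `|v e| = 1 by near: e; apply: filterS H => e [].
  have a1 : `|A e - Pi| <= C * e by near: e; exact: sF.
  have a2 : `|Gx e - g| <= C * e by near: e; exact: sF.
  rewrite /Q normrZ ger0_norm ?invr_ge0 ?(ltW e0)// mulrC ler_pdivrMr//.
  rewrite (le_trans (ler_normD _ _))// /K mulrDl lerD//.
    rewrite normrZ -mulrA ler_wpM2l// (le_trans (ler_norm_mulmx _ _))// vn mulr1.
    by rewrite -mulrA ler_wpM2l// distrC.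
  rewrite (le_trans (ler_norm_mulmx _ _))// vn mulr1 -[leRHS]mulrA ler_wpM2l//.
  by rewrite (le_trans (ler_norm_mulmx _ _))// -[leRHS]mulrA ler_wpM2l// mulr_ge0.
have cnu : (fun e => al e - 1) @ F --> (0 : R).
  by rewrite -[0](subrr (1 : R)); apply: cvgB cal _; exact: cvg_cst.
pose rw e := e^-1 *: (Gx e *m A e - Gx e).
have cpv : (fun e => (p *m v e) 0 0) @ F --> (p *m v1) 0 0.
  by apply: cvg00; apply: cvg_mulmx cv; exact: cvg_cst.
have crv : (fun e => (rw e *m v e) 0 0) @ F --> (row0 *m v1) 0 0.
  by apply: cvg00; exact: cvg_mulmx crow cv.
have cQ0 : (fun e => Q e 0 0) @ F --> Q1 0 0 by exact: cvg00.
have ctot : (fun e => (kappa * (rw e *m v e) 0 0 + (al e - 1) * Q e 0 0) * (p *m v e) 0 0) @ F -->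
    (kappa * (row0 *m v1) 0 0 + 0 * Q1 0 0) * (p *m v1) 0 0.
  apply: cvgM cpv; apply: cvgD; last exact: cvgM.
  exact: cvgMl_tmp.
have : 0 <= (kappa * (row0 *m v1) 0 0 + 0 * Q1 0 0) * (p *m v1) 0 0.
  apply: (cvgr_to_ge ctot).
  have F0 : \forall e \near F, 0 < e by apply: sF; exact: nbhs_right_gt.
  apply: filterS2 H F0 => e [_ _ Av] e0.
  have h1 : (al e - 1) * (Gx e *m v e) 0 0 = e * (rw e *m v e) 0 0.
    rewrite /rw -scalemxAl mulmxBl -mulmxA Av -scalemxAr.
    move: (Gx e *m v e) => k; rewrite !mxE mulrA divff ?gt_eqF//; ring.
  have h2 : (al e - 1) * (p *m v e) 0 0 = kappa * (Gx e *m v e) 0 0 + e * Q e 0 0.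
    have -> : e * Q e 0 0 = (kappa *: ((g - Gx e) *m v e) + p *m (A e - Pi) *m v e) 0 0.
      rewrite /Q; move: (kappa *: _ + _) => k.
      by rewrite mxE mulrA divff ?mul1r// gt_eqF.
    rewrite [p *m (A e - Pi)]mulmxBr !mulmxBl -mulmxA Av -scalemxAr hp mulmxDl -scalemxAl.
    move: (p *m v e) (g *m v e) (Gx e *m v e) => a b c; rewrite !mxE; ring.
  (* nu^2 (p v) = e (kappa k v + nu Q) *)
  have h3 : (al e - 1) ^+ 2 * (p *m v e) 0 0 =
      e * (kappa * (rw e *m v e) 0 0 + (al e - 1) * Q e 0 0).
    rewrite expr2 -mulrA h2 mulrDr mulrCA h1.
    by move: (al e - 1) ((rw e *m v e) 0 0) (Q e 0 0) => x y z; ring.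
  rewrite -(pmulr_rge0 _ e0) mulrA -h3.
  by rewrite -mulrA -expr2 mulr_ge0// sqr_ge0.
rewrite mul0r addr0 sE -!scalemxAr [(s *: (row0 *m u1)) 0 0]mxE [(s *: (p *m u1)) 0 0]mxE hpu.
rewrite (_ : _ * _ = - (s ^+ 2 * (kappa * (row0 *m u1) 0 0))); last first.
  by move: ((row0 *m u1) 0 0) => k; ring.
by rewrite oppr_ge0 leNgt pmulr_rgt0 ?hdM// exprn_even_gt0.
Unshelve. all: by end_near. Qed.

(** The limits a1, b1 of an orthonormal basis stay independent, so the
    determinant d of their coordinates in RV is nonzero, and L(a1,b1)
    J(a1,b1) = d^2 times the product of two numbers of opposite signs. *)
Lemma no_complex_multiplier :
  ~ (\forall e \near F, exists al be : R, [/\ be != 0, 1 <= al ^+ 2 + be ^+ 2 &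
      eigenvalue (to_C (A e)) (Complex al be)]).
Proof.
pose bad e (al be : R) := [/\ be != 0, 1 <= al ^+ 2 + be ^+ 2 &
      eigenvalue (to_C (A e)) (Complex al be)].
pose good e (al be : R) (a b : 'cV[R]_N) := [/\ `|a| = 1, `|b| = 1, inner a b = 0 &
   [/\ A e *m (A e *m a) = (2 * al) *: (A e *m a) - (al ^+ 2 + be ^+ 2) *: a,
    A e *m (A e *m b) = (2 * al) *: (A e *m b) - (al ^+ 2 + be ^+ 2) *: b &
    (a^T *m ((A e)^T *m J *m A e - J) *m b) 0 0 =
      (al ^+ 2 + be ^+ 2 - 1) * (a^T *m J *m b) 0 0]].
move=> Hev.
have /choice[q Hq] : forall e, exists q : (R * R) * ('cV[R]_N * 'cV[R]_N),
    (exists al be, bad e al be) ->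
    bad e q.1.1 q.1.2 /\ good e q.1.1 q.1.2 q.2.1 q.2.2.
  move=> e; have [[al [be Hb]]|nev] := pselect (exists al be, bad e al be).
    have [be0 _ ev] := Hb; have [a [b ab]] := plane_basis JT be0 ev.
    by exists ((al, be), (a, b)).
  by exists ((0, 0), (0, 0)).
pose al e := (q e).1.1; pose be e := (q e).1.2.
pose a e := (q e).2.1; pose b e := (q e).2.2.
have H : \forall e \near F, bad e (al e) (be e) /\ good e (al e) (be e) (a e) (b e).
  by apply: filterS Hev => e; exact: Hq.
have bound e : bad e (al e) (be e) -> `|A e| <= `|Pi| + 1 ->
    `|al e| <= 2 * (N%:R * N%:R) * (`|Pi| + 1) /\ `|be e| <= 2 * (N%:R * N%:R) * (`|Pi| + 1).
  move=> [_ _ ev] bA; have [h1 h2] := eigenvalue_bound ev.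
  by split; [rewrite (le_trans h1)|rewrite (le_trans h2)]; rewrite // ler_wpM2l// !mulr_ge0.
have [|al1 cal] := @ultra_bounded_cvg _ _ F _ al (2 * (N%:R * N%:R) * (`|Pi| + 1)).
  by apply: filterS2 H boundA => e [hb _] bA; have [] := bound e hb bA.
have [|be1 cbe] := @ultra_bounded_cvg _ _ F _ be (2 * (N%:R * N%:R) * (`|Pi| + 1)).
  by apply: filterS2 H boundA => e [hb _] bA; have [] := bound e hb bA.
have [a1 ca a1n] : exists2 a1, a @ F --> a1 & `|a1| = 1.
  by apply: norm1_cvg; apply: filterS H => e [_ []].
have [b1 cb b1n] : exists2 b1, b @ F --> b1 & `|b1| = 1.
  by apply: norm1_cvg; apply: filterS H => e [_ []].
have a10 : a1 != 0 by rewrite -normr_eq0 a1n oner_neq0.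
have b10 : b1 != 0 by rewrite -normr_eq0 b1n oner_neq0.
have crho : (fun e => al e ^+ 2 + be e ^+ 2) @ F --> al1 ^+ 2 + be1 ^+ 2.
  by apply: cvgD; rewrite expr2; under eq_fun do rewrite expr2; exact: cvgM.
have ra : Pi *m (Pi *m a1) = (2 * al1) *: (Pi *m a1) - (al1 ^+ 2 + be1 ^+ 2) *: a1.
  by apply: (limit_relation _ cal crho ca); apply: filterS H => e [_ [_ _ _ []]].
have rb : Pi *m (Pi *m b1) = (2 * al1) *: (Pi *m b1) - (al1 ^+ 2 + be1 ^+ 2) *: b1.
  by apply: (limit_relation _ cal crho cb); apply: filterS H => e [_ [_ _ _ []]].
have ab1 : inner a1 b1 = 0.
  have c1 : (fun e => inner (a e) (b e)) @ F --> inner a1 b1.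
    by apply: cvg00; exact: cvg_mulmx (cvg_trmx ca) cb.
  have c2 : (fun e => inner (a e) (b e)) @ F --> (0 : R).
    apply: cvg_trans (@cvg_cst _ (0 : R) _ F _); apply: near_eq_cvg.
    by apply: filterS H => e [_ [_ _ -> _]].
  exact: (@cvg_unique _ (@norm_hausdorff _ _) _ _ _ _ c1 c2).
have [be' [be'E ev]] := quadratic_eigenvalue a10 ra.
have [RV [B [hRV ev1 ev2 neg]]] := hplane ev.
rewrite -be'E in ra rb.
have [xa aE] := strongly_invariant_span hRV ev1 ev2 ra.
have [xb bE] := strongly_invariant_span hRV ev1 ev2 rb.
have L0T : L0^T = - L0.
  pose D (e : R) := e^-1 *: ((A e)^T *m J *m A e - J).
  have c1 : (fun e => (D e)^T) @ F --> L0^T by exact: cvg_trmx cL.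
  have c2 : (fun e => - D e) @ F --> - L0 by exact: cvgN cL.
  have DT : (fun e => (D e)^T) = (fun e => - D e).
    apply/funext => e; rewrite /D linearZ /= linearB /= !trmx_mul trmxK JT mulNmx mulmxN mulmxA.
    by rewrite -[RHS]scalerN opprB opprK addrC.
  rewrite DT in c1.
  exact: (@cvg_unique _ (@norm_hausdorff _ _) _ _ _ _ c1 c2).
pose L e := e^-1 *: ((A e)^T *m J *m A e - J).
have cJ : (fun e => ((a e)^T *m J *m b e) 0 0) @ F --> (a1^T *m J *m b1) 0 0.
  apply: cvg00; apply: cvg_mulmx cb; apply: cvg_mulmx (cvg_trmx ca) _; exact: cvg_cst.
have cLab : (fun e => ((a e)^T *m L e *m b e) 0 0) @ F --> (a1^T *m L0 *m b1) 0 0.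
  by apply: cvg00; apply: cvg_mulmx cb; exact: cvg_mulmx (cvg_trmx ca) cL.
have ge0 : 0 <= (a1^T *m L0 *m b1) 0 0 * (a1^T *m J *m b1) 0 0.
  apply: (cvgr_to_ge (cvgM cLab cJ)).
  have F0 : \forall e \near F, 0 < e by apply: sF; exact: nbhs_right_gt.
  apply: filterS2 H F0 => e [[_ rho1 _] [_ _ _ [_ _ form]]] e0 /=.
  have -> : ((a e)^T *m L e *m b e) 0 0 =
      e^-1 * ((a e)^T *m ((A e)^T *m J *m A e - J) *m b e) 0 0.
    by rewrite /L -scalemxAr -scalemxAl; move: (_ *m b e) => k; rewrite mxE.
  rewrite form -!mulrA -expr2.
  apply: mulr_ge0; first by rewrite invr_ge0 ltW.
  by apply: mulr_ge0; rewrite ?subr_ge0 ?sqr_ge0.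
pose d := xa 0 0 * xb 1 0 - xa 1 0 * xb 0 0.
have Z (M : 'M[R]_N) : M^T = - M ->
    (a1^T *m M *m b1) 0 0 = d * (RV^T *m M *m RV) 0 1.
  move=> MT.
  have -> : a1^T *m M *m b1 = xa^T *m (RV^T *m M *m RV) *m xb.
    by rewrite aE bE trmx_mul !mulmxA.
  by apply: skew2; rewrite !trmx_mul trmxK MT mulNmx mulmxN mulmxA.
rewrite (Z _ L0T) (Z _ JT) in ge0.
set l := (_ *m RV) 0 1 in neg ge0; set om := (_ *m RV) 0 1 in neg ge0.
have bb : 0 < inner b1 b1.
  by rewrite (lt_le_trans _ (sqr_norm_le_inner b1))// b1n expr1n.
have d0 : d != 0.
  apply/eqP => d0.
  (* a vanishing determinant makes the coordinates, hence a1 and b1,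
     proportional *)
  have dep2 (i j : 'I_(1.*2)) : xa i 0 * xb j 0 = xb i 0 * xa j 0.
    have two (k : 'I_(1.*2)) : k = 0 \/ k = 1.
      by case: k => [[|[|//]] ?]; [left|right]; exact: val_inj.
    move/eqP: d0; rewrite subr_eq0 => /eqP d0.
    have [->|->] := two i; have [->|->] := two j;
      first [exact: mulrC | by rewrite d0 mulrC | by rewrite -d0 mulrC].
  have dep (i : 'I_(1.*2)) : xa i 0 *: b1 = xb i 0 *: a1.
    rewrite aE bE !scalemxAr; congr (_ *m _); apply/colP => j; rewrite !mxE.
    exact: dep2.
  have xa0 (i : 'I_(1.*2)) : xa i 0 = 0.
    have : inner b1 (xa i 0 *: b1) = 0.
      by rewrite dep /inner -scalemxAr mxE -[_ 0 0]/(inner b1 a1) innerC ab1 mulr0.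
    rewrite /inner -scalemxAr mxE -[_ 0 0]/(inner b1 b1) => /eqP.
    by rewrite mulf_eq0 (gt_eqF bb) orbF => /eqP.
  move/eqP: a10; apply; rewrite aE (_ : xa = 0) ?mulmx0//.
  by apply/colP => i; rewrite xa0 mxE.
have om0 : om != 0 by apply: contraTneq neg => ->; rewrite invr0 mulr0 ltxx.
have : 0 <= d ^+ 2 * om ^+ 2 * (l / om).
  rewrite (_ : _ * _ = d * l * (d * om)) ?ge0//.
  by move: (l) (om) om0 => x y y0; field.
by rewrite leNgt pmulr_rlt0 ?neg// mulr_gt0// exprn_even_gt0.
Qed.

End Along.

(** An ultrafilter of parameters with a multiplier outside the open disk
    decides whether that multiplier is real. *)
Lemma multipliers_in_disk :
  \forall e \near 0^'+, forall a : R[i], eigenvalue (to_C (A e)) a -> `|a| < 1.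
Proof.
pose bad : set R := [set e | exists al be : R, 1 <= al ^+ 2 + be ^+ 2 /\
   eigenvalue (to_C (A e)) (Complex al be)].
suff : \forall e \near 0^'+, ~ bad e.
  apply: filterS => e nb [al be] ev; rewrite norm_complex -[1]/(real_complex R 1) ltcR.
  rewrite ltNge; apply/negP => /= h; apply: nb; exists al, be; split=> //.
  by rewrite -(sqr_sqrtr (addr_ge0 (sqr_ge0 al) (sqr_ge0 be))) exprn_ege1.
apply: contrapT => nb.
have PW : ProperFilter (within bad (0 : R)^'+).
  split; last exact: within_filter.
  by move=> H; apply: nb; move: H; rewrite /within /=; apply: filterS => e; exact.
have [F [FU sF]] := ultraFilterLemma PW.
have sF0 : (0 : R)^'+ `<=` F.
  by move=> B HB; apply: sF; rewrite /within /=; apply: filterS HB.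
have Fbad : F bad by apply: sF; rewrite /within /=; exact: nearW.
have PF : ProperFilter F by exact: ultra_proper.
have [H|H] := in_ultra_setVsetC [set e | exists al : R, eigenvalue (to_C (A e)) (Complex al 0)] FU.
  exact: (no_real_multiplier sF0 H).
apply: (no_complex_multiplier sF0); apply: filterS2 Fbad H => e [al [be [h ev]]] nr.
exists al, be; split=> //; apply/eqP => be0; apply: nr; exists al.
by rewrite -be0.
Qed.

End Multipliers.

(** * Asymptotic stability of the perturbed orbit *)

Section SpectralHypotheses.
Variable R : realType.

(** The complex line of fixed row vectors is spanned by the real vector u;
    the coefficient of a real fixed vector is its real part. *)
Lemma simple_fixed_line N (Pi : 'M[R]_N) (u : 'cV[R]_N) :
  geo_mult Pi 1 = 1%N -> u != 0 -> Pi *m u = u ->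
  forall v : 'cV[R]_N, Pi *m v = v -> exists s : R, v = s *: u.
Proof.
move=> hgeo u0 Piu v Piv.
pose c (w : 'cV[R]_N) : 'rV[R[i]]_N := (map_mx (real_complex R) w)^T.
have inE w : Pi *m w = w -> (c w <= eigenspace (to_C Pi)^T 1)%MS.
  move=> Piw; apply/eigenspaceP; rewrite scale1r /c -trmx_mul.
  by rewrite -[to_C Pi *m _](to_C_mul Pi w) Piw.
have cu0 : c u != 0 by rewrite trmx_eq0 map_mx_eq0.
have /andP[_ le] : (c u == eigenspace (to_C Pi)^T 1)%MS.
  rewrite -(geq_leqif (mxrank_leqif_eq (inE u Piu))).
  by move: hgeo; rewrite /geo_mult => ->; rewrite lt0n mxrank_eq0.
have /sub_rVP[k vk] := submx_trans (inE v Piv) le.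
exists (complex.Re k); apply/colP => i.
have := congr1 (fun M : 'rV_N => complex.Re (M 0 i)) vk.
by rewrite !mxE; case: k {vk} => a b /=; rewrite mulr0 subr0.
Qed.

Lemma spectrum_cases N k (Pi : 'M[R]_N) (lam : 'I_k -> R[i]) (a : R[i]) :
  char_poly (to_C Pi) = ('X - 1%:P) ^+ 2 *
    \prod_(j < k) (('X - (lam j)%:P) * ('X - ((lam j)^*)%:P)) ->
  eigenvalue (to_C Pi) a -> a = 1 \/ exists j, a = lam j \/ a = (lam j)^*.
Proof.
move=> hspec; rewrite eigenvalue_root_char hspec rootM root_exp_XsubC.
move=> /orP[/eqP ->|]; first by left.
rewrite /root horner_prod prodf_seq_eq0 => /hasP[j _ /=]; rewrite hornerM !hornerXsubC.
rewrite mulf_eq0 !subr_eq0 => h; right; exists j.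
by case/orP: h => /eqP ->; [left|right].
Qed.

End SpectralHypotheses.

Section PerturbedStability.
Variables (R : realType) (n : nat) (sys : mech_system R n) (r0 : nat).
Hypothesis hr0 : (3 <= r0)%N.
Hypothesis hsys : standing_assumptions sys r0.
Local Notation V := 'cV[R]_(n + n).
Local Notation U := (dom sys).
Local Notation J := (sympJ R n).

Lemma pert_periodic (x : V) (t d e : R) (l : nat) : U x -> 0 < d -> 0 <= e ->
  pert sys x (t + l%:R * d) d e = pert sys x t d e.
Proof.
move=> Ux d0 e0; case: hsys => _ _ _ _ per.
elim: l t => [|l IH] t; first by rewrite mul0r addr0.
by rewrite -natr1 mulrDl mul1r addrA -[RHS]IH /pert per.
Qed.

(** The linear stability criterion for the perturbed system, whose field has
    period l delta in time. *)
Lemma periodic_orbit_stable (l : nat) (d e : R) (x : R -> V) (X : R -> 'M[R]_(n + n)) :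
  (0 < l)%N -> 0 < d -> 0 <= e ->
  perturbed_orbit sys d e x -> periodic x (l%:R * d) -> variational sys d e x X ->
  (forall a : R[i], eigenvalue (to_C (X (l%:R * d))) a -> `|a| < 1) ->
  asymptotically_stable U (field sys d e) x.
Proof.
move=> l0 d0 e0 hx px [X1 DX] mult.
have [f [fX [pE cf cfX Dp _]]] := pert_extension hr0 hsys.
pose DF (p : V * R) := J *m hess sys p.1 + e *: fX (p.1, p.2, d, e).
have slot (p : V * R) : (fun p : V * R => (p.1, p.2, d, e)) @ p --> (p.1, p.2, d, e).
  have a1 : (fun p : V * R => (p.1, p.2)) @ p --> (p.1, p.2).
    have b1 : (fun p : V * R => p.1) @ p --> p.1 by exact: cvg_fst.
    have b2 : (fun p : V * R => p.2) @ p --> p.2 by exact: cvg_snd.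
    exact: (cvg_pair b1 b2).
  have a2 : (fun p : V * R => (p.1, p.2, d)) @ p --> (p.1, p.2, d).
    exact: (cvg_pair a1 (@cvg_cst _ d _ (nbhs p) _)).
  exact: (cvg_pair a2 (@cvg_cst _ e _ (nbhs p) _)).
apply: (@floquet_stability R _ U (field sys d e) DF (l%:R * d) x X).
- exact: (dom_open hsys).
- move=> p Up v; have D1 := is_derive_mulmxl J (is_derive_grad hr0 hsys v Up).
  have D2 := is_deriveZ e (Dp _ p.2 _ _ Up d0 e0 v).
  rewrite /DF mulmxDl -mulmxA -scalemxAl; exact: is_deriveD D1 D2.
- move=> p Up.
  have c1 : (fun p : V * R => hess sys p.1) @ p --> hess sys p.1.
    have ch : hess sys @ p.1 --> hess sys p.1 by exact: (hess_continuous hr0 hsys Up).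
    exact: (cvg_comp fst (hess sys) cvg_fst ch).
  have c2 : (fun p : V * R => fX (p.1, p.2, d, e)) @ p --> fX (p.1, p.2, d, e).
    have ch : fX @ (p.1, p.2, d, e) --> fX (p.1, p.2, d, e) by exact: cfX.
    exact: (cvg_comp _ _ (slot p) ch).
  have c3 : (fun p : V * R => J *m hess sys p.1) @ p --> J *m hess sys p.1.
    exact: (cvg_mulmx (@cvg_cst _ J _ (nbhs p) _) c1).
  exact: (cvgD c3 (cvgZ (@cvg_cst _ e _ (nbhs p) _) c2)).
- move=> p Up.
  have c1 : (fun p : V * R => grad (ham sys) p.1) @ p --> grad (ham sys) p.1.
    have ch : grad (ham sys) @ p.1 --> grad (ham sys) p.1.
      exact: (grad_continuous hr0 hsys Up).
    exact: (cvg_comp fst (grad (ham sys)) cvg_fst ch).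
  have c2 : (fun p : V * R => f (p.1, p.2, d, e)) @ p --> f (p.1, p.2, d, e).
    have ch : f @ (p.1, p.2, d, e) --> f (p.1, p.2, d, e) by exact: cf.
    exact: (cvg_comp _ _ (slot p) ch).
  have c3 : (fun p : V * R => ham_field sys p.1) @ p --> ham_field sys p.1.
    exact: (cvg_mulmx (@cvg_cst _ J _ (nbhs p) _) c1).
  have c4 : (fun p : V * R => ham_field sys p.1 + e *: f (p.1, p.2, d, e)) @ p -->
      ham_field sys p.1 + e *: f (p.1, p.2, d, e).
    exact: (cvgD c3 (cvgZ (@cvg_cst _ e _ (nbhs p) _) c2)).
  have nU : \forall w \near p, U w.1.
    have nU : nbhs p.1 U by apply: open_nbhs_nbhs; split; [exact: (dom_open hsys)|].
    have c0 : (fun p : V * R => p.1) @ p --> p.1 by exact: cvg_fst.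
    exact: (c0 _ nU).
  change ((fun p : V * R => field sys d e p.1 p.2) @ p --> field sys d e p.1 p.2).
  rewrite /field (pE _ _ _ _ Up d0 e0).1.
  apply: cvg_trans c4; apply: near_eq_cvg; apply: filterS nU => w Uw.
  by rewrite (pE _ _ _ _ Uw d0 e0).1.
- by rewrite mulr_gt0// ltr0n.
- by move=> y t Uy; rewrite /field pert_periodic.
- by move=> t; exact: (hx t I).
- exact: px.
- exact: X1.
- move=> t; have [Ut _] := hx t I; have := DX t.
  by rewrite (jac_grad hr0 hsys Ut) (pE _ _ _ _ Ut d0 e0).2.
- exact: small_power.
Qed.

End PerturbedStability.

Theorem theorem4p3 (R : realType) (n : nat) (hn : (1 <= n)%N)
    (sys : mech_system R n) (r0 : nat) (hr0 : (3 <= r0)%N)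
    (hsys : standing_assumptions sys r0)
    (* the conservative orbit, with x0 t = x_0(t; z) and X0 t = X_0(t; z) *)
    (m l : nat) (hm : (0 < m)%N) (hl : (0 < l)%N) (hml : coprime m l)
    (tau : R) (z : 'cV[R]_(n + n)) (x0 : R -> 'cV[R]_(n + n))
    (hx0 : conservative_orbit sys x0) (hx0z : x0 0 = z)
    (htau : minimal_period x0 tau)
    (X0 : R -> 'M[R]_(n + n))
    (hX0 : variational sys (tau * m%:R / l%:R) 0 x0 X0)
    (Pi : 'M[R]_(n + n)) (hPi : Pi = X0 (m%:R * tau))
    (* (A.1) *)
    (hnormal : m_normal sys Pi z)
    (hM0 : melnikov sys m l tau x0 0 = 0)
    (hM1 : derive1 (melnikov sys m l tau x0) 0 != 0)
    (* (A.2) *)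
    (hcircle : forall a : R[i], eigenvalue (to_C Pi) a -> `|a| = 1)
    (* (A.3) *)
    (halg : alg_mult Pi 1 = 2%N) (hgeo : geo_mult Pi 1 = 1%N)
    (* the family F, its period function T and its parameter r *)
    (I : set R) (zeta : R -> 'cV[R]_(n + n)) (T : R -> R)
    (hF : energy_family sys z tau I zeta T)
    (r : 'cV[R]_(n + n) -> R -> R)
    (hr : set_inj I (fun c => r (zeta c) (m%:R * T c)))
    (* the perturbed orbit, with x e t = x(t; xi e, delta e, e) and
       X e t = X(t; xi e, delta e, e) *)
    (e0 : R) (he0 : 0 < e0)
    (xi : R -> 'cV[R]_(n + n)) (delta : R -> R)
    (x : R -> R -> 'cV[R]_(n + n)) (X : R -> R -> 'M[R]_(n + n))
    (hxi : Ck_on 1 `[0, e0[ xi) (hdelta : Ck_on 1 `[0, e0[ delta)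
    (hxiO : exists K : R, \forall e \near 0^'+, `|xi e - z| <= K * e)
    (hdeltaO : exists K : R,
      \forall e \near 0^'+, `|l%:R * delta e - m%:R * tau| <= K * e)
    (hx : forall e, 0 < e < e0 ->
      [/\ perturbed_orbit sys (delta e) e (x e), x e 0 = xi e,
          periodic (x e) (l%:R * delta e) &
          r (xi e) (l%:R * delta e) = r z (m%:R * tau)])
    (hX : forall e, 0 < e < e0 -> variational sys (delta e) e (x e) (X e))
    (* the eigenvalues of Pi other than +1 are n - 1 distinct conjugate pairs *)
    (lam : 'I_n.-1 -> R[i]) (hlam : injective lam)
    (hlamC : forall j k, lam j != (lam k)^*)
    (hspec : char_poly (to_C Pi) =
      ('X - 1%:P) ^+ 2 *
      \prod_(k < n.-1) (('X - (lam k)%:P) * ('X - ((lam k)^*)%:P)))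
    (* bases of the tangent space and of the subspaces N_k *)
    (RT : 'M[R]_(n + n, 1.*2)) (BT : 'M[R]_(1.*2))
    (hT : strongly_invariant Pi RT BT)
    (hT1 : forall a : R[i], eigenvalue (to_C BT) a <-> a = 1)
    (RN : 'I_n.-1 -> 'M[R]_(n + n, 1.*2)) (BN : 'I_n.-1 -> 'M[R]_(1.*2))
    (hN : forall k, strongly_invariant Pi (RN k) (BN k))
    (hNlam : forall k (a : R[i]),
      eigenvalue (to_C (BN k)) a <-> a = lam k \/ a = (lam k)^*)
    (* (i) and (ii) *)
    (hiM : 0 < derive1 T (ham sys z) * derive1 (melnikov sys m l tau x0) 0)
    (hiC : 0 < volume_contraction sys m l tau x0 X0 RT)
    (hii : forall k, 0 < volume_contraction sys m l tau x0 X0 (RN k)) :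
  \forall e \near 0^'+,
    (forall a : R[i], eigenvalue (to_C (X e (l%:R * delta e))) a -> `|a| < 1) /\
    asymptotically_stable (dom sys) (field sys (delta e) e) (x e).
Proof.
pose S := m%:R * tau; pose d0 := tau * m%:R / l%:R; pose Te e := l%:R * delta e.
have [tau0 ptau _] := htau.
have S0 : 0 < S by rewrite mulr_gt0// ltr0n.
have l0 : 0 < l%:R :> R by rewrite ltr0n.
have d00 : 0 < d0 by rewrite divr_gt0// mulr_gt0// ltr0n.
have ST1 : 0 < S < S + 1 by rewrite S0 ltrDl ltr01.
have [f [fX [pE cf cfX _ Dp]]] := pert_extension hr0 hsys.
have near_e : \forall e \near 0^'+, 0 < e < e0.
  near=> e; apply/andP; split; near: e; first exact: nbhs_right_gt.
  exact: nbhs_right_lt.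
have hx' : \forall e \near 0^'+, perturbed_orbit sys (delta e) e (x e).
  by apply: filterS near_e => e /hx[].
have hX' : \forall e \near 0^'+, variational sys (delta e) e (x e) (X e).
  by apply: filterS near_e => e /hX.
have hxO : exists K : R, \forall e \near 0^'+, `|x e 0 - x0 0| <= K * e.
  have [K HK] := hxiO; exists K; apply: filterS2 near_e HK => e /hx[_ -> _ _].
  by rewrite hx0z.
have hdO : exists K : R, \forall e \near 0^'+, `|delta e - d0| <= K * e.
  have [K HK] := hdeltaO; exists (K / l%:R); apply: filterS HK => e h.
  rewrite -(ler_pM2l l0) -{1}(gtr0_norm l0) -normrM mulrBr.
  rewrite /d0 [l%:R * (_ / _)]mulrC divfK ?gt_eqF// [tau * _]mulrC (le_trans h)//.
  by rewrite mulrCA mulrA divfK ?gt_eqF// mulrC.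
have hTO : exists K : R, \forall e \near 0^'+, `|Te e - S| <= K * e by exact: hdeltaO.
have dpos := delta_pos d00 hdO.
have Ux0 t : dom sys (x0 t) by have [] := hx0 t Logic.I.
have [Ls Ls0 DLs] : exists2 Ls : R -> 'M[R]_(n + n), Ls 0 = 0 & forall t : R,
    is_derive t (1 : R) Ls (sympl_drift fX (conservative_args x0 d0 t, X0 t)).
  apply: antiderivative_mx => t; apply: (drift_along_continuous hx0 hX0).
  exact: (sympl_drift_continuous cfX (Ux0 t) d00 (lexx 0)).
have [Lh Lh0 DLh] : exists2 Lh : R -> 'rV[R]_(n + n), Lh 0 = 0 & forall t : R,
    is_derive t (1 : R) Lh (energy_drift sys f fX (conservative_args x0 d0 t, X0 t)).
  apply: antiderivative_mx => t; apply: (drift_along_continuous hx0 hX0).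
  exact: (energy_drift_continuous hr0 hsys cf cfX (Ux0 t) d00 (lexx 0)).
have avg := averaging hr0 hsys pE cf cfX hx0 hX0 d00 ST1 hx' hX' hxO hdO hTO.
pose A e := X e (Te e); pose Gx e := (grad (ham sys) (xi e))^T.
have hL (eta : R) : 0 < eta -> \forall e \near 0^'+,
    `|(A e)^T *m sympJ R n *m A e - sympJ R n - e *: Ls S| <= eta * e.
  move=> eta0.
  have H : \forall e \near 0^'+, `|(A e)^T *m sympJ R n *m A e -
      (X e 0)^T *m sympJ R n *m X e 0 - e *: Ls S| <= eta * e.
    apply: (@avg _ _ (sympl_drift fX) Ls
      (fun e t => (X e t)^T *m sympJ R n *m X e t) _ Ls0 DLs _ eta eta0) => [t|].
      exact: (sympl_drift_continuous cfX (Ux0 t) d00 (lexx 0)).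
    near=> e => t _.
    have e0' : 0 < e by near: e; exact: nbhs_right_gt.
    have de : 0 < delta e by near: e.
    have Hx : perturbed_orbit sys (delta e) e (x e) by near: e.
    have HX : variational sys (delta e) e (x e) (X e) by near: e.
    have [Ut _] := Hx t Logic.I.
    have := sympl_identity hr0 hsys Ut HX.
    by rewrite (pE _ t _ _ Ut de (ltW e0')).2.
  apply: filterS2 hX' H => e [X1 _].
  by rewrite X1 trmx1 mul1mx mulmx1.
have hrow (eta : R) : 0 < eta -> \forall e \near 0^'+,
    `|Gx e *m A e - Gx e - e *: Lh S| <= eta * e.
  move=> eta0.
  have H : \forall e \near 0^'+, `|(grad (ham sys) (x e (Te e)))^T *m A e -
      (grad (ham sys) (x e 0))^T *m X e 0 - e *: Lh S| <= eta * e.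
    apply: (@avg _ _ (energy_drift sys f fX) Lh
      (fun e t => (grad (ham sys) (x e t))^T *m X e t) _ Lh0 DLh _ eta eta0) => [t|].
      exact: (energy_drift_continuous hr0 hsys cf cfX (Ux0 t) d00 (lexx 0)).
    near=> e => t _.
    have e0' : 0 < e by near: e; exact: nbhs_right_gt.
    have de : 0 < delta e by near: e.
    have Hx : perturbed_orbit sys (delta e) e (x e) by near: e.
    have HX : variational sys (delta e) e (x e) (X e) by near: e.
    have [Ut Dt] := Hx t Logic.I.
    have := energy_identity hr0 hsys Ut Dt HX.
    by rewrite (pE _ t _ _ Ut de (ltW e0')).1 (pE _ t _ _ Ut de (ltW e0')).2.
  apply: filterS2 near_e H => e ee.
  have [_ x0e pe _] := hx e ee; have [X1 _] := hX e ee.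
  by rewrite -[Te e]add0r pe X1 mulmx1 x0e.
have Uz : dom sys z by rewrite -hx0z.
have [CA HCA] := endpoint_close hr0 hsys pE cf cfX hx0 hX0 d00 ST1 hx' hX' hxO hdO hTO.
have [CG HCG] : exists CG : R, \forall e \near 0^'+,
    `|Gx e - (grad (ham sys) z)^T| <= CG * e.
  have cK : compact [set z] by exact: compact_set1.
  have KU : [set z] `<=` dom sys by move=> _ ->.
  have [rho [L [rho0 L0 HLip]]] := grad_lipschitz hr0 hsys cK KU.
  have [K HK] := hxiO; exists (L * K); near=> e.
  have h1 : `|xi e - z| <= K * e by near: e.
  have h2 : K * e < rho by near: e; exact: mul_small.
  have [_ h3 _] := HLip z (xi e) erefl (le_lt_trans h1 h2).
  by rewrite -linearB /= mx_norm_trmx (le_trans h3)// -mulrA ler_wpM2l// ltW.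
pose C := Num.max CA CG.
have hA : \forall e \near 0^'+, `|A e - Pi| <= C * e.
  near=> e; have e0' : 0 < e by near: e; exact: nbhs_right_gt.
  rewrite (@le_trans _ _ (CA * e))//; first by rewrite hPi; near: e.
  by rewrite ler_wpM2r ?(ltW e0')// le_max lexx.
have hG : \forall e \near 0^'+, `|Gx e - (grad (ham sys) z)^T| <= C * e.
  near=> e; have e0' : 0 < e by near: e; exact: nbhs_right_gt.
  rewrite (@le_trans _ _ (CG * e))//; first by near: e.
  by rewrite ler_wpM2r ?(ltW e0')// le_max lexx orbT.
set u1 := ham_field sys z; pose u2 := 'D_1 zeta (ham sys z).
pose p := u2^T *m sympJ R n; pose kappa := m%:R * derive1 T (ham sys z).
have hp : p *m Pi = p + kappa *: (grad (ham sys) z)^T.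
  by rewrite hPi; exact: (family_covector hr0 hsys hm hx0 hx0z tau0 ptau hX0 hF).
have hpu : (p *m u1) 0 0 = -1.
  rewrite /p /u1 /ham_field -mulmxA [sympJ R n *m (_ *m _)]mulmxA sympJ_sqr mulNmx mul1mx.
  rewrite mulmxN mxE -[X in - X]/(inner u2 (grad (ham sys) z)) innerC.
  by rewrite (energy_normalization hr0 hsys hx0 hx0z hF).
have u10 : u1 != 0.
  by apply: contra_eq_neq hpu => ->; rewrite mulmx0 mxE eq_sym oppr_eq0 oner_neq0.
have Piu : Pi *m u1 = u1.
  have := orbit_velocity hr0 hsys hx0 hX0 (ltW S0).
  by rewrite hx0z -[X in x0 X]add0r periodic_nat// hx0z -hPi.
have hfix := simple_fixed_line hgeo u10 Piu.
have hdM : 0 < kappa * (Lh S *m u1) 0 0.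
  have <- : derive1 (melnikov sys m l tau x0) 0 = (Lh S *m u1) 0 0.
    by rewrite (melnikov_derive hr0 hsys pE cf cfX Dp hx0 hX0 d00 S0 erefl erefl Lh0 DLh) hx0z.
  by rewrite -mulrA mulr_gt0// ltr0n.
have contr (RV : 'M[R]_(n + n, 1.*2)) : 0 < volume_contraction sys m l tau x0 X0 RV ->
    (RV^T *m Ls S *m RV) 0 1 / (RV^T *m sympJ R n *m RV) 0 1 < 0.
  have Ed : d0 = m%:R * tau / l%:R by rewrite /d0 [tau * _]mulrC.
  rewrite (volume_contraction_drift hr0 hsys pE cfX hx0 hX0 d00 S0 RV erefl Ed Ls0 DLs).
  by rewrite mulNr oppr_gt0 pmulr_rlt0// invr_gt0.
have conjE (al be : R) : (Complex al be)^* = Complex al (- be) by [].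
have hreal (al : R) : eigenvalue (to_C Pi) (Complex al 0) -> al = 1.
  move=> ev; have [[]//|[j aE]] := spectrum_cases hspec ev.
  have : Complex al 0 = (Complex al 0)^* :> R[i] by rewrite conjE oppr0.
  case: aE => ->; rewrite ?conjCK => /eqP; first by rewrite (negPf (hlamC j j)).
  by rewrite eq_sym (negPf (hlamC j j)).
have hplane (al be : R) : eigenvalue (to_C Pi) (Complex al be) ->
    exists (RV : 'M[R]_(n + n, 1.*2)) (B : 'M[R]_(1.*2)),
     [/\ strongly_invariant Pi RV B, eigenvalue (to_C B) (Complex al be),
         eigenvalue (to_C B) (Complex al (- be)) &
         (RV^T *m Ls S *m RV) 0 1 / (RV^T *m sympJ R n *m RV) 0 1 < 0].
  rewrite -conjE => ev; have [aE|[j aE]] := spectrum_cases hspec ev.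
    exists RT, BT; rewrite aE; split; [exact: hT| | |exact: contr].
      by apply/hT1.
    by apply/hT1; rewrite conjC1.
  exists (RN j), (BN j); split; [exact: hN| | |exact: contr].
    by apply/hNlam.
  by apply/hNlam; case: aE => ->; [right|left; rewrite conjCK].
have mult := multipliers_in_disk (sympJ_tr R n) hA hG hL hrow hp hpu hfix hdM hreal hplane.
near=> e.
have e0' : 0 < e by near: e; exact: nbhs_right_gt.
have de : 0 < delta e by near: e.
have Hm : forall a : R[i], eigenvalue (to_C (A e)) a -> `|a| < 1 by near: e.
have ee : 0 < e < e0 by near: e.
have [Hx _ pe _] := hx e ee.
split=> //.
exact: (periodic_orbit_stable hr0 hsys hl de (ltW e0') Hx pe (hX e ee) Hm).
Unshelve. all: by end_near. Qed.
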